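(* For $a,b>0$ let $R_{a,b}=(-a,a)\times(-b,b)\subset\mathbb{R}^2$. Then for all $a,b>0$, $$\frac{\pi^2}{24}<F(R_{1,1})\leq F(R_{a,b})<\frac{\pi^{2}}{12},$$ and $\lim_{a\to\infty}F(R_{a,1})=\frac{\pi^{2}}{12}$. Moreover, the function $a\mapsto F(R_{a,1})$ is increasing for $a\geq 1$.
   Context: For a domain (open connected set) $D\subset\mathbb{R}^2$ of finite Lebesgue measure $|D|$, the torsion function $u_D$ is the unique weak solution in $H_0^1(D)$ of $\Delta u_D=-1$ in $D$; the torsional rigidity is $T(D)=\int_D u_D(x)\,dx$; $\lambda_1(D)$ is the first (smallest) Dirichlet eigenvalue of $-\Delta$ on $D$. The Pólya functional is $F(D)=\dfrac{\lambda_1(D)\,T(D)}{|D|}$. *)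

(* Defs.v *)
From HB Require Import structures.
From mathcomp Require Import all_boot all_order all_algebra.
From mathcomp Require Import all_classical all_reals all_analysis.
From mathcomp Require Import measurable_realfun.
Set Implicit Arguments.
Unset Strict Implicit.
Unset Printing Implicit Defensive.
Import Order.TTheory GRing.Theory Num.Theory.
Import numFieldNormedType.Exports.
Local Open Scope classical_set_scope.
Local Open Scope ring_scope.

Definition area {R : realType} :
  set (measurableTypeR R * measurableTypeR R) -> \bar R :=
  (@lebesgue_measure R \x @lebesgue_measure R)%E.
HB.instance Definition _ (R : realType) := Measure.on (@area R).

(* The two coordinates of the plane are indexed by bool:
   false is the first one, true the second one. *)
Definition dir (R : realType) (i : bool) : R * R :=
  if i then (0, 1) else (1, 0).

Definition partial (R : realType) (i : bool) (f : R * R -> R) : R * R -> R :=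
  fun p => 'D_(dir R i) f p.

(* C^oo: every iterated partial derivative of f exists and is continuous. *)
Definition smooth (R : realType) (f : R * R -> R) : Prop :=
  forall (s : seq bool) (p : R * R),
    {for p, continuous (foldr (@partial R) f s)} /\
    forall i : bool, derivable (foldr (@partial R) f s) p (dir R i).

Definition supp (R : realType) (f : R * R -> R) : set (R * R) :=
  closure [set p | f p != 0].

(* C_c^oo(D) *)
Definition test_function (R : realType) (D : set (R * R)) (phi : R * R -> R) :
    Prop :=
  [/\ smooth phi, compact (supp phi) & supp phi `<=` D].

Definition L2 (R : realType) (D : set (R * R)) (f : R * R -> R) : Prop :=
  measurable_fun D f /\ (\int[area]_(p in D) (f p ^+ 2)%:E < +oo)%E.

(* u belongs to H^1(D) and has weak gradient g. *)
Definition H1 (R : realType) (D : set (R * R)) (u : R * R -> R)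
    (g : bool -> R * R -> R) : Prop :=
  [/\ L2 D u,
      forall i, L2 D (g i) &
      forall phi i, test_function D phi ->
        \int[area]_(p in D) (u p * partial i phi p) =
        - \int[area]_(p in D) (g i p * phi p)].

(* u belongs to H^1_0(D), the closure of C_c^oo(D) in H^1(D), and has weak
   gradient g. *)
Definition H10 (R : realType) (D : set (R * R)) (u : R * R -> R)
    (g : bool -> R * R -> R) : Prop :=
  H1 D u g /\
  exists phi : nat -> R * R -> R,
    (forall n, test_function D (phi n)) /\
    (\int[area]_(p in D)
       ((phi n p - u p) ^+ 2
        + \sum_(i : bool) (partial i (phi n) p - g i p) ^+ 2)%:E)%E
      @[n --> \oo] --> (0 : \bar R)%E.

(* u in H^1_0(D) is a weak solution of - Laplacian u = f in D. *)
Definition weak_solution (R : realType) (D : set (R * R)) (u f : R * R -> R) :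
    Prop :=
  exists2 g, H10 D u g &
    forall phi, test_function D phi ->
      \int[area]_(p in D) (\sum_(i : bool) g i p * partial i phi p) =
      \int[area]_(p in D) (f p * phi p).

(* A representative of the torsion function, which is unique up to equality
   almost everywhere in D (cst 0 if there is no weak solution). *)
Definition torsion_function (R : realType) (D : set (R * R)) : R * R -> R :=
  xget (cst 0) [set u : R * R -> R | weak_solution D u (cst 1)].

Definition torsional_rigidity (R : realType) (D : set (R * R)) : R :=
  \int[area]_(p in D) torsion_function D p.

Definition dirichlet_eigenvalue (R : realType) (D : set (R * R)) (l : R) :
    Prop :=
  exists2 u : R * R -> R, weak_solution D u (fun p => l * u p) &
    ~ {ae area, forall p, D p -> u p = 0}.

(* The smallest Dirichlet eigenvalue (0 if there is none). *)
Definition lambda1 (R : realType) (D : set (R * R)) : R :=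
  xget 0 [set l | dirichlet_eigenvalue D l /\
                  forall m, dirichlet_eigenvalue D m -> l <= m].

(* The Polya functional; meaningful for D open, connected, of finite area. *)
Definition polya (R : realType) (D : set (R * R)) : R :=
  lambda1 D * torsional_rigidity D / fine (area D).

Definition rectangle (R : realType) (a b : R) : set (R * R) :=
  `]- a, a[%classic `*` `]- b, b[%classic.

(* Main.v *)
(* Write [m = 2 i + 1], [n = 2 j + 1] and [t = (a / b)^2]. Expanding in the
   eigenfunctions [cos (m pi x / 2 a) cos (n pi y / 2 b)] gives
     F(R_{a,b}) = 64 / pi^4 * \sum_(i, j) (1 + t) / (m^2 n^2 (m^2 + n^2 t)).
   The terms [(i, j)] and [(j, i)] add up to
     (m^2 + n^2) / (m^2 n^2 (m^2 n^2 + (m^2 - n^2)^2 s)),  s = t / (1 + t)^2,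
   which decreases in [s]. All claims follow: [s] is largest for [a = b],
   decreases in [a >= b] and tends to 0, and for [s = 0] the sum is
   (\sum 1 / m^2) (\sum 1 / m^4) = pi^2 / 8 * pi^4 / 96.

   The torsional rigidity is computed for an arbitrary weak solution [u]: if
   [v_N] is the [N]-th partial sum of the torsion series, then [- Laplacian v_N]
   is the partial Fourier sum [S_N] of the constant 1, so that
   [\int u S_N = \int v_N], and [S_N] tends to 1 in L^2 because
   [\sum 1 / m^2 = pi^2 / 8]. A weak solution exists because the torsion series
   and its termwise gradient converge absolutely and uniformly; it lies in H^1_0
   because smooth cutoffs of functions vanishing linearly at the boundary
   converge in H^1. The lower bound for the Dirichlet eigenvalues is the
   one-dimensional Poincare inequality, applied in each variable. *)
Require Import Defs.
From mathcomp Require Import all_boot all_order all_algebra.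
From mathcomp Require Import all_classical all_reals all_analysis.
From mathcomp Require Import measurable_realfun.
From mathcomp Require Import zify ring lra.
Set Implicit Arguments.
Unset Strict Implicit.
Unset Printing Implicit Defensive.
Import Order.TTheory GRing.Theory Num.Theory.
Import numFieldNormedType.Exports.
Local Open Scope classical_set_scope.
Local Open Scope ring_scope.

(** [torsion_function] and [lambda1] are chosen by [xget], so nothing can be said of them before
    existence is known: a weak solution has to be built, and the candidate for the first eigenvalue
    has to be both attained and a lower bound. Completeness of the cosine system is never invoked.
    The torsion equation cannot be tested against 1, which does not vanish on the boundary; it is
    tested against [v_N], and the equation of [v_N] against [u], so that the symmetry of the energy
    form links the two integrals. That [S_N] tends to 1 is then a numerical coincidence between
    [\sum 1 / m^2] and the area. This sum and [\sum 1 / m^4] come from a half-angle recursion for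
    sums of powers of cosecants. Adding transposed terms is essential for monotonicity: alone, the
    term [(i, j)] increases or decreases in [t] according to the sign of [m - n]. The bound
    [pi^2 / 24] needs only the leading term of the series, which gives [F >= 64 / pi^4], and the
    estimate [pi^2 <= 10]. *)

Local Notation plane R := (measurableTypeR R * measurableTypeR R)%type.

(** * Measurability and square-integrable functions in the plane *)

(** The sigma-algebra of [plane R] is a product, not one generated by open sets. Second countability
    reconciles the two: an open set is the union of the countably many rational rectangles that it
    contains. *)
Lemma open_prod_measurable (R : realType) (U : set (R * R)) :
  open U -> measurable (U : set (plane R)).
Proof.
move=> oU.
pose B (q : (rat * rat) * (rat * rat)) : set (plane R) :=
  `]ratr q.1.1, ratr q.1.2[ `*` `]ratr q.2.1, ratr q.2.2[.
have -> : U = \bigcup_(q in [set q | B q `<=` U]) B q.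
  apply/seteqP; split => [p Up|p [q /= qU] /qU //].
  have : nbhs p U by exact: open_nbhs_nbhs.
  rewrite -nbhs_ballE => -[/= e e0 eU].
  have ratin (x : R) : exists q1 q2 : rat,
      [/\ x - e < ratr q1 :> R, ratr q1 < x :> R, x < ratr q2 :> R & ratr q2 < x + e :> R].
    have [|q1] := @rat_in_itvoo R (x - e) x; first by rewrite ltrBlDr ltrDl.
    have [|q2] := @rat_in_itvoo R x (x + e); first by rewrite ltrDl.
    by rewrite !in_itv/= => /andP[? ?] /andP[? ?]; exists q1, q2.
  have [q1 [q2 [q1l q1x q2x q2l]]] := ratin p.1.
  have [q3 [q4 [q3l q3x q4x q4l]]] := ratin p.2.
  exists ((q1, q2), (q3, q4)); last by split; rewrite /= in_itv/= ?q1x ?q3x.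
  move=> z /= [/=]; rewrite !in_itv/= => /andP[z1 z2] /andP[z3 z4].
  by apply: eU; split; rewrite /ball/= ltr_distlC;
    apply/andP; split; [exact: lt_trans z1|exact: lt_trans z2 _|
      exact: lt_trans z3|exact: lt_trans z4 _].
rewrite bigcup_mkcond; apply: countable_bigcupT_measurable => [|q].
  exact: countableP.
case: ifPn => _; last exact: measurable0.
by apply: measurableX; exact: measurable_itv.
Qed.

Lemma continuous_plane_measurable (R : realType) (f : R * R -> R)
    (D : set (plane R)) :
  measurable D -> continuous f -> measurable_fun D (f : plane R -> R).
Proof.
move=> mD cf.
suff : measurable_fun [set: plane R] (f : plane R -> measurableTypeR R).
  by move=> mf; apply: measurable_funS mf.
apply: (measurability _ (@RGenOpens.measurableE R)) => /=.
move=> _ [_ [a [b ->] <-]]; rewrite setTI.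
apply: open_prod_measurable.
by apply: open_comp => //; move=> x _; exact: cf.
Qed.

Section square_integrable.
Variables (R : realType) (D : set (plane R)).
Hypotheses (mD : measurable D) (fD : (area D < +oo)%E).
Notation mu := (@area R).
Implicit Types f g : plane R -> R.

Lemma L2_sqr_integrable f : L2 D f -> mu.-integrable D (EFin \o (fun p => f p ^+ 2)%R).
Proof.
move=> [mf ff]; apply/integrableP; split.
  by apply/measurable_EFinP; exact: measurable_funX.
rewrite (eq_integral (fun p => (f p ^+ 2)%:E))// => p _.
by rewrite /= ger0_norm// sqr_ge0.
Qed.

Lemma L2_integrableM f g : L2 D f -> L2 D g ->
  mu.-integrable D (EFin \o (fun p => f p * g p)%R).
Proof.
move=> f2 g2.
apply: (@le_integrable _ _ _ mu D mD _
  (EFin \o (fun p => f p ^+ 2 + g p ^+ 2)%R)).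
- by apply/measurable_EFinP; apply: measurable_funM; [case: f2|case: g2].
- move=> p _ /=; rewrite lee_fin (@ger0_norm _ (_ + _)) ?addr_ge0 ?sqr_ge0//.
  rewrite ler_norml; apply/andP; split; nra.
- rewrite (_ : EFin \o _ = (EFin \o (fun p => f p ^+ 2)%R) \+ (EFin \o (fun p => g p ^+ 2)%R))%E//.
  by apply: integrableD => //; exact: L2_sqr_integrable.
Qed.

Lemma integrable_L2 f : measurable_fun D f ->
  mu.-integrable D (EFin \o (fun p => f p ^+ 2)%R) -> L2 D f.
Proof.
move=> mf /integrableP[_]; split => //.
rewrite (eq_integral (fun p => `|(EFin \o (fun p => f p ^+ 2)%R) p|%E))// => p _.
by rewrite /= ger0_norm// sqr_ge0.
Qed.

Lemma bounded_integrable f (M : R) : measurable_fun D f ->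
  (forall p, D p -> `|f p| <= M) -> mu.-integrable D (EFin \o f).
Proof.
move=> mf fM; apply: measurable_bounded_integrable => //.
exists M; split; first by rewrite num_real.
by move=> M' MM' p Dp; apply: (le_trans (fM _ Dp)); exact: ltW.
Qed.

Lemma bounded_L2 f (M : R) : measurable_fun D f ->
  (forall p, D p -> `|f p| <= M) -> L2 D f.
Proof.
move=> mf fM; apply: integrable_L2 => //.
apply: (@bounded_integrable _ (M ^+ 2)); first exact: measurable_funX.
move=> p /fM fpM; rewrite normrX lerXn2r// nnegrE//.
exact: le_trans fpM.
Qed.

Lemma L2D f g : L2 D f -> L2 D g -> L2 D (fun p => f p + g p).
Proof.
move=> f2 g2; apply: integrable_L2.
  by apply: measurable_funD; [case: f2|case: g2].
rewrite (_ : EFin \o _ = ((EFin \o (fun p => f p ^+ 2)%R) \+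
   (EFin \o (fun p => g p ^+ 2)%R)) \+ (EFin \o (fun p => (f p * g p) *+ 2)%R))%E.
  apply: integrableD => //.
    by apply: integrableD => //; exact: L2_sqr_integrable.
  rewrite (_ : EFin \o _ = (EFin \o (fun p => f p * g p)%R) \+ (EFin \o (fun p => f p * g p)%R))%E.
    by apply: integrableD => //; exact: L2_integrableM.
  by apply/funext => p /=; rewrite -EFinD -mulr2n.
by apply/funext => p /=; rewrite -!EFinD; congr EFin; ring.
Qed.

Lemma L2Z f (k : R) : L2 D f -> L2 D (fun p => k * f p).
Proof.
move=> f2; apply: integrable_L2.
  by apply: measurable_funM => //; case: f2.
rewrite (_ : EFin \o _ = (fun p => (k ^+ 2)%R%:E * (EFin \o (fun p => f p ^+ 2)%R) p))%E.
  by apply: integrableZl => //; exact: L2_sqr_integrable.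
by apply/funext => p /=; rewrite -EFinM; congr EFin; ring.
Qed.

Lemma L2B f g : L2 D f -> L2 D g -> L2 D (fun p => f p - g p).
Proof.
move=> f2 g2; rewrite (_ : (fun p => _) = (fun p => f p + (-1) * g p)).
  by apply: L2D => //; exact: L2Z.
by apply/funext => p; rewrite mulN1r.
Qed.

Lemma L2_cst (k : R) : L2 D (cst k).
Proof. by apply: (@bounded_L2 _ `|k|). Qed.

(** The polynomial [A + 2 t B + t^2 C], the integral of [(f + t g)^2], is nonnegative for every [t],
    so its discriminant is not positive. *)
Lemma Cauchy_Schwarz f g : L2 D f -> L2 D g ->
  (\int[mu]_(p in D) (f p * g p)) ^+ 2 <=
  \int[mu]_(p in D) (f p ^+ 2) * \int[mu]_(p in D) (g p ^+ 2).
Proof.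
move=> f2 g2.
set A := \int[mu]_(p in D) (f p ^+ 2); set C := \int[mu]_(p in D) (g p ^+ 2).
set B := \int[mu]_(p in D) (f p * g p).
have A0 : 0 <= A by apply: Rintegral_ge0 => p _; exact: sqr_ge0.
have C0 : 0 <= C by apply: Rintegral_ge0 => p _; exact: sqr_ge0.
have key (t : R) : 0 <= A + 2 * t * B + t ^+ 2 * C.
  have : 0 <= \int[mu]_(p in D) ((f p + t * g p) ^+ 2).
    by apply: Rintegral_ge0 => p _; exact: sqr_ge0.
  rewrite (_ : (fun p => (f p + t * g p) ^+ 2) =
     (fun p => f p ^+ 2 + ((2 * t) * (f p * g p) + t ^+ 2 * g p ^+ 2))); last first.
    by apply/funext => p; ring.
  have if2 := L2_sqr_integrable f2. have ig2 := L2_sqr_integrable g2.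
  have ifg := L2_integrableM f2 g2.
  have i1 : mu.-integrable D (EFin \o (fun p => 2 * t * (f p * g p))%R).
    by rewrite (_ : EFin \o _ = (fun p => (2 * t)%R%:E * (EFin \o (fun p => f p * g p)%R) p)%E);
      [exact: integrableZl|].
  have i2 : mu.-integrable D (EFin \o (fun p => t ^+ 2 * g p ^+ 2)%R).
    by rewrite (_ : EFin \o _ = (fun p => (t ^+ 2)%R%:E * (EFin \o (fun p => g p ^+ 2)%R) p)%E);
      [exact: integrableZl|].
  rewrite RintegralD//; last first.
    rewrite (_ : EFin \o _ = (EFin \o (fun p => 2 * t * (f p * g p))%R) \+
      (EFin \o (fun p => t ^+ 2 * g p ^+ 2)%R))%E//.
    exact: integrableD.
  by rewrite RintegralD// !RintegralZl// addrA.
have [C00|Cn0] := eqVneq C 0.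
  have [->|Bn0] := eqVneq B 0; first by rewrite expr0n/= mulr_ge0.
  (* For [C = 0] the polynomial is affine with slope [2 B]; at this [t] it would take the value
     -1. *)
  have := key (- (A + 1) / (2 * B)).
  rewrite C00 mulr0 addr0 (_ : A + _ = -1); last by field.
  by rewrite lerNr oppr0 ler10.
have Cp : 0 < C by rewrite lt_neqAle eq_sym Cn0.
have := key (- B / C).
rewrite (_ : A + _ + _ = (A * C - B ^+ 2) / C); last by field.
by rewrite pmulr_lge0 ?invr_gt0// subr_ge0.
Qed.

Lemma L2_cvgM (fn : nat -> plane R -> R) f g :
  (forall n, L2 D (fn n)) -> L2 D f -> L2 D g ->
  \int[mu]_(p in D) ((fn n p - f p) ^+ 2) @[n --> \oo] --> (0 : R) ->
  \int[mu]_(p in D) (fn n p * g p) @[n --> \oo] -->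
  \int[mu]_(p in D) (f p * g p).
Proof.
move=> fn2 f2 g2 fnf.
set C := \int[mu]_(p in D) (g p ^+ 2).
have C0 : 0 <= C by apply: Rintegral_ge0 => p _; exact: sqr_ge0.
set a := fun n => \int[mu]_(p in D) ((fn n p - f p) ^+ 2).
have a0 n : 0 <= a n by apply: Rintegral_ge0 => p _; exact: sqr_ge0.
have bnd n : `|\int[mu]_(p in D) (fn n p * g p) - \int[mu]_(p in D) (f p * g p)|
   <= Num.sqrt (a n * C).
  rewrite -RintegralB//; [|exact: L2_integrableM|exact: L2_integrableM].
  rewrite (_ : (fun p => _) = (fun p => (fn n p - f p) * g p)); last first.
    by apply/funext => p; ring.
  rewrite -ler_sqr ?nnegrE ?sqrtr_ge0//.
  rewrite sqr_sqrtr ?mulr_ge0//.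
  by rewrite real_normK ?num_real//; apply: Cauchy_Schwarz => //; exact: L2B.
apply/cvgrPdist_le => e e0.
have : Num.sqrt (a n * C) @[n --> \oo] --> Num.sqrt (0 * C).
  apply: continuous_cvg; first exact: sqrt_continuous.
  by apply: cvgMl.
rewrite mul0r sqrtr0 => /cvgrPdist_le /(_ e e0).
apply: filterS => n; rewrite sub0r normrN ger0_norm ?sqrtr_ge0//.
by move=> h; rewrite distrC (le_trans (bnd n)).
Qed.

(** Dominated convergence with a constant as dominating function, integrable because [D] has finite
    area. Measurability and the bound of the limit are returned as well, since they are what puts
    the limit in L^2. *)
Lemma bounded_cvg_integral (fn : nat -> plane R -> R) f (M : R) :
  (forall n, measurable_fun D (fn n)) ->
  (forall n p, D p -> `|fn n p| <= M) ->
  (forall p, D p -> fn n p @[n --> \oo] --> f p) ->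
  [/\ measurable_fun D f, (forall p, D p -> `|f p| <= M) &
    \int[mu]_(p in D) (fn n p) @[n --> \oo] --> \int[mu]_(p in D) (f p)].
Proof.
move=> mfn fnM fnf.
have mf : measurable_fun D f by apply: (measurable_fun_cvg mfn).
have fM p : D p -> `|f p| <= M.
  move=> Dp; have h : `|fn n p| @[n --> \oo] --> `|f p| by apply: cvg_norm; exact: fnf.
  rewrite -(cvg_lim (@Rhausdorff R) h); apply: limr_le; first exact: cvgP h.
  by apply: nearW => n; exact: fnM.
split => //.
have M0 : mu.-integrable D (EFin \o cst M).
  by apply: (@bounded_integrable _ `|M|).
have [||||_ _] := @dominated_convergence _ _ _ mu D mD (fun n => EFin \o fn n) (EFin \o f)
   (EFin \o cst M) _ _ _ M0.
- by move=> n; apply/measurable_EFinP.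
- exact/measurable_EFinP.
- by apply: aeW => p Dp; apply: cvg_EFin; [exact: nearW|exact: fnf].
- by apply: aeW => p n Dp; rewrite /= lee_fin; exact: fnM.
move=> h; apply: fine_cvg.
rewrite /Rintegral fineK; last first.
  by apply: integrable_fin_num => //; exact: (bounded_integrable mf fM).
exact: h.
Qed.

End square_integrable.

(** * Iterated integrals on rectangles *)

Lemma integral_setX12 (R : realType) (A B : set (measurableTypeR R))
    (f : plane R -> R) :
  measurable A -> measurable B ->
  area.-integrable (A `*` B) (EFin \o f) ->
  (\int[area]_(p in A `*` B) (f p)%:E =
   \int[lebesgue_measure]_(x in A) \int[lebesgue_measure]_(y in B) (f (x, y))%:E)%E.
Proof.
move=> mA mB intf; have mAB : measurable (A `*` B) by exact: measurableX.
have intf' : area.-integrable setT ((EFin \o f) \_ (A `*` B)).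
  by move: intf; rewrite (integrable_mkcond _ mAB).
rewrite integral_mkcond -[LHS](integral12_prod_meas1 intf').
rewrite [RHS]integral_mkcond; apply: eq_integral => x _.
rewrite /fubini_F patchE; case: ifPn => xA.
  rewrite [RHS]integral_mkcond; apply: eq_integral => y _.
  by rewrite !patchE in_setX /= xA.
rewrite -[RHS](integral0 lebesgue_measure setT); apply: eq_integral => y _.
by rewrite patchE in_setX (negbTE xA).
Qed.

Lemma integral_setX21 (R : realType) (A B : set (measurableTypeR R))
    (f : plane R -> R) :
  measurable A -> measurable B ->
  area.-integrable (A `*` B) (EFin \o f) ->
  (\int[area]_(p in A `*` B) (f p)%:E =
   \int[lebesgue_measure]_(y in B) \int[lebesgue_measure]_(x in A) (f (x, y))%:E)%E.
Proof.
move=> mA mB intf; have mAB : measurable (A `*` B) by exact: measurableX.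
have intf' : area.-integrable setT ((EFin \o f) \_ (A `*` B)).
  by move: intf; rewrite (integrable_mkcond _ mAB).
rewrite integral_mkcond -[LHS](integral21_prod_meas1 intf').
rewrite [RHS]integral_mkcond; apply: eq_integral => y _.
rewrite /fubini_G patchE; case: ifPn => yB.
  rewrite [RHS]integral_mkcond; apply: eq_integral => x _.
  by rewrite !patchE in_setX /= yB andbT.
rewrite -[RHS](integral0 lebesgue_measure setT); apply: eq_integral => x _.
by rewrite patchE in_setX (negbTE yB) andbF.
Qed.

Lemma Rintegral_tensor (R : realType) (A B : set (measurableTypeR R))
    (f g : measurableTypeR R -> R) :
  measurable A -> measurable B ->
  lebesgue_measure.-integrable B (EFin \o g) ->
  lebesgue_measure.-integrable A (EFin \o f) ->
  area.-integrable (A `*` B) (EFin \o (fun p => f p.1 * g p.2)) ->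
  \int[area]_(p in A `*` B) (f p.1 * g p.2) =
  \int[lebesgue_measure]_(x in A) f x * \int[lebesgue_measure]_(y in B) g y.
Proof.
move=> mA mB ig if_ intfg; rewrite /Rintegral integral_setX12//=.
under eq_integral => x _.
  under eq_integral => y _ do rewrite EFinM.
  rewrite integralZl// -[X in (_ * X)%E]fineK; last exact: integrable_fin_num.
  over.
by rewrite integralZr// fineM//; exact: integrable_fin_num.
Qed.

Definition half_width (R : realType) (a b : R) (i : bool) : R := if i then b else a.

(* [slice i s t] is the point with coordinate [t] in the direction [dir R i]
   and [s] in the other one. *)
Definition slice (R : realType) (i : bool) (s t : R) : R * R :=
  if i then (s, t) else (t, s).

Section rectangle.
Variables (R : realType) (a b : R).
Hypotheses (a0 : 0 < a) (b0 : 0 < b).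
Notation D := (rectangle a b : set (plane R)).
Notation mu := (@area R).
Notation side := (half_width a b).

Lemma half_width_gt0 i : 0 < side i. Proof. by case: i. Qed.

Lemma measurable_rectangle : measurable D.
Proof. by apply: measurableX; exact: measurable_itv. Qed.

Lemma area_rectangle : mu D = (4 * (a * b))%:E.
Proof.
rewrite /area product_measure1E; [|exact: measurable_itv|exact: measurable_itv].
rewrite [X in (X * _)%E]lebesgue_measure_itv [X in (_ * X)%E]lebesgue_measure_itv.
rewrite /= !lte_fin !gtrN// -!EFinD -EFinM; congr EFin; ring.
Qed.

Lemma area_rectangle_lty : (mu D < +oo)%E.
Proof. by rewrite area_rectangle ltry. Qed.

Lemma rectangle_slice i s t : D (slice i s t) <->
  (s \in `](- side (~~ i)), (side (~~ i))[) /\ (t \in `](- side i), (side i)[).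
Proof.
by case: i => /=; rewrite /rectangle/=; split => -[].
Qed.

(** On each slice [F] is a primitive of [f] that vanishes at both ends, so the slice integral is 0
    and Fubini concludes. Regularity of [F] is asked on closed slices only: in the Poincare
    inequality [F] contains a tangent that is not smooth on the whole line. *)
Lemma Rintegral_partial0 i (F f : R * R -> R) (M : R) :
  measurable_fun D (f : plane R -> R) ->
  (forall p, D p -> `|f p| <= M) ->
  (forall s t, s \in `](- side (~~ i)), (side (~~ i))[ ->
     t \in `[(- side i), (side i)] ->
     is_derive t 1 (fun t => F (slice i s t)) (f (slice i s t))) ->
  (forall s, s \in `](- side (~~ i)), (side (~~ i))[ ->
     {within `[(- side i), (side i)], continuous (fun t => f (slice i s t))}) ->
  (forall s, s \in `](- side (~~ i)), (side (~~ i))[ ->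
     F (slice i s (side i)) = 0 /\ F (slice i s (- side i)) = 0) ->
  \int[mu]_(p in D) f p = 0.
Proof.
move=> mf fM dF cf F0.
have intf : mu.-integrable D (EFin \o f).
  exact: (bounded_integrable measurable_rectangle area_rectangle_lty mf fM).
have slice0 s : s \in `](- side (~~ i)), (side (~~ i))[ ->
    (\int[lebesgue_measure]_(t in `](- side i)%R, (side i)%R[)
       (f (slice i s t))%:E = 0)%E.
  move=> sI; have i0 := half_width_gt0 i.
  have lt_ : - side i < side i by rewrite gtrN.
  rewrite -(@integral_itv_bndoo _ _ _ _ true false); last first.
    apply/measurable_EFinP.
    apply: (@measurable_funS _ _ _ _ `[(- side i), (side i)]%classic) => //.
      exact: subset_itv_oo_cc.
    by apply: subspace_continuous_measurable_fun => //; exact: cf.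
  rewrite (@continuous_FTC2 _ _ (fun t => F (slice i s t)))//.
  - by rewrite !(F0 _ sI).1 !(F0 _ sI).2 subee.
  - exact: cf.
  - have cF t : t \in `[(- side i), (side i)] -> {for t, continuous (fun t => F (slice i s t))}.
      move=> /(dF _ _ sI) [dFt _]; apply/differentiable_continuous.
      exact/derivable1_diffP.
    split.
    + move=> t tI; have [|//] := dF s t sI _.
      by move: tI; rewrite inE/= !in_itv/= => /andP[/ltW -> /ltW ->].
    + by apply: cvg_at_right_filter; apply: cF; rewrite in_itv/= lexx (ltW lt_).
    + by apply: cvg_at_left_filter; apply: cF; rewrite in_itv/= lexx (ltW lt_).
  - move=> t tI; rewrite derive1E; apply: derive_val.
    by apply: dF => //; move: tI; rewrite !in_itv/= => /andP[/ltW -> /ltW ->].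
rewrite /Rintegral.
case: i {dF cf F0} slice0 => slice0.
  rewrite integral_setX12//.
  by rewrite integral0_eq//= => s sI; exact: slice0.
rewrite integral_setX21//.
by rewrite integral0_eq//= => s sI; exact: slice0.
Qed.

End rectangle.

(** * Sums of inverse powers of the odd integers *)

Section sine_bounds.
Variable R : realType.
Implicit Types x c : R.

Lemma ge0_derive_ge0 (f g : R -> R) c :
  (forall x, is_derive x 1 f (g x)) -> f 0 = 0 ->
  (forall x, 0 < x < c -> 0 <= g x) -> forall x, 0 <= x <= c -> 0 <= f x.
Proof.
move=> df f0 g0 x /andP[x0 xc]; rewrite -f0.
apply: (@ger0_derive1_ndecr _ f 0 c) => // [y yc|].
- by rewrite derive1E (@derive_val _ _ _ _ _ _ _ (df y)) g0.
- apply: continuous_subspaceT => y; apply/differentiable_continuous.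
  by apply/derivable1_diffP; have [] := df y.
Qed.

Lemma sin_le x : 0 <= x -> sin x <= x.
Proof.
move=> x0; rewrite -subr_ge0.
have df (y : R) : is_derive y 1 (fun y => y - sin y) (1 - cos y) by exact: is_deriveB.
apply: (ge0_derive_ge0 df _ _ (c := x)); first by rewrite sin0 subr0.
  by move=> y _; rewrite subr_ge0 cos_le1.
by rewrite x0 lexx.
Qed.

Lemma mul_cos_le_sin x : 0 <= x <= pi -> x * cos x <= sin x.
Proof.
move=> x0; rewrite -subr_ge0.
have df (y : R) : is_derive y 1 (fun y => sin y - y * cos y) (y * sin y).
  by apply: is_derive_eq; rewrite /GRing.scale/=; ring.
apply: (ge0_derive_ge0 df _ _ (c := pi)) => //; first by rewrite sin0 mul0r subr0.
by move=> y /andP[y0 ypi]; rewrite mulr_ge0 ?ltW// sin_gt0_pi// y0 ypi.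
Qed.

(** Squaring [x cos x <= sin x] and eliminating the cosine gives [x^2 <= (1 + x^2) sin^2 x]. The
    error 1 is uniform in [x]: over [N] angles it adds up to [N], negligible against a sum of order
    [N^2]. *)
Lemma csc2_bounds x : 0 < x < pi / 2 ->
  x ^- 2 <= (sin x) ^- 2 <= 1 + x ^- 2.
Proof.
move=> /andP[x0 xpi]; have pi0 := pi_gt0 R.
have s0 : 0 < sin x by apply: sin_gt0_pihalf; rewrite x0.
have sx := sin_le (ltW x0).
have xc : x * cos x <= sin x by apply: mul_cos_le_sin; lra.
have c0 : 0 < cos x by apply: cos_gt0_pihalf; lra.
apply/andP; split.
  by rewrite lef_pV2 ?posrE ?exprn_gt0// ler_sqr ?nnegrE// ltW.
have -> : 1 + x ^- 2 = (x ^+ 2 + 1) / x ^+ 2 by field; rewrite gt_eqF.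
rewrite ler_pdivlMr ?exprn_gt0// mulrC ler_pdivrMr ?exprn_gt0//.
have : (x * cos x) ^+ 2 <= sin x ^+ 2.
  by rewrite ler_sqr ?nnegrE ?mulr_ge0// ltW.
rewrite exprMn; have := cos2Dsin2 x; nra.
Qed.

End sine_bounds.

Section odd_series.
Variable R : realType.

Definition oddr (k : nat) : R := (k.*2.+1)%:R.

Lemma oddrE k : oddr k = 2 * k%:R + 1.
Proof. by rewrite /oddr -natr1 -muln2 natrM mulrC. Qed.

Lemma oddr_gt0 k : 0 < oddr k. Proof. by rewrite ltr0n. Qed.
Lemma oddr_neq0 k : oddr k != 0. Proof. by rewrite gt_eqF// oddr_gt0. Qed.
Lemma oddr_ge1 k : 1 <= oddr k. Proof. by rewrite ler1n. Qed.
Lemma oddr_inj : injective oddr.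
Proof. by move=> i j /eqP; rewrite eqr_nat => /eqP[]; lia. Qed.

Definition odd_sum (p N : nat) : R := \sum_(k < N) (oddr k) ^- p.

(** These [N] angles lie in []0, pi / 2[] and are proportional to the odd integers. Since the sine
    is close to its argument near 0, [csc_sum p N] is comparable to [(4 N / pi)^p] times
    [odd_sum p N]. *)
Let angle (N k : nat) : R := oddr k * pi / (4 * N%:R).
Let csc_sum (p N : nat) : R := \sum_(k < N) (sin (angle N k)) ^- p.

Lemma sum_fold (N : nat) (f : nat -> R) :
  \sum_(k < N + N) f k = \sum_(k < N) (f k + f (N + N - k.+1)%N).
Proof.
rewrite big_split_ord big_split/=; congr +%R.
rewrite (reindex_inj rev_ord_inj)/=; apply: eq_bigr => k _; congr f.
by have := ltn_ord k; lia.
Qed.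

Let angle_lt N k : (0 < N)%N -> (k < N)%N -> 0 < angle N k < pi / 2.
Proof.
move=> N0 kN; have N0' : 0 < N%:R :> R by rewrite ltr0n.
have pi0 := pi_gt0 R.
rewrite /angle divr_gt0 ?mulr_gt0 ?oddr_gt0//=.
rewrite ltr_pdivrMr ?mulr_gt0//.
have : oddr k < 2 * N%:R by rewrite /oddr -natrM ltr_nat; lia.
by move=> h; nra.
Qed.

(* The half-angle step: the angles at level [2 N] are the halves [x / 2] of
   the angles [x] at level [N] together with their complements. *)
Let csc_sum_double p N : (0 < N)%N -> csc_sum p (N + N) =
  \sum_(k < N) ((sin (angle N k / 2)) ^- p + (cos (angle N k / 2)) ^- p).
Proof.
move=> N0; rewrite /csc_sum (sum_fold N (fun k => (sin (angle (N + N) k)) ^- p)).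
have N0' : N%:R != 0 :> R by rewrite pnatr_eq0 -lt0n.
apply: eq_bigr => k _.
have -> : angle (N + N) k = angle N k / 2 by rewrite /angle natrD; field; rewrite N0' -mulr2n mulrn_eq0.
have -> : angle (N + N) (N + N - k.+1) = pi / 2 - angle N k / 2.
  rewrite /angle !oddrE natrB ?natrD; last by have := ltn_ord k; lia.
  by rewrite -natr1; field; rewrite N0' -mulr2n mulrn_eq0.
by rewrite sinB sin_pihalf cos_pihalf mul1r mul0r subr0.
Qed.

Let half_angle N k : (0 < N)%N -> (k < N)%N ->
  [/\ sin (angle N k / 2) != 0, cos (angle N k / 2) != 0,
    sin (angle N k) = 2 * sin (angle N k / 2) * cos (angle N k / 2) &
    sin (angle N k / 2) ^+ 2 = 1 - cos (angle N k / 2) ^+ 2].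
Proof.
move=> N0 kN; have /andP[h1 h2] := angle_lt N0 kN.
have pi0 := pi_gt0 R; split.
- by rewrite gt_eqF//; apply: sin_gt0_pihalf; lra.
- by rewrite gt_eqF//; apply: cos_gt0_pihalf; lra.
- rewrite [in LHS](_ : angle N k = (angle N k / 2) *+ 2); last by rewrite -mulr_natr; field.
  by rewrite sin_mulr2n -mulr_natr; ring.
- by rewrite sin2cos2.
Qed.

(** With [s] and [c] the sine and cosine of the half angle, [1 / s^2 + 1 / c^2 = 1 / (s c)^2], which
    is 4 over the squared sine of the full angle. *)
Let csc_sum2_double N : (0 < N)%N -> csc_sum 2 (N + N) = 4 * csc_sum 2 N.
Proof.
move=> N0; rewrite csc_sum_double// /csc_sum mulr_sumr; apply: eq_bigr => k _.
have [s0 c0 -> s2] := half_angle N0 (ltn_ord k).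
set s := sin _ in s0 s2 *; set c := cos _ in c0 s2 *.
have -> : s ^- 2 + c ^- 2 = (s ^+ 2 + c ^+ 2) / (s ^+ 2 * c ^+ 2) by field; rewrite s0 c0.
rewrite (_ : s ^+ 2 + _ = 1); last by rewrite s2 subrK.
by field; rewrite s0 c0.
Qed.

(** Here [1 / s^4 + 1 / c^4 = (1 - 2 s^2 c^2) / (s c)^4] with [2 s c] the sine of the full angle;
    the correction term brings in the squares. *)
Let csc_sum4_double N : (0 < N)%N ->
  csc_sum 4 (N + N) = 16 * csc_sum 4 N - 8 * csc_sum 2 N.
Proof.
move=> N0; rewrite csc_sum_double// /csc_sum !mulr_sumr -sumrB.
apply: eq_bigr => k _.
have [s0 c0 -> s2] := half_angle N0 (ltn_ord k).
set s := sin _ in s0 s2 *; set c := cos _ in c0 s2 *.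
have -> : s ^- 4 + c ^- 4 = ((s ^+ 2 + c ^+ 2) ^+ 2 - 2 * (s ^+ 2 * c ^+ 2)) / (s ^+ 4 * c ^+ 4).
  by field; rewrite s0 c0.
have -> : s ^+ 2 + c ^+ 2 = 1 by rewrite s2 subrK.
by field; rewrite s0 c0.
Qed.

(** Solves the two doubling recursions, started from the single angle [pi / 4], whose squared sine
    is 1/2. *)
Let csc_sumE n : csc_sum 2 (2 ^ n) = 2 * (2 ^+ n) ^+ 2 /\
  csc_sum 4 (2 ^ n) = (8 * (2 ^+ n) ^+ 4 + 4 * (2 ^+ n) ^+ 2) / 3.
Proof.
elim: n => [|n [IH2 IH4]].
  have e : sin (angle 1 0) ^+ 2 = 1 / 2.
    have -> : angle 1 0 = pi / 4 by rewrite /angle oddrE mulr0 add0r mul1r mulr1.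
    have := cos_mulr2n (pi / 4 : R).
    have -> : (pi / 4 : R) *+ 2 = pi / 2 by rewrite -mulr_natr; field.
    rewrite cos_pihalf sin2cos2 mulr2n; lra.
  have e' : sin (angle 1 0) ^- 2 = 2 by rewrite e; field.
  rewrite !expn0 /csc_sum !big_ord1 e' !expr0 !expr1n; split; first by field.
  by rewrite (exprM _ 2 2) e; field.
have n0 : (0 < 2 ^ n)%N by rewrite expn_gt0.
rewrite expnS mul2n -addnn csc_sum2_double// csc_sum4_double// IH2 IH4 !exprS.
by split; field.
Qed.

Let scale_sum p N : (0 < N)%N ->
  \sum_(k < N) (angle N k) ^- p = (4 * N%:R / pi) ^+ p * odd_sum p N.
Proof.
move=> N0; have N0' : N%:R != 0 :> R by rewrite pnatr_eq0 -lt0n.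
have pi0 : pi != 0 :> R by rewrite gt_eqF// pi_gt0.
rewrite /odd_sum mulr_sumr; apply: eq_bigr => k _.
rewrite -[in LHS]exprVn -[in RHS]exprVn -exprMn; congr (_ ^+ _).
rewrite /angle; move: (oddr k) (oddr_neq0 k) (pi : R) pi0 => o o0 P P0; field.
by rewrite N0' o0 P0.
Qed.

Let odd_sum2_bounds N : (0 < N)%N ->
  csc_sum 2 N - N%:R <= (4 * N%:R / pi) ^+ 2 * odd_sum 2 N <= csc_sum 2 N.
Proof.
move=> N0; rewrite -scale_sum// /csc_sum; apply/andP; split.
  rewrite lerBlDl -[X in X%:R]card_ord -sum1_card natr_sum -big_split/=.
  by apply: ler_sum => k _; have /andP[] := csc2_bounds (angle_lt N0 (ltn_ord k)).
by apply: ler_sum => k _; have /andP[] := csc2_bounds (angle_lt N0 (ltn_ord k)).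
Qed.

(** The lower bound squares [csc2_bounds]: [csc^4 <= (1 + x^-2)^2 <= 1 + 2 csc^2 + x^-4]. *)
Let odd_sum4_bounds N : (0 < N)%N ->
  csc_sum 4 N - N%:R - 2 * csc_sum 2 N <=
  (4 * N%:R / pi) ^+ 4 * odd_sum 4 N <= csc_sum 4 N.
Proof.
move=> N0; rewrite -scale_sum// /csc_sum; apply/andP; split.
  rewrite -addrA -opprD lerBlDl -[X in X%:R]card_ord -sum1_card natr_sum.
  rewrite mulr_sumr -!big_split/=.
  apply: ler_sum => k _; have /andP[] := csc2_bounds (angle_lt N0 (ltn_ord k)).
  rewrite -!exprVn !(exprM _ 2 2).
  set u := _^-1 ^+ 2; set v := _^-1 ^+ 2; have : 0 <= v by exact: sqr_ge0.
  by nra.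
apply: ler_sum => k _; have /andP[] := csc2_bounds (angle_lt N0 (ltn_ord k)).
rewrite -!exprVn !(exprM _ 2 2) => h _.
by rewrite ler_sqr ?nnegrE ?sqr_ge0.
Qed.

Lemma odd_sum_nd p : nondecreasing_seq (odd_sum p).
Proof.
apply/nondecreasing_seqP => n; rewrite /odd_sum big_ord_recr/= lerDl.
by rewrite invr_ge0 exprn_ge0// ltW// oddr_gt0.
Qed.

(** The closed forms of the cosecant sums exist only along powers of two; monotonicity recovers the
    whole sequence. *)
Lemma nondecreasing_subseq_cvg (u : nat -> R) (l : R) :
  nondecreasing_seq u -> u (2 ^ n)%N @[n --> \oo] --> l ->
  u n @[n --> \oo] --> l.
Proof.
move=> nd ul.
have le_l n : u n <= l.
  have nd2 : nondecreasing_seq (fun n => u (2 ^ n)%N).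
    by move=> i j ij; apply: nd; rewrite leq_exp2l.
  have -> : l = lim (u (2 ^ n)%N @[n --> \oo]) by rewrite (cvg_lim (@Rhausdorff R) ul).
  apply: le_trans (nondecreasing_cvgn_le nd2 _ n); last exact: cvgP ul.
  by apply: nd; apply: ltnW; exact: ltn_expl.
apply/cvgrPdist_le => e e0.
move/cvgrPdist_le : ul => /(_ e e0) [N _ /(_ N (leqnn N)) h].
exists (2 ^ N)%N => // n /= Nn.
rewrite ger0_norm ?subr_ge0//; move: h; rewrite ger0_norm ?subr_ge0// => h.
by apply: le_trans h; rewrite lerB//; exact: nd.
Qed.

Let cvg_inv2 : (2 ^- n : R) @[n --> \oo] --> (0 : R).
Proof.
rewrite (_ : (fun n => _) = (fun n => 2^-1 ^+ n)); last by apply/funext => n; rewrite exprVn.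
by apply: cvg_expr; rewrite ger0_norm// invf_lt1// ltr1n.
Qed.

Lemma odd_sum2_cvg : odd_sum 2 n @[n --> \oo] --> (pi ^+ 2 / 8 : R).
Proof.
apply: nondecreasing_subseq_cvg; first exact: odd_sum_nd.
have pi0 := pi_gt0 R.
(* For [x = 2^n] the cosecant sum is [2 x^2] with error at most [x]; dividing by [(4 x / pi)^2]
   yields these two functions. *)
apply: (@squeeze_cvgr _ _ _ _ (fun n => pi ^+ 2 / 8 - pi ^+ 2 / 16 * 2 ^- n)
  (fun n => pi ^+ 2 / 8)); last exact: cvg_cst; last first.
  rewrite -[X in _ --> X]subr0 -[X in _ - X](mulr0 (pi ^+ 2 / 16)).
  by apply: cvgB; [exact: cvg_cst|apply: cvgM; [exact: cvg_cst|exact: cvg_inv2]].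
apply: nearW => n; have n0 : (0 < 2 ^ n)%N by rewrite expn_gt0.
have := odd_sum2_bounds n0; rewrite (csc_sumE n).1 natrX.
set x := 2 ^+ n; have x0 : 0 < x by rewrite exprn_gt0.
set S := odd_sum 2 _; move: (pi : R) pi0 => P P0 /andP[h1 h2].
have e : S = (4 * x / P) ^+ 2 * S * (P / (4 * x)) ^+ 2.
  by field; rewrite ?(gt_eqF P0) ?(gt_eqF x0).
have p0 : 0 <= (P / (4 * x)) ^+ 2 by exact: sqr_ge0.
apply/andP; split; rewrite e.
  apply: le_trans (ler_wpM2r p0 h1).
  by rewrite le_eqVlt; apply/orP; left; apply/eqP; field; rewrite ?(gt_eqF P0) ?(gt_eqF x0).
apply: le_trans (ler_wpM2r p0 h2) _.
by rewrite le_eqVlt; apply/orP; left; apply/eqP; field; rewrite ?(gt_eqF P0) ?(gt_eqF x0).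
Qed.

Lemma odd_sum4_cvg : odd_sum 4 n @[n --> \oo] --> (pi ^+ 4 / 96 : R).
Proof.
apply: nondecreasing_subseq_cvg; first exact: odd_sum_nd.
have pi0 := pi_gt0 R.
(* For [x = 2^n] the bounds are weakened to [8/3 x^4 - 4 x^3] and [8/3 x^4 + 4/3 x^3], then divided
   by [(4 x / pi)^4]. *)
apply: (@squeeze_cvgr _ _ _ _ (fun n => pi ^+ 4 / 96 - pi ^+ 4 / 64 * 2 ^- n)
  (fun n => pi ^+ 4 / 96 + pi ^+ 4 / 192 * 2 ^- n)).
- apply: nearW => n; have n0 : (0 < 2 ^ n)%N by rewrite expn_gt0.
  have := odd_sum4_bounds n0; rewrite (csc_sumE n).1 (csc_sumE n).2 natrX.
  set x := 2 ^+ n; have x1 : 1 <= x by rewrite exprn_ege1// ler1n.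
  have x0 : 0 < x by apply: lt_le_trans x1.
  set S := odd_sum 4 _; move: (pi : R) pi0 => P P0 /andP[h1 h2].
  have e : S = (4 * x / P) ^+ 4 * S * (P / (4 * x)) ^+ 4.
    by field; rewrite ?(gt_eqF P0) ?(gt_eqF x0).
  have p0 : 0 <= (P / (4 * x)) ^+ 4 by rewrite exprn_ge0// divr_ge0 ?mulr_ge0 ?ltW.
  have x2 : x <= x ^+ 2 by nra.
  have x3 : x ^+ 2 <= x ^+ 3 by nra.
  apply/andP; split; rewrite e.
    apply: le_trans (ler_wpM2r p0 h1).
    have -> : P ^+ 4 / 96 - P ^+ 4 / 64 * x^-1 =
      (8 / 3 * x ^+ 4 - 4 * x ^+ 3) * (P / (4 * x)) ^+ 4 by field; rewrite ?(gt_eqF x0).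
    by apply: ler_wpM2r => //; lra.
  apply: le_trans (ler_wpM2r p0 h2) _.
  have -> : P ^+ 4 / 96 + P ^+ 4 / 192 * x^-1 =
      (8 / 3 * x ^+ 4 + 4 / 3 * x ^+ 3) * (P / (4 * x)) ^+ 4 by field; rewrite ?(gt_eqF x0).
  by apply: ler_wpM2r => //; lra.
- rewrite -[X in _ --> X]subr0 -[X in _ - X](mulr0 (pi ^+ 4 / 64)).
  by apply: cvgB; [exact: cvg_cst|apply: cvgM; [exact: cvg_cst|exact: cvg_inv2]].
- rewrite -[X in _ --> X]addr0 -[X in _ + X](mulr0 (pi ^+ 4 / 192)).
  by apply: cvgD; [exact: cvg_cst|apply: cvgM; [exact: cvg_cst|exact: cvg_inv2]].
Qed.

End odd_series.

(** * The symmetrized double series *)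

Section lattice_sum.
Variable R : realType.
Notation oddr := (@oddr R).
Implicit Types s t : R.

(* The terms [(i, j)] and [(j, i)] of the double series for the Polya functional,
   added up. *)
Definition sym_term s (i j : nat) : R :=
  let m := oddr i ^+ 2 in let n := oddr j ^+ 2 in
  (m + n) / (m * n * (m * n + (m - n) ^+ 2 * s)).

(** The factor 1/2 compensates that a sum over the whole square meets both [(i, j)] and [(j, i)]. *)
Definition lattice_sum s (N : nat) : R :=
  2^-1 * \sum_(i < N) \sum_(j < N) sym_term s i j.

Lemma oddr2_gt0 i : 0 < oddr i ^+ 2.
Proof. by rewrite exprn_gt0// oddr_gt0. Qed.

Lemma sym_term_ge0 s i j : 0 <= s -> 0 <= sym_term s i j.
Proof.
move=> s0; have m0 := oddr2_gt0 i; have n0 := oddr2_gt0 j.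
rewrite /sym_term divr_ge0// ?addr_ge0 ?mulr_ge0 ?ltW//.
by rewrite ltr_wpDr ?mulr_gt0// mulr_ge0// sqr_ge0.
Qed.

Lemma lattice_sumE t N : 0 < t ->
  \sum_(i < N) \sum_(j < N)
    (1 + t) / (oddr i ^+ 2 * oddr j ^+ 2 * (oddr i ^+ 2 + oddr j ^+ 2 * t)) =
  lattice_sum (t / (1 + t) ^+ 2) N.
Proof.
move=> t0; set S := LHS.
suff : S + S = \sum_(i < N) \sum_(j < N) sym_term (t / (1 + t) ^+ 2) i j.
  by rewrite /lattice_sum => <-; field.
rewrite {2}/S exchange_big/= -big_split/=; apply: eq_bigr => i _.
rewrite -big_split/=; apply: eq_bigr => j _.
rewrite /sym_term; move: (oddr2_gt0 i) (oddr2_gt0 j).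
move: (oddr i ^+ 2) (oddr j ^+ 2) => m n m0 n0.
have d1 : m + n * t != 0 by rewrite gt_eqF// addr_gt0// mulr_gt0.
have d2 : n + m * t != 0 by rewrite gt_eqF// addr_gt0// mulr_gt0.
have d3 : 1 + t != 0 by rewrite gt_eqF// addr_gt0.
(* This factorization is the reason for the parameter [t / (1 + t)^2]: the two transposed
   denominators multiply to a function of it. *)
have -> : m * n + (m - n) ^+ 2 * (t / (1 + t) ^+ 2) =
    (m + n * t) * (n + m * t) / (1 + t) ^+ 2 by field.
field.
by rewrite d1 d2 d3 !gt_eqF.
Qed.

Lemma sym_term_anti s s' i j : 0 <= s -> s <= s' ->
  sym_term s' i j <= sym_term s i j.
Proof.
move=> s0 ss'; have m0 := oddr2_gt0 i; have n0 := oddr2_gt0 j.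
have mn0 := mulr_gt0 m0 n0.
rewrite /sym_term ler_wpM2l//; first by rewrite addr_ge0 ?ltW.
have d0 : 0 < oddr i ^+ 2 * oddr j ^+ 2 + (oddr i ^+ 2 - oddr j ^+ 2) ^+ 2 * s.
  by rewrite ltr_wpDr// mulr_ge0// sqr_ge0.
have dd : (oddr i ^+ 2 - oddr j ^+ 2) ^+ 2 * s <= (oddr i ^+ 2 - oddr j ^+ 2) ^+ 2 * s'.
  by rewrite ler_wpM2l// sqr_ge0.
rewrite lef_pV2 ?posrE ?mulr_gt0//; first by rewrite ler_pM2l// lerD2l.
by rewrite (lt_le_trans d0)// lerD2l.
Qed.

Lemma lattice_sum_anti s s' N : 0 <= s -> s <= s' ->
  lattice_sum s' N <= lattice_sum s N.
Proof.
move=> s0 ss'; rewrite /lattice_sum ler_wpM2l//.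
by apply: ler_sum => i _; apply: ler_sum => j _; exact: sym_term_anti.
Qed.

Lemma lattice_sum_nd s : 0 <= s -> nondecreasing_seq (lattice_sum s).
Proof.
move=> s0; apply/nondecreasing_seqP => n; rewrite /lattice_sum ler_wpM2l//.
rewrite big_ord_recr/= -[leLHS]addr0 lerD//; last first.
  by apply: sumr_ge0 => j _; exact: sym_term_ge0.
apply: ler_sum => i _; rewrite big_ord_recr/= lerDl; exact: sym_term_ge0.
Qed.

(** At [s = 0] the symmetric term splits into [1 / (m n^2) + 1 / (m^2 n)], with [m], [n] squares of
    odd integers, and each half factorizes. *)
Lemma lattice_sum0E N : lattice_sum 0 N = odd_sum R 2 N * odd_sum R 4 N.
Proof.
pose f (i j : nat) : R := oddr i ^- 2 * oddr j ^- 4.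
have -> : odd_sum R 2 N * odd_sum R 4 N = \sum_(i < N) \sum_(j < N) f i j.
  rewrite /odd_sum mulr_suml; apply: eq_bigr => i _.
  by rewrite mulr_sumr.
set S := RHS.
suff : S + S = \sum_(i < N) \sum_(j < N) sym_term 0 i j.
  by rewrite /lattice_sum => <-; field.
rewrite {2}/S exchange_big/= -big_split/=; apply: eq_bigr => i _.
rewrite -big_split/=; apply: eq_bigr => j _.
rewrite /sym_term /f mulr0 addr0.
move: (oddr_neq0 R i) (oddr_neq0 R j); move: (oddr i) (oddr j) => m n m0 n0.
by field; rewrite m0 n0.
Qed.

Lemma lattice_sum0_cvg : lattice_sum 0 n @[n --> \oo] --> (pi ^+ 6 / 768 : R).
Proof.
have -> : (pi ^+ 6 / 768 : R) = pi ^+ 2 / 8 * (pi ^+ 4 / 96).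
  by move: (pi : R) => P; field.
under eq_fun do rewrite lattice_sum0E.
by apply: cvgM; [exact: odd_sum2_cvg|exact: odd_sum4_cvg].
Qed.

Lemma lattice_sum0_le N : lattice_sum 0 N <= pi ^+ 6 / 768.
Proof.
rewrite -(cvg_lim (@Rhausdorff R) lattice_sum0_cvg).
apply: nondecreasing_cvgn_le; first exact: lattice_sum_nd.
exact: cvgP lattice_sum0_cvg.
Qed.

Definition lattice_lim s : R := limn (lattice_sum s).

Lemma lattice_lim_cvg s : 0 <= s -> lattice_sum s n @[n --> \oo] --> lattice_lim s.
Proof.
move=> s0; suff : cvgn (lattice_sum s) by [].
apply: nondecreasing_is_cvgn; first exact: lattice_sum_nd.
exists (pi ^+ 6 / 768) => _ [n _ <-].
by apply: le_trans (lattice_sum0_le n); exact: lattice_sum_anti.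
Qed.

Lemma lattice_lim_ge s N : 0 <= s -> lattice_sum s N <= lattice_lim s.
Proof.
move=> s0; apply: nondecreasing_cvgn_le; first exact: lattice_sum_nd.
exact: cvgP (lattice_lim_cvg s0).
Qed.

Lemma lattice_lim0 : lattice_lim 0 = pi ^+ 6 / 768.
Proof. exact: cvg_lim lattice_sum0_cvg. Qed.

Lemma lattice_lim_ge1 s : 0 <= s -> 1 <= lattice_lim s.
Proof.
move=> s0; apply: le_trans (lattice_lim_ge 1 s0).
rewrite /lattice_sum !big_ord1 /sym_term oddrE mulr0 add0r expr1n subrr expr0n/=.
by rewrite mul0r addr0 !mulr1 invr1 mulr1 mulVf.
Qed.

(** Diagonal terms do not depend on [s]. The term [(0, 1)] is the first that strictly decreases, and
    its gain [c] survives in every partial sum with at least two indices, hence in the limit. *)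
Lemma lattice_lim_decr s s' : 0 <= s -> s < s' -> lattice_lim s' < lattice_lim s.
Proof.
move=> s0 ss'; have s'0 : 0 <= s' by rewrite (le_trans s0)// ltW.
pose c := 2^-1 * (sym_term s 0 1 - sym_term s' 0 1).
have c0 : 0 < c.
  rewrite mulr_gt0// subr_gt0 /sym_term !oddrE mulr0 add0r mulr1.
  rewrite ltr_pM2l; last by lra.
  by rewrite ltf_pV2 ?posrE; lra.
suff : c <= lattice_lim s - lattice_lim s' by move=> h; rewrite -subr_gt0; exact: lt_le_trans h.
have h : (lattice_sum s n - lattice_sum s' n) @[n --> \oo] --> lattice_lim s - lattice_lim s'.
  by apply: cvgB; exact: lattice_lim_cvg.
rewrite -(cvg_lim (@Rhausdorff R) h); apply: limr_ge; first exact: cvgP h.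
exists 2%N => // n /= n2.
rewrite /lattice_sum -mulrBr -sumrB /c ler_wpM2l//.
under eq_bigr do rewrite -sumrB.
have n0 : (0 < n)%N by exact: leq_trans n2.
rewrite (bigD1 (Ordinal n0))//= (bigD1 (Ordinal n2))//= -addrA lerDl addr_ge0//.
  by apply: sumr_ge0 => j _; rewrite subr_ge0 sym_term_anti// ltW.
apply: sumr_ge0 => i _; apply: sumr_ge0 => j _.
by rewrite subr_ge0 sym_term_anti// ltW.
Qed.

(** One partial sum suffices, as it bounds [lattice_lim s] from below: fix [N] with an error below
    [e / 2] at [s = 0], then use that this finite sum is Lipschitz in [s] with constant [C]. The
    [+ 1] in [d] avoids a zero denominator. *)
Lemma lattice_lim_near0 (e : R) : 0 < e ->
  exists2 d : R, 0 < d & forall s, 0 <= s -> s < d ->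
    pi ^+ 6 / 768 - e < lattice_lim s.
Proof.
move=> e0; have e20 : 0 < e / 2 by lra.
have /cvgrPdist_lt/(_ _ e20)[N _ /(_ N (leqnn N)) hN] := lattice_sum0_cvg.
pose C : R := \sum_(i < N) \sum_(j < N)
  (oddr i ^+ 2 + oddr j ^+ 2) * (oddr i ^+ 2 - oddr j ^+ 2) ^+ 2.
have C0 : 0 <= C.
  apply: sumr_ge0 => i _; apply: sumr_ge0 => j _.
  by rewrite mulr_ge0 ?addr_ge0 ?sqr_ge0.
exists (e / 2 / (C + 1)); first by rewrite divr_gt0// ltr_wpDl.
move=> s s0; rewrite ltr_pdivlMr ?ltr_wpDl// => sd.
have h : lattice_sum 0 N - lattice_sum s N <= C * s.
  rewrite /lattice_sum -mulrBr -sumrB.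
  apply: (@le_trans _ _ (\sum_(i < N) (\sum_(j < N) sym_term 0 i j - \sum_(j < N) sym_term s i j))).
    rewrite ler_piMl// ?invf_le1 ?ler1n//; apply: sumr_ge0 => i _.
    by rewrite subr_ge0; apply: ler_sum => j _; exact: sym_term_anti.
  rewrite /C mulr_suml; apply: ler_sum => i _.
  rewrite -sumrB mulr_suml; apply: ler_sum => j _.
  rewrite /sym_term mulr0 addr0.
  have m1 : 1 <= oddr i ^+ 2 by rewrite exprn_ege1// oddr_ge1.
  have n1 : 1 <= oddr j ^+ 2 by rewrite exprn_ege1// oddr_ge1.
  move: (oddr i ^+ 2) (oddr j ^+ 2) m1 n1 => m n m1 n1.
  have p1 : 1 <= m * n by nra.
  have q0 : 0 <= (m - n) ^+ 2 * s by rewrite mulr_ge0// sqr_ge0.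
  have -> : (m + n) / (m * n * (m * n)) - (m + n) / (m * n * (m * n + (m - n) ^+ 2 * s)) =
    (m + n) * (m - n) ^+ 2 * s / (m * n * (m * n) * (m * n + (m - n) ^+ 2 * s)).
    by field; rewrite !gt_eqF//; nra.
  rewrite ler_piMr//; first by rewrite mulr_ge0// mulr_ge0 ?sqr_ge0//; lra.
  have d1 : 1 <= m * n * (m * n) * (m * n + (m - n) ^+ 2 * s).
    by rewrite !mulr_ege1//; lra.
  by rewrite invf_le1// (lt_le_trans _ d1).
have := lattice_lim_ge N s0; move: hN; rewrite ltr_norml => /andP[h1 h2].
by move: h1 h2 h sd; move: (pi ^+ 6 / 768 : R) => P; nra.
Qed.

(** Telescoping from [(2 x + 1)^-2 <= 1 / (4 x) - 1 / (4 (x + 1))] bounds the odd sum [pi^2 / 8] by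
    5/4. This precision is enough for the lower bound on the square. *)
Lemma pi_sqr_le : pi ^+ 2 <= 10 :> R.
Proof.
suff h : forall n, odd_sum R 2 n <= 5 / 4.
  suff : pi ^+ 2 / 8 <= 5 / 4 :> R by move: (pi ^+ 2 : R) => P; lra.
  rewrite -(cvg_lim (@Rhausdorff R) (@odd_sum2_cvg R)); apply: limr_le.
    exact: cvgP (@odd_sum2_cvg R).
  exact: nearW.
case=> [|n]; first by rewrite /odd_sum big_ord0; lra.
have n1 (k : nat) : 0 < k.+1%:R :> R by [].
suff h : odd_sum R 2 n.+1 <= 5 / 4 - (4 * n.+1%:R)^-1.
  by apply: le_trans h _; rewrite lerBlDr lerDl invr_ge0 mulr_ge0.
elim: n => [|n IH].
  by rewrite /odd_sum big_ord1 oddrE mulr0 add0r expr1n invr1 mulr1; lra.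
rewrite /odd_sum big_ord_recr/= -/(odd_sum R 2 n.+1).
have : oddr n.+1 ^- 2 <= (4 * n.+1%:R)^-1 - (4 * n.+2%:R)^-1.
  rewrite oddrE -[n.+2%:R]natr1; have := n1 n; move: (n.+1%:R : R) => x x0.
  have -> : (4 * x)^-1 - (4 * (x + 1))^-1 = (4 * x * (x + 1))^-1.
    by field; rewrite !gt_eqF//; lra.
  by rewrite lef_pV2 ?posrE; nra.
by move=> h; apply: le_trans (lerD IH h) _; rewrite addrA subrK.
Qed.

End lattice_sum.

(** * Smooth functions and cutoffs *)

Section smooth1.
Variable R : realType.
Implicit Types f g : R -> R.

(** The derivative is an existential witness, so that sums, products and compositions follow by
    induction without computing an iterated derivative operator. *)
Fixpoint diff_upto (n : nat) f : Prop :=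
  if n is n'.+1 then
    exists2 g : R -> R, (forall x : R, is_derive x 1 f (g x)) & diff_upto n' g
  else True.

Definition smooth1 f := forall n, diff_upto n f.

Lemma diff_uptoS n f : diff_upto n.+1 f -> diff_upto n f.
Proof. by elim: n f => [//|n IH] f [g fg /IH gn]; exists g. Qed.

Lemma diff_upto_cst n (c : R) : diff_upto n (cst c).
Proof.
elim: n c => [//|n IH] c; exists (cst 0); last exact: IH.
by move=> x; exact: is_derive_cst.
Qed.

Lemma diff_uptoD n f g : diff_upto n f -> diff_upto n g ->
  diff_upto n (fun x => f x + g x).
Proof.
elim: n f g => [//|n IH] f g [f' ff' f'n] [g' gg' g'n].
by exists (fun x => f' x + g' x); [move=> x; exact: is_deriveD|exact: IH].
Qed.

Lemma diff_uptoM n f g : diff_upto n f -> diff_upto n g ->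
  diff_upto n (fun x => f x * g x).
Proof.
elim: n f g => [//|n IH] f g fn gn; have := fn; have := gn.
move=> [g' gg' g'n] [f' ff' f'n].
exists (fun x => f x * g' x + g x * f' x).
  by move=> x; exact: is_deriveM.
by apply: diff_uptoD; apply: IH => //; exact: diff_uptoS.
Qed.

Lemma diff_upto_comp n f g : diff_upto n f -> diff_upto n g ->
  diff_upto n (fun x => f (g x)).
Proof.
elim: n f g => [//|n IH] f g [f' ff' f'n] gn; have := gn; move=> [g' gg' g'n].
exists (fun x => f' (g x) * g' x).
  by move=> x; apply: (@is_derive1_comp _ f g).
by apply: diff_uptoM => //; apply: IH => //; exact: diff_uptoS.
Qed.

Lemma smooth1_cst (c : R) : smooth1 (cst c).
Proof. by move=> n; exact: diff_upto_cst. Qed.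

Lemma smooth1_id : smooth1 id.
Proof.
case=> [//|n]; exists (cst 1); last exact: diff_upto_cst.
by move=> x; exact: is_derive_id.
Qed.

Lemma smooth1M f g : smooth1 f -> smooth1 g -> smooth1 (fun x => f x * g x).
Proof. by move=> fs gs n; exact: diff_uptoM. Qed.

Lemma smooth1D f g : smooth1 f -> smooth1 g -> smooth1 (fun x => f x + g x).
Proof. by move=> fs gs n; exact: diff_uptoD. Qed.

Lemma smooth1_comp f g : smooth1 f -> smooth1 g -> smooth1 (fun x => f (g x)).
Proof. by move=> fs gs n; exact: diff_upto_comp. Qed.

Lemma smooth1_cos : smooth1 cos.
Proof.
suff : forall n, diff_upto n (@cos R) /\ diff_upto n (@sin R).
  by move=> h n; case: (h n).
elim=> [//|n [IHc IHs]]; split.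
  exists (fun x => -1 * sin x); first by move=> x; rewrite mulN1r; exact: is_derive_cos.
  by apply: diff_uptoM => //; exact: diff_upto_cst.
by exists cos => // x; exact: is_derive_sin.
Qed.

End smooth1.

Section bump.
Variable R : realType.
Implicit Types t : R.

(* The exponent [k] makes the family stable under differentiation. *)
Definition bump (k : nat) t : R :=
  if 0 < t then t ^- k * expR (- t^-1) else 0.

Lemma bump_ge0 k t : 0 <= bump k t.
Proof.
rewrite /bump; case: ifPn => // t0.
by rewrite mulr_ge0 ?invr_ge0 ?exprn_ge0 ?expR_ge0// ltW.
Qed.

(** With [r = 1 / t] this is [r^k <= k! e^r], a single term of the exponential series. *)
Lemma bump_le k t : bump k t <= k`!%:R.
Proof.
rewrite /bump; case: ifPn => [t0|_]; last by rewrite ler0n.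
rewrite -exprVn; have : 0 <= t^-1 by rewrite invr_ge0 ltW.
move: t^-1 => r r0; rewrite expRN ler_pdivrMr ?expR_gt0//.
case: k => [|k].
  by rewrite expr0 mul1r (le_trans _ (expR_ge1Dx _))// lerDl.
have := expR_ge1Dxn k r0; have f0 : 0 < k.+1`!%:R :> R by rewrite ltr0n fact_gt0.
rewrite -ler_pdivrMl// mulrC => h; apply: le_trans h.
by rewrite lerDr.
Qed.

(** Together with [bump_le] it gives a quadratic bound at the origin, where the two pieces of [bump]
    are glued. *)
Lemma bump_shift k t : bump k t = t ^+ 2 * bump k.+2 t.
Proof.
rewrite /bump; case: ifPn => [t0|_]; last by rewrite mulr0.
have tn0 : t != 0 by rewrite gt_eqF.
rewrite mulrA !exprS; congr (_ * _).
by field; rewrite tn0 expf_neq0.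
Qed.

(** Avoids one-sided limits at the gluing point: the difference quotient at 0 is at most [C |h|]. *)
Lemma is_derive_sqr_bound (f : R -> R) (C : R) :
  (forall x, `|f x| <= C * x ^+ 2) -> is_derive (0 : R) 1 f 0.
Proof.
move=> fC; have f0 : f 0 = 0.
  by apply/eqP; rewrite -normr_le0 (le_trans (fC 0))// expr0n/= mulr0.
have C0 : 0 <= C by have := fC 1; rewrite expr1n mulr1; exact: le_trans.
suff h : h^-1 *: (f (h *: 1 + 0) - f 0) @[h --> (0 : R)^'] --> (0 : R).
  by apply: DeriveDef; [exact: cvgP h|exact: cvg_lim h].
apply/cvgrPdist_le => e e0; near=> h.
rewrite sub0r normrN f0 subr0 addr0 /GRing.scale/= mulr1 normrM normfV.
have h0 : 0 < `|h| by rewrite normr_gt0; near: h; exact: nbhs_dnbhs_neq.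
rewrite mulrC ler_pdivrMr// (le_trans (fC _))//.
rewrite -real_normK ?num_real// expr2 mulrA ler_wpM2r//.
have : `|h| <= e / (C + 1).
  near: h; apply: dnbhs0_le; rewrite divr_gt0// ltr_wpDl//.
rewrite ler_pdivlMr ?ltr_wpDl// => h1; apply: le_trans h1.
by rewrite mulrC ler_wpM2l// lerDl.
Unshelve. all: by end_near. Qed.

Lemma is_derive_bump k t :
  is_derive t 1 (bump k) (- k%:R * bump k.+1 t + bump k.+2 t).
Proof.
have [t0|t0|t0] := ltgtP t 0.
- have -> : - k%:R * bump k.+1 t + bump k.+2 t = 0.
    by rewrite /bump ltNge (ltW t0)/= mulr0 addr0.
  apply: (@near_eq_is_derive _ _ _ (cst 0)).
  near=> s; rewrite /bump ltNge ifF//; apply/negbF; apply: ltW.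
  by near: s; exact: lt_nbhsl.
- have tn0 : t != 0 by rewrite gt_eqF.
  have d0 : is_derive t 1 (fun s : R => s^-1) (- t ^- 2).
    by apply: is_derive_eq (is_deriveV tn0 (is_derive_id t 1)) _; rewrite /GRing.scale/= mulr1.
  have d1 : is_derive t 1 (fun s : R => s ^- k) (- k%:R * t ^- k.+1).
    elim: k => [|k IH].
      rewrite (_ : (fun s => _) = cst 1); last by apply/funext => s; rewrite expr0 invr1.
      by rewrite oppr0 mul0r; exact: is_derive_cst.
    rewrite (_ : (fun s => _) = (fun s => s^-1 * s ^- k)); last first.
      by apply/funext => s; rewrite exprS invfM.
    apply: is_derive_eq; rewrite /GRing.scale/= -natr1 !exprS; field.
    by rewrite tn0 expf_neq0.
  have d2 : is_derive t 1 (fun s : R => - s^-1) (t ^- 2).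
    by apply: is_derive_eq; rewrite opprK.
  have d3 : is_derive t 1 (fun s : R => expR (- s^-1)) (expR (- t^-1) * t ^- 2).
    by apply: (@is_derive1_comp _ expR (fun s => - s^-1)).
  have d4 : is_derive t 1 (fun s : R => s ^- k * expR (- s^-1))
      (- k%:R * bump k.+1 t + bump k.+2 t).
    apply: is_derive_eq; rewrite /bump t0 /GRing.scale/= !exprS; field.
    by rewrite tn0 expf_neq0.
  apply: near_eq_is_derive d4.
  near=> s; rewrite /bump ifT//; near: s; exact: lt_nbhsr.
- have -> : - k%:R * bump k.+1 t + bump k.+2 t = 0.
    by rewrite t0 /bump ltxx mulr0 addr0.
  rewrite t0.
  apply: (@is_derive_sqr_bound _ (k.+2)`!%:R) => x.
  rewrite bump_shift normrM ger0_norm ?sqr_ge0//.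
  by rewrite ger0_norm ?bump_ge0// mulrC ler_wpM2r ?sqr_ge0// bump_le.
Unshelve. all: by end_near. Qed.

Lemma smooth1_bump k : smooth1 (bump k).
Proof.
move=> n; elim: n k => [//|n IH] k.
exists (fun t => cst (- k%:R) t * bump k.+1 t + bump k.+2 t).
  exact: is_derive_bump.
by apply: diff_uptoD => //; apply: diff_uptoM => //; exact: diff_upto_cst.
Qed.

Lemma bump0_ge t : 0 < t -> 1 - t^-1 <= bump 0 t.
Proof.
move=> t0; rewrite /bump t0 expr0 invr1 mul1r.
exact: expR_ge1Dx.
Qed.

Lemma mul_bump k t : 0 < t -> t * bump k.+1 t = bump k t.
Proof.
move=> t0; have tn0 : t != 0 by rewrite gt_eqF.
by rewrite /bump t0 mulrA exprS invfM mulrA divff// mul1r.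
Qed.

End bump.

Section cutoff.
Variables (R : realType) (c : R).
Hypothesis c0 : 0 < c.
Implicit Types x : R.

(* Vanishes outside a compact subset of ]- c, c[, tends to 1 inside, and has a
   derivative of size at most [6 c / (c^2 - x^2)], uniformly in [n]. *)
Definition cutoff (n : nat) x : R := bump 0 (n%:R * (c ^+ 2 - x ^+ 2) - 1).

Definition dcutoff (n : nat) x : R :=
  bump 2 (n%:R * (c ^+ 2 - x ^+ 2) - 1) * (- (2 * n%:R * x)).

Lemma is_derive_cutoff n x : is_derive x 1 (cutoff n) (dcutoff n x).
Proof.
apply: (@is_derive1_comp _ (bump 0) (fun x => n%:R * (c ^+ 2 - x ^+ 2) - 1)).
  by have := is_derive_bump 0 (n%:R * (c ^+ 2 - x ^+ 2) - 1); rewrite oppr0 mul0r add0r.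
by apply: is_derive_eq; rewrite /GRing.scale/=; ring.
Qed.

Lemma smooth1_cutoff n : smooth1 (cutoff n).
Proof.
apply: (@smooth1_comp _ (bump 0) (fun x => n%:R * (c ^+ 2 - x ^+ 2) - 1)).
  exact: smooth1_bump.
have -> : (fun x : R => n%:R * (c ^+ 2 - x ^+ 2) - 1) =
    (fun x => cst (n%:R * c ^+ 2 - 1) x + cst (- n%:R) x * (id x * id x)).
  by apply/funext => x /=; ring.
apply: smooth1D; first exact: smooth1_cst.
apply: smooth1M; first exact: smooth1_cst.
by apply: smooth1M; exact: smooth1_id.
Qed.

Lemma cutoff_norm n x : `|cutoff n x| <= 1.
Proof. by rewrite ger0_norm ?bump_ge0// (le_trans (bump_le _ _)). Qed.

Lemma cutoff_neq0 n x : cutoff n x != 0 -> 1 < n%:R * (c ^+ 2 - x ^+ 2).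
Proof.
by rewrite /cutoff /bump; case: ifPn; rewrite ?eqxx// subr_gt0.
Qed.

Let arg_cvg x : `|x| < c -> n%:R * (c ^+ 2 - x ^+ 2) - 1 @[n --> \oo] --> +oo.
Proof.
move=> xc; have d0 : 0 < c ^+ 2 - x ^+ 2.
  by rewrite subr_gt0 -[x ^+ 2]real_normK ?num_real// ltr_sqr ?nnegrE// ltW.
apply/cvgryPge => A.
have [n _ nP] : \forall n \near \oo, (A + 1) / (c ^+ 2 - x ^+ 2) <= n%:R.
  exact: nbhs_infty_ger.
exists n => // m /nP /=.
by rewrite ler_pdivrMr// => h; rewrite lerBrDr.
Qed.

Lemma cutoff_cvg x : `|x| < c -> cutoff n x @[n --> \oo] --> (1 : R).
Proof.
move=> /arg_cvg cv.
have pos : \forall n \near \oo, 0 < n%:R * (c ^+ 2 - x ^+ 2) - 1.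
  exact: cvgry_gt.
have inv0 : (n%:R * (c ^+ 2 - x ^+ 2) - 1)^-1 @[n --> \oo] --> (0 : R).
  exact: (gtr0_cvgV0 pos).2 cv.
apply: (@squeeze_cvgr _ _ _ _
  (fun n => 1 - (n%:R * (c ^+ 2 - x ^+ 2) - 1)^-1) (cst 1)).
- near=> n; rewrite bump0_ge/=; last by near: n.
  by rewrite (le_trans (bump_le _ _)).
- by rewrite -[X in _ --> X]subr0; apply: cvgB => //; exact: cvg_cst.
- exact: cvg_cst.
Unshelve. all: by end_near. Qed.

(** Writing [t] for the argument of [bump], [n (c^2 - x^2) = t + 1] and [t * bump 2 t = bump 1 t];
    the factor [n] created by differentiation is absorbed. *)
Let mul_dcutoff n x : `|x| < c ->
  (c ^+ 2 - x ^+ 2) * `|dcutoff n x| =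
  (bump 1 (n%:R * (c ^+ 2 - x ^+ 2) - 1) +
   bump 2 (n%:R * (c ^+ 2 - x ^+ 2) - 1)) * (2 * `|x|).
Proof.
move=> xc; rewrite /dcutoff; set t := _ - 1.
have nt : n%:R * (c ^+ 2 - x ^+ 2) = t + 1 by rewrite subrK.
rewrite normrM (ger0_norm (bump_ge0 _ _)) normrN !normrM !normr_nat.
have -> : (c ^+ 2 - x ^+ 2) * (bump 2 t * (2 * n%:R * `|x|)) =
    n%:R * (c ^+ 2 - x ^+ 2) * bump 2 t * (2 * `|x|) by ring.
rewrite nt mulrDl mul1r; congr ((_ + _) * _).
have [t0|t0] := ltP 0 t; first exact: mul_bump.
by rewrite /bump ltNge t0/= mulr0.
Qed.

Lemma mul_dcutoff_le n x : `|x| < c -> (c ^+ 2 - x ^+ 2) * `|dcutoff n x| <= 6 * c.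
Proof.
move=> xc; rewrite mul_dcutoff//.
have := bump_le 1 (n%:R * (c ^+ 2 - x ^+ 2) - 1).
have := bump_le 2 (n%:R * (c ^+ 2 - x ^+ 2) - 1).
have := bump_ge0 1 (n%:R * (c ^+ 2 - x ^+ 2) - 1).
have := bump_ge0 2 (n%:R * (c ^+ 2 - x ^+ 2) - 1).
rewrite !factS fact0 !muln1; set u := bump 2 _; set v := bump 1 _ => u0 v0 u2 v1.
(* The 3 is [1! + 2!], the sum of the bounds of [bump 1] and [bump 2]. *)
have -> : 6 * c = 3 * (2 * c) by ring.
apply: ler_pM; [exact: addr_ge0|by rewrite mulr_ge0| |].
  by rewrite (_ : 3 = 1 + 2) ?lerD//; ring.
by rewrite ler_pM2l// ltW.
Qed.

(** Since [t * bump k.+1 t = bump k t] is at most 1 for [k = 0] and [k = 1], both bumps are at most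
    [1 / t], and [t] tends to infinity with [n]. *)
Lemma mul_dcutoff_cvg x : `|x| < c ->
  (c ^+ 2 - x ^+ 2) * `|dcutoff n x| @[n --> \oo] --> (0 : R).
Proof.
move=> xc; have cv := arg_cvg xc.
have pos : \forall n \near \oo, 0 < n%:R * (c ^+ 2 - x ^+ 2) - 1.
  exact: cvgry_gt.
have inv0 : (n%:R * (c ^+ 2 - x ^+ 2) - 1)^-1 @[n --> \oo] --> (0 : R).
  exact: (gtr0_cvgV0 pos).2 cv.
apply: (@squeeze_cvgr _ _ _ _ (cst 0)
  (fun n => (n%:R * (c ^+ 2 - x ^+ 2) - 1)^-1 * (4 * `|x|))).
- near=> n; have : 0 < n%:R * (c ^+ 2 - x ^+ 2) - 1 by near: n.
  rewrite mul_dcutoff//; set t := _ - 1 => t0.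
  rewrite mulr_ge0 ?addr_ge0 ?bump_ge0 ?mulr_ge0//=.
  have -> : t^-1 * (4 * `|x|) = (t^-1 + t^-1) * (2 * `|x|) by ring.
  rewrite ler_wpM2r ?mulr_ge0// lerD//.
    by rewrite -[leRHS]mulr1 ler_pdivlMl// mul_bump// (le_trans (bump_le _ _)).
  by rewrite -[leRHS]mulr1 ler_pdivlMl// mul_bump// (le_trans (bump_le _ _)).
- exact: cvg_cst.
- by rewrite -[X in _ --> X](mul0r (4 * `|x|)); apply: cvgM => //; exact: cvg_cst.
Unshelve. all: by end_near. Qed.

End cutoff.

(** * Smooth functions of two variables and integration by parts *)

Section smooth2.
Variable R : realType.
Implicit Types f g : R * R -> R.

Fixpoint diff2_upto (n : nat) f : Prop :=
  continuous f /\
  (if n is n'.+1 then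
    forall i, (forall p, derivable f p (dir R i)) /\ diff2_upto n' (partial i f)
  else True).

Lemma diff2_smooth f : (forall n, diff2_upto n f) -> smooth f.
Proof.
move=> fn s p; suff : forall n, diff2_upto n (foldr (@partial R) f s).
  move=> h; split; first by have [+ _] := h 0%N; apply.
  by move=> i; have [_ /(_ i)[+ _]] := h 1%N; apply.
elim: s => [//|i s IH] n /=.
by have [_ /(_ i)[_]] := IH n.+1.
Qed.

Lemma diff2_uptoS n f : diff2_upto n.+1 f -> diff2_upto n f.
Proof.
elim: n f => [|n IH] f [fc fn]; split => // i.
by have [dfi fni] := fn i; split => //; exact: IH.
Qed.

Lemma diff2_upto_continuous n f : diff2_upto n f -> continuous f.
Proof. by case: n => [|n] []. Qed.

Lemma partialD i f g : (forall p, derivable f p (dir R i)) ->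
  (forall p, derivable g p (dir R i)) ->
  partial i (fun p => f p + g p) = (fun p => partial i f p + partial i g p).
Proof. by move=> df dg; apply/funext => p; exact: deriveD. Qed.

Lemma partialM i f g : (forall p, derivable f p (dir R i)) ->
  (forall p, derivable g p (dir R i)) ->
  partial i (fun p => f p * g p) = (fun p => f p * partial i g p + g p * partial i f p).
Proof. by move=> df dg; apply/funext => p; exact: deriveM. Qed.

Lemma diff2_uptoD n f g : diff2_upto n f -> diff2_upto n g ->
  diff2_upto n (fun p => f p + g p).
Proof.
elim: n f g => [|n IH] f g [fc fn] [gc gn]; split => //;
  try by move=> p; apply: continuousD; [exact: fc|exact: gc].
move=> i; have [df fi] := fn i; have [dg gi] := gn i; split.
  by move=> p; apply: derivableD.
by rewrite partialD//; exact: IH.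
Qed.

Lemma diff2_uptoM n f g : diff2_upto n f -> diff2_upto n g ->
  diff2_upto n (fun p => f p * g p).
Proof.
elim: n f g => [|n IH] f g fn gn.
  by split=> // p; apply: continuousM; [exact: fn.1|exact: gn.1].
have fn' := diff2_uptoS fn; have gn' := diff2_uptoS gn.
split; first by move=> p; apply: continuousM; [exact: fn.1|exact: gn.1].
move=> i; have [df fi] := fn.2 i; have [dg gi] := gn.2 i; split.
  by move=> p; apply: derivableM.
by rewrite partialM//; apply: diff2_uptoD; exact: IH.
Qed.

Lemma diff2_upto_cst n (c : R) : diff2_upto n (cst c).
Proof.
elim: n c => [|n IH] c; split => //; try by move=> p; exact: cvg_cst.
move=> i; split; first by move=> p; exact: derivable_cst.
rewrite (_ : partial i (cst c) = cst 0); first exact: IH.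
by apply/funext => p; exact: derive_cst.
Qed.

Lemma diff2_upto_sum n I (r : seq I) (F : I -> R * R -> R) :
  (forall i, diff2_upto n (F i)) -> diff2_upto n (fun p => \sum_(i <- r) F i p).
Proof.
move=> Fn; elim: r => [|x r IH].
  rewrite (_ : (fun p => _) = cst 0); first exact: diff2_upto_cst.
  by apply/funext => p; rewrite big_nil.
rewrite (_ : (fun p => _) = (fun p => F x p + \sum_(i <- r) F i p)).
  exact: diff2_uptoD.
by apply/funext => p; rewrite big_cons.
Qed.

Definition coordinate (i : bool) (p : R * R) : R := if i then p.2 else p.1.

Lemma slice_dir i s t (h : R) : h *: dir R i + slice i s t = slice i s (h *: 1 + t).
Proof.
by case: i; rewrite /slice/dir; congr pair => /=; rewrite scaler0 add0r.
Qed.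

Lemma sliceE i p : slice i (coordinate (~~ i) p) (coordinate i p) = p.
Proof. by case: i p => -[]. Qed.

Lemma is_derive_slice i f s t : derivable f (slice i s t) (dir R i) ->
  is_derive t 1 (fun t => f (slice i s t)) (partial i f (slice i s t)).
Proof.
have e : (fun h : R => h^-1 *: ((f \o shift (slice i s t)) (h *: dir R i) - f (slice i s t))) =
  (fun h : R => h^-1 *: (((fun t => f (slice i s t)) \o shift t) (h *: 1) - f (slice i s t))).
  by apply/funext => h /=; rewrite slice_dir.
by move=> df; apply: DeriveDef; rewrite /partial /derivable /derive -e.
Qed.

Lemma is_derive_coord i f p (l : R) :
  is_derive (coordinate i p) 1 (fun t => f (slice i (coordinate (~~ i) p) t)) l ->
  derivable f p (dir R i) /\ partial i f p = l.
Proof.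
suff h (s t : R) : is_derive t 1 (fun t => f (slice i s t)) l ->
    derivable f (slice i s t) (dir R i) /\ partial i f (slice i s t) = l.
  by move=> /h; rewrite sliceE.
have e : (fun h : R => h^-1 *: ((f \o shift (slice i s t)) (h *: dir R i) - f (slice i s t))) =
  (fun h : R => h^-1 *: (((fun t => f (slice i s t)) \o shift t) (h *: 1) - f (slice i s t))).
  by apply/funext => h /=; rewrite slice_dir.
by rewrite /derivable /partial /derive e => -[].
Qed.

Lemma continuous_coord i : continuous (coordinate i).
Proof. by case: i => p; [exact: cvg_snd|exact: cvg_fst]. Qed.

Lemma coord_slice i s t : coordinate i (slice i s t) = t. Proof. by case: i. Qed.
Lemma coordN_slice i s t : coordinate (~~ i) (slice i s t) = s. Proof. by case: i. Qed.

Lemma partial_lift i (f f' : R -> R) : (forall t : R, is_derive t 1 f (f' t)) ->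
  (forall p, derivable (fun p => f (coordinate i p)) p (dir R i)) /\
  partial i (fun p => f (coordinate i p)) = (fun p => f' (coordinate i p)).
Proof.
move=> ff'.
have d p : derivable (fun p => f (coordinate i p)) p (dir R i) /\
    partial i (fun p => f (coordinate i p)) p = f' (coordinate i p).
  apply: is_derive_coord.
  by under eq_fun do rewrite coord_slice; exact: ff'.
by split; [move=> p; case: (d p)|apply/funext => p; case: (d p)].
Qed.

Lemma partial_liftN i (f : R -> R) :
  (forall p, derivable (fun p => f (coordinate (~~ i) p)) p (dir R i)) /\
  partial i (fun p => f (coordinate (~~ i) p)) = cst 0.
Proof.
have d p : derivable (fun p => f (coordinate (~~ i) p)) p (dir R i) /\
    partial i (fun p => f (coordinate (~~ i) p)) p = 0.
  apply: is_derive_coord.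
  by under eq_fun do rewrite coordN_slice; exact: is_derive_cst.
by split; [move=> p; case: (d p)|apply/funext => p; case: (d p)].
Qed.

Lemma diff2_upto_lift n i (f : R -> R) : smooth1 f ->
  diff2_upto n (fun p => f (coordinate i p)).
Proof.
move=> fs; have := fs n.+1; elim: n f {fs} => [|n IH] f [f' ff' f'n].
  split => // p; apply: continuous_comp; first exact: continuous_coord.
  by apply/differentiable_continuous/derivable1_diffP; have [] := ff' (coordinate i p).
split.
  move=> p; apply: continuous_comp; first exact: continuous_coord.
  by apply/differentiable_continuous/derivable1_diffP; have [] := ff' (coordinate i p).
move=> j; have [->|ij] := eqVneq j i.
  have [d ->] := partial_lift i ff'; split => //; exact: IH.
have -> : i = ~~ j by case: (i) (j) ij => -[].
have [d ->] := partial_liftN j f; split => //; exact: diff2_upto_cst.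
Qed.

End smooth2.

Section test_integration_by_parts.
Variables (R : realType) (a b : R).
Hypotheses (a0 : 0 < a) (b0 : 0 < b).
Notation D := (rectangle a b : set (plane R)).
Notation mu := (@area R).
Notation side := (half_width a b).
Implicit Types f v phi : R * R -> R.

Let mD := measurable_rectangle a b.
Let fD := area_rectangle_lty a0 b0.

Lemma continuous_rectangle_bounded f : continuous f ->
  exists M, forall p, D p -> `|f p| <= M.
Proof.
move=> cf; pose K := (`[(- a), a] `*` `[(- b), b] : set (R * R)).
have cK : compact K by apply: compact_setX; exact: segment_compact.
have : compact (f @` K).
  by apply: continuous_compact => //; exact: continuous_subspaceT.
move=> /compact_bounded [M [_ hM]]; exists (M + 1) => p [/= h1 h2].
apply: (hM (M + 1)); first by rewrite ltrDl.
by exists p => //; split => /=; [move: h1|move: h2]; rewrite !in_itv/= =>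
  /andP[/ltW -> /ltW ->].
Qed.

Lemma continuous_rectangle_measurable f : continuous f ->
  measurable_fun D (f : plane R -> R).
Proof. exact: continuous_plane_measurable. Qed.

Lemma continuous_rectangle_integrable f : continuous f ->
  mu.-integrable D (EFin \o (f : plane R -> R)).
Proof.
move=> cf; have [M fM] := continuous_rectangle_bounded cf.
exact: (bounded_integrable mD fD (continuous_rectangle_measurable cf) fM).
Qed.

Lemma continuous_rectangle_L2 f : continuous f -> L2 D f.
Proof.
move=> cf; have [M fM] := continuous_rectangle_bounded cf.
exact: (bounded_L2 mD fD (continuous_rectangle_measurable cf) fM).
Qed.

Lemma test_function_continuous phi : test_function D phi -> continuous phi.
Proof. by move=> [+ _ _] p => /(_ [::] p)[]. Qed.

Lemma test_function_derivable i phi : test_function D phi ->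
  forall p, derivable phi p (dir R i).
Proof. by move=> [+ _ _] p => /(_ [::] p)[_]; apply. Qed.

Lemma test_function_partial i phi : test_function D phi ->
  continuous (partial i phi).
Proof. by move=> [+ _ _] p => /(_ [:: i] p)[]. Qed.

Lemma test_function0 phi p : test_function D phi -> ~ D p -> phi p = 0.
Proof.
move=> [_ _ sD] nDp; apply/eqP/negPn/negP => h; apply: nDp; apply: sD.
by apply: subset_closure.
Qed.

Lemma slice_side_out i s : ~ D (slice i s (side i)) /\ ~ D (slice i s (- side i)).
Proof.
by split => /rectangle_slice[_]; rewrite in_itv/= ltxx ?andbF.
Qed.

Lemma continuous_slice i f s : continuous f -> continuous (fun t => f (slice i s t)).
Proof.
move=> cf t; apply: (@continuous_comp _ _ _ (slice i s) f); last exact: cf.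
case: i; rewrite /slice /continuous_at.
  by apply: (@cvg_pair _ _ _ _ (nbhs s) (nbhs t)); [exact: cvg_cst|exact: cvg_id].
by apply: (@cvg_pair _ _ _ _ (nbhs t) (nbhs s)); [exact: cvg_id|exact: cvg_cst].
Qed.

(** Only [phi] has to vanish on the boundary: [v * phi] is the primitive given to
    [Rintegral_partial0]. Hence [v] may be a gradient component, which does not vanish there. *)
Lemma test_integration_by_parts i v phi : continuous v ->
  (forall p, derivable v p (dir R i)) -> continuous (partial i v) ->
  test_function D phi ->
  \int[mu]_(p in D) (v p * partial i phi p) =
  - \int[mu]_(p in D) (partial i v p * phi p).
Proof.
move=> cv dv cdv tphi.
have cphi := test_function_continuous tphi.
have cdphi := test_function_partial (i := i) tphi.
have dphi := test_function_derivable (i := i) tphi.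
have c1 : continuous (fun p => v p * partial i phi p).
  by move=> p; apply: continuousM; [exact: cv|exact: cdphi].
have c2 : continuous (fun p => partial i v p * phi p).
  by move=> p; apply: continuousM; [exact: cdv|exact: cphi].
have c3 : continuous (fun p => v p * partial i phi p + partial i v p * phi p).
  by move=> p; exact: (continuousD (@c1 p) (@c2 p)).
apply/eqP; rewrite -addr_eq0; apply/eqP.
rewrite -RintegralD//; [|exact: continuous_rectangle_integrable|
  exact: continuous_rectangle_integrable].
have [M hM] := continuous_rectangle_bounded c3.
apply: (@Rintegral_partial0 R a b a0 b0 i (fun p => v p * phi p) _ M) => //.
- exact: continuous_rectangle_measurable.
- move=> s t sI tI; have := is_derive_slice (dv (slice i s t)) => d1.
  have := is_derive_slice (dphi (slice i s t)) => d2.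
  apply: is_derive_eq (is_deriveM d1 d2) _.
  by rewrite /GRing.scale/= [X in _ + X]mulrC.
- by move=> s sI; apply: continuous_subspaceT; exact: (@continuous_slice i _ s c3).
- move=> s sI; have [h1 h2] := slice_side_out i s.
  by rewrite !(test_function0 tphi)// !mulr0.
Qed.

End test_integration_by_parts.

(** * Weak solutions on rectangles *)

Section H10_approximation.
Variables (R : realType) (a b : R).
Hypotheses (a0 : 0 < a) (b0 : 0 < b).
Notation D := (rectangle a b : set (plane R)).
Notation mu := (@area R).
Notation side := (half_width a b).

Let mD := measurable_rectangle a b.
Let fD := area_rectangle_lty a0 b0.

Lemma bounded_cvg_integralM (fn : nat -> plane R -> R) (f w : plane R -> R) (M : R) :
  (forall n, measurable_fun D (fn n)) ->
  (forall n p, D p -> `|fn n p| <= M) ->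
  (forall p, D p -> fn n p @[n --> \oo] --> f p) ->
  measurable_fun D w -> (exists K, forall p, D p -> `|w p| <= K) ->
  \int[mu]_(p in D) (fn n p * w p) @[n --> \oo] -->
  \int[mu]_(p in D) (f p * w p).
Proof.
move=> mfn fnM fnf mw [K wK].
have [|||_ _ //] := @bounded_cvg_integral R D mD fD (fun n p => fn n p * w p)
  (fun p => f p * w p) (M * K).
- by move=> n; exact: measurable_funM.
- by move=> n p Dp; rewrite normrM ler_pM// ?fnM// wK.
- by move=> p Dp; apply: cvgM; [exact: fnf|exact: cvg_cst].
Qed.

Lemma coord_lt_side p i : D p -> `|coordinate i p| < side i.
Proof.
by move=> [/=]; rewrite !in_itv/= -!ltr_norml; case: i.
Qed.

Lemma coord_sqr_lt p i : D p -> 0 < side i ^+ 2 - coordinate i p ^+ 2.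
Proof.
move=> /(@coord_lt_side _ i) h.
rewrite subr_gt0 -[coordinate i p ^+ 2]real_normK ?num_real//.
by rewrite ltr_sqr ?nnegrE// ltW// half_width_gt0.
Qed.

Definition cutoff2 (n : nat) (p : R * R) : R :=
  cutoff a n (coordinate false p) * cutoff b n (coordinate true p).

Lemma cutoff2E i n p : cutoff2 n p =
  cutoff (side i) n (coordinate i p) * cutoff (side (~~ i)) n (coordinate (~~ i) p).
Proof. by case: i => //=; rewrite /cutoff2 mulrC. Qed.

Lemma diff2_upto_cutoff2 m n : diff2_upto m (cutoff2 n).
Proof.
apply: diff2_uptoM.
  exact: (diff2_upto_lift m false (smooth1_cutoff a n)).
exact: (diff2_upto_lift m true (smooth1_cutoff b n)).
Qed.

Lemma partial_cutoff2 i n p : partial i (cutoff2 n) p =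
  dcutoff (side i) n (coordinate i p) * cutoff (side (~~ i)) n (coordinate (~~ i) p).
Proof.
rewrite (_ : cutoff2 n = (fun p => cutoff (side i) n (coordinate i p) *
  cutoff (side (~~ i)) n (coordinate (~~ i) p))); last by apply/funext => q; exact: cutoff2E.
have [d1 e1] := partial_lift i (is_derive_cutoff (side i) n).
have [d2 e2] := partial_liftN i (cutoff (side (~~ i)) n).
by rewrite (partialM d1 d2) e1 e2 /= mulr0 add0r mulrC.
Qed.

Lemma cutoff2_norm n p : `|cutoff2 n p| <= 1.
Proof. by rewrite /cutoff2 normrM mulr_ile1// cutoff_norm. Qed.

Lemma cutoff2_cvg p : D p -> cutoff2 n p @[n --> \oo] --> (1 : R).
Proof.
move=> Dp; rewrite -[X in _ --> X]mulr1; apply: cvgM.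
  by apply: cutoff_cvg => //; exact: (coord_lt_side false Dp).
by apply: cutoff_cvg => //; exact: (coord_lt_side true Dp).
Qed.

(** The support stays in the closed set [K], cut out by the condition that both cutoffs can be
    nonzero; [K] keeps a positive distance from the sides. *)
Lemma cutoff2_test n v : (forall m, diff2_upto m v) ->
  test_function D (fun p => v p * cutoff2 n p).
Proof.
move=> vs.
pose K := \bigcap_(i in [set: bool]) [set p : R * R | 1 <= n%:R * (side i ^+ 2 - coordinate i p ^+ 2)].
have cl : closed K.
  apply: closed_bigI => i _.
  apply: (@closed_comp _ _ (fun p => n%:R * (side i ^+ 2 - coordinate i p ^+ 2)) [set x : R | 1 <= x]).
    move=> p _; apply: (@continuousM _ _ (cst n%:R) (fun p => side i ^+ 2 - coordinate i p ^+ 2)).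
      exact: cvg_cst.
    apply: (@continuousB _ _ _ (cst (side i ^+ 2)) (fun p => coordinate i p ^+ 2)).
      exact: cvg_cst.
    exact: (continuousM (@continuous_coord R i p) (@continuous_coord R i p)).
  exact: closed_ge.
have sK : supp (fun p => v p * cutoff2 n p) `<=` K.
  rewrite /supp closureE; apply: smallest_sub => // p /=.
  rewrite mulf_eq0 negb_or => /andP[_ c0] i _ /=; apply: ltW.
  by move: c0; rewrite (cutoff2E i) mulf_eq0 negb_or => /andP[/cutoff_neq0].
have KD : K `<=` D.
  move=> p Kp; have h i : `|coordinate i p| < side i.
    rewrite -ltr_sqr ?nnegrE ?(ltW (half_width_gt0 a0 b0 i))//.
    rewrite real_normK ?num_real// -subr_gt0.
    have := Kp i I => /= h1.
    have : 0 < n%:R * (side i ^+ 2 - coordinate i p ^+ 2) by rewrite (lt_le_trans _ h1).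
    (* For [n = 0] the set [K] is empty, because its condition reads [1 <= 0]. *)
    by rewrite pmulr_rgt0//; case: (n) h1 => [|m]; rewrite ?mul0r ?ler10// ltr0n.
  by split; rewrite /= in_itv/= -ltr_norml; [exact: (h false)|exact: (h true)].
split; last exact: subset_trans sK KD.
  apply: diff2_smooth => m; apply: diff2_uptoM => //; exact: diff2_upto_cutoff2.
apply: (@subclosed_compact _ _ (`[(- a), a] `*` `[(- b), b])).
- exact: closed_closure.
- by apply: compact_setX; exact: segment_compact.
- move=> p /sK /KD [/= h1 h2].
  by split => /=; [move: h1|move: h2]; rewrite !in_itv/= => /andP[/ltW -> /ltW ->].
Qed.

(** The decay [vM] towards each side is measured by [side^2 - x^2], exactly the factor that tames
    the derivative of a cutoff. *)
Variables (vn : nat -> R * R -> R) (u : R * R -> R) (g : bool -> R * R -> R) (M : R).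
Hypotheses (vs : forall n m, diff2_upto m (vn n))
  (vM : forall n i p, D p -> `|vn n p| <= M * (side i ^+ 2 - coordinate i p ^+ 2))
  (dvM : forall n i p, D p -> `|partial i (vn n) p| <= M)
  (vu : forall p, D p -> vn n p @[n --> \oo] --> u p)
  (dvg : forall i p, D p -> partial i (vn n) p @[n --> \oo] --> g i p).

Let phi n p := vn n p * cutoff2 n p.

Let test_phi n : test_function D (phi n).
Proof. exact: cutoff2_test. Qed.

Let partial_phi i n p : partial i (phi n) p =
  vn n p * partial i (cutoff2 n) p + cutoff2 n p * partial i (vn n) p.
Proof.
rewrite /phi partialM//.
  by have [_ /(_ i)[]] := vs n 1.
by have [_ /(_ i)[]] := diff2_upto_cutoff2 1 n.
Qed.

Let M0 : 0 <= M.
Proof.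
have D0 : D (0, 0) by split; rewrite /= in_itv/= oppr_lt0 ?a0 ?b0.
exact: le_trans (dvM 0 true D0).
Qed.

Let phi_bound n p : D p -> `|phi n p| <= M * a ^+ 2.
Proof.
move=> Dp; rewrite /phi normrM -[leRHS]mulr1 ler_pM// ?cutoff2_norm//.
apply: le_trans (vM n false Dp) _; rewrite ler_wpM2l// lerBlDr lerDl.
exact: sqr_ge0.
Qed.

Let phi_cvg p : D p -> phi n p @[n --> \oo] --> u p.
Proof.
move=> Dp; rewrite -[X in _ --> X]mulr1; apply: cvgM; first exact: vu.
exact: cutoff2_cvg.
Qed.

(** This is the delicate term of the gradient of [phi n]: [dcutoff] is not bounded in [n], but the
    decay of [vn n] turns it into a bounded quantity that tends to 0. *)
Let cross_le i n p : D p -> `|vn n p * partial i (cutoff2 n) p| <=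
  M * ((side i ^+ 2 - coordinate i p ^+ 2) * `|dcutoff (side i) n (coordinate i p)|).
Proof.
move=> Dp; rewrite partial_cutoff2 mulrA normrM -[leRHS]mulr1.
rewrite ler_pM// ?cutoff_norm//.
by rewrite normrM mulrA ler_wpM2r// vM.
Qed.

Let dphi_bound i n p : D p -> `|partial i (phi n) p| <= M * (6 * side i) + M.
Proof.
move=> Dp; rewrite partial_phi (le_trans (ler_normD _ _))// lerD//.
  apply: le_trans (cross_le i n Dp) _; rewrite ler_wpM2l//.
  by apply: mul_dcutoff_le; exact: coord_lt_side.
by rewrite normrM -[leRHS]mul1r ler_pM// ?cutoff2_norm// dvM.
Qed.

Let dphi_cvg i p : D p -> partial i (phi n) p @[n --> \oo] --> g i p.
Proof.
move=> Dp.
have -> : (fun n => partial i (phi n) p) = (fun n =>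
    vn n p * partial i (cutoff2 n) p + cutoff2 n p * partial i (vn n) p).
  by apply/funext => n; exact: partial_phi.
rewrite -[g i p]add0r -[g i p]mul1r; apply: cvgD; last first.
  by apply: cvgM; [exact: cutoff2_cvg|exact: dvg].
apply/norm_cvg0P.
apply: (@squeeze_cvgr _ _ _ _ (cst 0) (fun n =>
  M * ((side i ^+ 2 - coordinate i p ^+ 2) * `|dcutoff (side i) n (coordinate i p)|))).
- by apply: nearW => n; rewrite normr_ge0/=; exact: cross_le.
- exact: cvg_cst.
- rewrite -[X in _ --> X](mulr0 M); apply: cvgM; first exact: cvg_cst.
  by apply: mul_dcutoff_cvg; [exact: half_width_gt0|exact: coord_lt_side].
Qed.

Let mphi n : measurable_fun D (phi n : plane R -> R).
Proof.
by apply: continuous_rectangle_measurable; exact: test_function_continuous (test_phi n).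
Qed.

Let mdphi i n : measurable_fun D (partial i (phi n) : plane R -> R).
Proof.
by apply: continuous_rectangle_measurable; exact: test_function_partial (test_phi n).
Qed.

(** The sequence [phi] uses the same index for the approximant and for the cutoff. Its values and
    gradients are bounded and converge pointwise, so dominated convergence yields both the weak
    gradient identity and the convergence in H^1. *)
Lemma H10_approximation : H10 D u g.
Proof.
have [mu' uM _] := bounded_cvg_integral mD fD mphi phi_bound phi_cvg.
have hg i := bounded_cvg_integral mD fD (mdphi i) (@dphi_bound i) (@dphi_cvg i).
split.
  split.
  - exact: (bounded_L2 mD fD mu' uM).
  - by move=> i; have [mg gM _] := hg i; exact: (bounded_L2 mD fD mg gM).
  - move=> psi i tpsi.
    have cpsi := test_function_continuous tpsi.
    have cdpsi := test_function_partial (i := i) tpsi.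
    have l1 : \int[mu]_(p in D) (phi n p * partial i psi p) @[n --> \oo] -->
        \int[mu]_(p in D) (u p * partial i psi p).
      apply: (bounded_cvg_integralM mphi phi_bound phi_cvg).
        exact: continuous_rectangle_measurable.
      exact: continuous_rectangle_bounded.
    have l2 : \int[mu]_(p in D) (partial i (phi n) p * psi p) @[n --> \oo] -->
        \int[mu]_(p in D) (g i p * psi p).
      apply: (bounded_cvg_integralM (mdphi i) (@dphi_bound i) (@dphi_cvg i)).
        exact: continuous_rectangle_measurable.
      exact: continuous_rectangle_bounded.
    have l3 : (- \int[mu]_(p in D) (partial i (phi n) p * psi p)) @[n --> \oo] -->
        (- \int[mu]_(p in D) (g i p * psi p) : R) by exact: cvgN l2.
    have e : (fun n => \int[mu]_(p in D) (phi n p * partial i psi p)) =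
        (fun n => - \int[mu]_(p in D) (partial i (phi n) p * psi p)).
      apply/funext => n; apply: (test_integration_by_parts a0 b0 _ _ _ tpsi).
      + exact: test_function_continuous (test_phi n).
      + exact: test_function_derivable (test_phi n).
      + exact: test_function_partial (test_phi n).
    rewrite e in l1.
    by rewrite -[LHS](cvg_lim (@Rhausdorff R) l1) -[RHS](cvg_lim (@Rhausdorff R) l3).
exists phi; split => //.
pose F n p := (phi n p - u p) ^+ 2 + \sum_(i : bool) (partial i (phi n) p - g i p) ^+ 2.
pose C := (2 * (M * a ^+ 2)) ^+ 2 + \sum_(i : bool) (2 * (M * (6 * side i) + M)) ^+ 2.
have sqr_diff (x y K : R) : `|x| <= K -> `|y| <= K -> (x - y) ^+ 2 <= (2 * K) ^+ 2.
  move=> xK yK; rewrite -[(x - y) ^+ 2]real_normK ?num_real//.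
  rewrite ler_sqr ?nnegrE ?mulr_ge0 ?(le_trans _ xK)//.
  by rewrite (le_trans (ler_normB _ _))// mulr_natl mulr2n lerD.
have mF n : measurable_fun D (F n).
  apply: measurable_funD; first by apply: measurable_funX; exact: measurable_funB.
  apply: measurable_sum => i; apply: measurable_funX; apply: measurable_funB => //.
  by case: (hg i).
have F0 n p : 0 <= F n p.
  by rewrite addr_ge0 ?sqr_ge0//; apply: sumr_ge0 => i _; exact: sqr_ge0.
have FC n p : D p -> `|F n p| <= C.
  move=> Dp; rewrite ger0_norm// /F /C lerD//.
    by apply: sqr_diff; [exact: phi_bound|exact: uM].
  apply: ler_sum => i _; apply: sqr_diff; first exact: dphi_bound.
  by have [_ + _] := hg i; exact.
have Fc p : D p -> F n p @[n --> \oo] --> cst (0 : R) p.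
  move=> Dp; suff : F n p @[n --> \oo] -->
      (u p - u p) ^+ 2 + \sum_(i : bool) (g i p - g i p) ^+ 2.
    rewrite (_ : _ + _ = 0)//.
    by rewrite subrr expr0n add0r big1// => i _; rewrite subrr expr0n.
  have sq (x : nat -> R) (l : R) : x n @[n --> \oo] --> l ->
      (x n - l) ^+ 2 @[n --> \oo] --> (l - l) ^+ 2.
    move=> xl; have xl0 : (x n - l) @[n --> \oo] --> l - l by apply: cvgB => //; exact: cvg_cst.
    exact: (cvgM xl0 xl0).
  apply: cvgD; first by apply: sq; exact: phi_cvg.
  rewrite (_ : (fun n => _) = (fun n => (partial true (phi n) p - g true p) ^+ 2 +
    (partial false (phi n) p - g false p) ^+ 2)); last first.
    by apply/funext => n; rewrite big_bool.
  by rewrite big_bool; apply: cvgD; apply: sq; exact: dphi_cvg.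
have [_ _] := bounded_cvg_integral mD fD mF FC Fc.
rewrite Rintegral_cst// mul0r => h.
have e n : (\int[mu]_(p in D) (F n p)%:E = (\int[mu]_(p in D) (F n p))%R%:E)%E.
  rewrite /Rintegral fineK//; apply: integrable_fin_num => //.
  exact: (bounded_integrable mD fD (mF n) (@FC n)).
rewrite (_ : (fun n => _) = (fun n => (\int[mu]_(p in D) (F n p))%R%:E)); last first.
  by apply/funext => n; rewrite -e.
by apply: cvg_EFin => //; exact: nearW.
Qed.

End H10_approximation.

(** * Trigonometric sums *)

Section modes.
Variable R : realType.
Notation oddr := (@oddr R).
Notation mu1 := (@lebesgue_measure R).
Implicit Types c x : R.

Definition freq c (i : nat) : R := oddr i * pi / (2 * c).
Definition mode c i x : R := cos (freq c i * x).
(* The Fourier coefficient of the constant 1; the sine is the sign [(-1)^i]. *)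
Definition mode_coef (i : nat) : R := 4 * sin (oddr i * (pi / 2)) / (oddr i * pi).

Lemma cos_sin_oddr i : cos (oddr i * (pi / 2)) = 0 /\ sin (oddr i * (pi / 2)) ^+ 2 = 1.
Proof.
have h : cos (oddr i * (pi / 2)) = 0.
  elim: i => [|i IH]; first by rewrite oddrE mulr0 add0r mul1r cos_pihalf.
  have -> : oddr i.+1 * (pi / 2) = oddr i * (pi / 2) + pi.
    by rewrite !oddrE -natr1; move: (pi : R) => P; field.
  by rewrite cosDpi IH oppr0.
by split => //; rewrite sin2cos2 h expr0n/= subr0.
Qed.

Lemma freq_gt0 c i : 0 < c -> 0 < freq c i.
Proof. by move=> c0; rewrite divr_gt0 ?mulr_gt0 ?oddr_gt0 ?pi_gt0. Qed.

Lemma freq_mul c i : 0 < c -> freq c i * c = oddr i * (pi / 2).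
Proof.
move=> c0; have cn0 : c != 0 by rewrite gt_eqF.
by rewrite /freq; move: (pi : R) (oddr i) => P o; field.
Qed.

Lemma cos_freq c i : 0 < c -> cos (freq c i * c) = 0.
Proof. by move=> c0; rewrite freq_mul//; case: (cos_sin_oddr i). Qed.

Lemma normr_sin_le x : `|sin x| <= `|x|.
Proof.
wlog x0 : x / 0 <= x => [h|].
  have [/h//|/ltW x0] := leP 0 x.
  by rewrite -normrN -sinN -[leRHS]normrN h// oppr_ge0.
rewrite (ger0_norm x0) ler_norml sin_le// andbT.
rewrite lerNl -sinN.
have [xpi|xpi] := leP x pi.
  by rewrite sinN (le_trans _ x0)// oppr_le0 sin_ge0_pi// x0.
by rewrite (le_trans (sin_le1 _))// (le_trans _ (ltW xpi))// (le_trans _ (pi_ge2 R))// ler1n.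
Qed.

(** As the cosine vanishes at [freq c i * c], the mode is, up to sign, the sine of
    [freq c i * (c - |x|)]. Then [|sin z| <= |z|] and [c (c - |x|) <= c^2 - x^2]. *)
Lemma mode_bound c i x : 0 < c -> `|x| < c ->
  `|mode c i x| <= freq c i / c * (c ^+ 2 - x ^+ 2).
Proof.
move=> c0 xc; have f0 := freq_gt0 i c0.
have e : mode c i x = mode c i `|x|.
  by rewrite /mode -[in LHS](cos_norm (_ * x)) normrM (gtr0_norm f0).
rewrite e -[x ^+ 2]real_normK ?num_real//.
move: `|x| (normr_ge0 x) xc => y y0 yc.
have -> : mode c i y = sin (freq c i * c) * sin (freq c i * (c - y)).
  rewrite /mode (_ : freq c i * y = freq c i * c - freq c i * (c - y)); last by ring.
  by rewrite cosB cos_freq// mul0r add0r.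
have s1 : `|sin (freq c i * c)| <= 1 := sin_max _.
rewrite normrM; apply: (@le_trans _ _ (1 * `|freq c i * (c - y)|)).
  by rewrite ler_pM// normr_sin_le.
rewrite mul1r ger0_norm; last by rewrite mulr_ge0 ?(ltW f0)// subr_ge0 ltW.
rewrite -[leRHS]mulrA ler_pM2l// ler_pdivlMl//.
by nra.
Qed.

Lemma mode_norm c i x : `|mode c i x| <= 1. Proof. exact: cos_max. Qed.

Definition dmode c i x : R := - freq c i * sin (freq c i * x).

Lemma is_derive_mode c i x : is_derive x 1 (mode c i) (dmode c i x).
Proof.
apply: is_derive_eq (@is_derive1_comp _ cos (fun x => freq c i * x) x _ _ _ _) _.
by rewrite /dmode /GRing.scale/= mulr1 mulNr mulrC mulNr.
Qed.

Lemma is_derive_dmode c i x : is_derive x 1 (dmode c i) (- freq c i ^+ 2 * mode c i x).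
Proof.
have h : is_derive x 1 (fun x => sin (freq c i * x)) (cos (freq c i * x) * freq c i).
  apply: is_derive_eq (@is_derive1_comp _ sin (fun x => freq c i * x) x _ _ _ _) _.
  by rewrite /GRing.scale/= mulr1.
apply: is_derive_eq; rewrite /GRing.scale/= /mode; ring.
Qed.

Lemma dmode_norm c i x : 0 < c -> `|dmode c i x| <= freq c i.
Proof.
move=> c0; have f0 := freq_gt0 i c0.
by rewrite /dmode normrM normrN (gtr0_norm f0) ler_piMr ?sin_max// ltW.
Qed.

Lemma smooth1_mode c i : smooth1 (mode c i).
Proof.
apply: (@smooth1_comp _ cos (fun x => freq c i * x)); first exact: smooth1_cos.
exact: (smooth1M (@smooth1_cst _ (freq c i)) (@smooth1_id R)).
Qed.

Lemma smooth1_continuous (f : R -> R) : smooth1 f -> continuous f.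
Proof.
move=> /(_ 1%N)[g fg _] x; apply/differentiable_continuous.
by apply/derivable1_diffP; have [] := fg x.
Qed.

Lemma Rintegral_antiderivative c (f F : R -> R) : 0 < c ->
  (forall x, is_derive x 1 F (f x)) -> continuous f ->
  \int[mu1]_(x in `](- c), c[) f x = F c - F (- c).
Proof.
move=> c0 dF cf; rewrite /Rintegral -(@integral_itv_bndoo _ _ _ _ true false); last first.
  apply/measurable_EFinP; apply: measurable_funTS.
  exact: continuous_measurable_fun.
have cF : continuous F.
  move=> x; apply/differentiable_continuous.
  by apply/derivable1_diffP; have [] := dF x.
rewrite (@continuous_FTC2 _ _ F)//.
- by rewrite gtrN.
- exact: continuous_subspaceT.
- split; first by move=> x _; have [] := dF x.
  + by apply: cvg_at_right_filter; exact: cF.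
  + by apply: cvg_at_left_filter; exact: cF.
- by move=> x _; rewrite derive1E; apply: derive_val.
Qed.

Lemma Rintegral_cos c l : 0 < c -> l != 0 ->
  \int[mu1]_(x in `](- c), c[) cos (l * x) = 2 * sin (l * c) / l.
Proof.
move=> c0 l0.
have dF (x : R) : is_derive x 1 (fun x => sin (l * x) / l) (cos (l * x)).
  have h : is_derive x 1 (fun x => sin (l * x)) (cos (l * x) * l).
    apply: is_derive_eq (@is_derive1_comp _ sin (fun x => l * x) x _ _ _ _) _.
    by rewrite /GRing.scale/= mulr1.
  by apply: is_derive_eq; rewrite /GRing.scale/=; field.
rewrite (Rintegral_antiderivative c0 dF); first by rewrite mulrN sinN; field.
move=> x; apply: (@continuous_comp _ _ _ (fun x => l * x) cos); last exact: continuous_cos.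
by apply: continuousM => //; exact: cvg_cst.
Qed.

Lemma Rintegral_mode c i : 0 < c ->
  \int[mu1]_(x in `](- c), c[) mode c i x = c * mode_coef i.
Proof.
move=> c0; have f0 := freq_gt0 i c0; rewrite /mode Rintegral_cos ?gt_eqF//.
rewrite freq_mul// /mode_coef /freq; have cn0 : c != 0 by rewrite gt_eqF.
have pn0 : pi != 0 :> R by rewrite gt_eqF// pi_gt0.
move: (oddr_neq0 R i) (sin _); move: (oddr i) => o o0 s.
by move: (pi : R) pn0 => P P0; field; rewrite o0 cn0 P0.
Qed.

Lemma interval_integrable c (f : R -> R) : continuous f ->
  mu1.-integrable `](- c), c[ (EFin \o f).
Proof.
move=> cf; have h : mu1.-integrable `[(- c), c] (EFin \o f).
  apply: continuous_compact_integrable; first exact: segment_compact.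
  exact: continuous_subspaceT.
by apply: integrableS h => //; exact: subset_itv_oo_cc.
Qed.

Lemma continuous_mode c i : continuous (mode c i).
Proof. exact: smooth1_continuous (smooth1_mode c i). Qed.

(** Product-to-sum formulas leave the frequencies [s] and [d]; the sines of [s c] and [d c] vanish
    by the addition formulas, each product containing a cosine that is 0. Only [d = 0], that is
    [i = j], contributes. *)
Lemma Rintegral_modeM c i j : 0 < c ->
  \int[mu1]_(x in `](- c), c[) (mode c i x * mode c j x) = c * (i == j)%:R.
Proof.
move=> c0; have fi0 := freq_gt0 i c0; have fj0 := freq_gt0 j c0.
pose s := freq c i + freq c j; pose d := freq c i - freq c j.
have sn0 : s != 0 by rewrite gt_eqF// addr_gt0.
have cc l : continuous (fun x : R => 2^-1 * cos (l * x)).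
  move=> x; apply: (@continuousM _ _ (cst 2^-1) (fun x => cos (l * x))).
    exact: cvg_cst.
  apply: (@continuous_comp _ _ _ (fun x => l * x) cos); last exact: continuous_cos.
  by apply: continuousM => //; exact: cvg_cst.
have cc' l : continuous (fun x : R => cos (l * x)).
  move=> x; apply: (@continuous_comp _ _ _ (fun x => l * x) cos); last exact: continuous_cos.
  by apply: continuousM => //; exact: cvg_cst.
rewrite (_ : (fun x => _) = (fun x => 2^-1 * cos (d * x) + 2^-1 * cos (s * x))); last first.
  apply/funext => x; rewrite /mode /d /s mulrBl mulrDl cosB cosD.
  by field.
rewrite RintegralD//; [|exact: interval_integrable|exact: interval_integrable].
rewrite !RintegralZl//; [|exact: interval_integrable|exact: interval_integrable].
rewrite (Rintegral_cos c0 sn0).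
have -> : sin (s * c) = 0 by rewrite /s mulrDl sinD !cos_freq// !(mulr0, mul0r) addr0.
rewrite mulr0 mul0r mulr0 addr0.
have [ij|ij] := eqVneq i j.
  have d0 : d = 0 by rewrite /d ij subrr.
  rewrite (_ : (fun x => _) = cst 1); last by apply/funext => x; rewrite d0 mul0r cos0.
  rewrite Rintegral_cst//= lebesgue_measure_itv/= lte_fin gtrN//=.
  by rewrite opprK mul1r mulr1; field.
have dn0 : d != 0.
  rewrite /d subr_eq0; apply/negP => /eqP h; move/eqP: ij; apply.
  have : oddr i = oddr j.
    apply: (@mulIf _ (pi / 2)); first by rewrite gt_eqF// divr_gt0// pi_gt0.
    by rewrite -!(freq_mul _ c0) h.
  by move/oddr_inj.
rewrite (Rintegral_cos c0 dn0).
have -> : sin (d * c) = 0 by rewrite /d mulrBl sinB !cos_freq// !(mulr0, mul0r) subr0.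
by rewrite !(mulr0, mul0r).
Qed.

Definition one_psum c (N : nat) x : R := \sum_(i < N) mode_coef i * mode c i x.
Definition coef_sqr_sum (N : nat) : R := \sum_(i < N) mode_coef i ^+ 2.

Lemma sqr_mode_coefE i : mode_coef i ^+ 2 = 16 / pi ^+ 2 * oddr i ^- 2.
Proof.
rewrite /mode_coef !exprMn (cos_sin_oddr i).2.
have pn0 : pi != 0 :> R by rewrite gt_eqF// pi_gt0.
move: (oddr_neq0 R i); move: (oddr i) => o o0.
by move: (pi : R) pn0 => P P0; field; rewrite o0 P0.
Qed.

(** Parseval's identity for the constant 1: [c] times this limit is the length [2 c] of the
    interval. It replaces completeness of the modes. *)
Lemma coef_sqr_sum_cvg : coef_sqr_sum n @[n --> \oo] --> (2 : R).
Proof.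
have pn0 : pi != 0 :> R by rewrite gt_eqF// pi_gt0.
have -> : (2 : R) = 16 / pi ^+ 2 * (pi ^+ 2 / 8).
  by move: (pi : R) pn0 => P P0; field.
rewrite (_ : coef_sqr_sum = (fun n => 16 / pi ^+ 2 * odd_sum R 2 n)); last first.
  by apply/funext => n; rewrite /odd_sum mulr_sumr; apply: eq_bigr => i _; exact: sqr_mode_coefE.
by apply: cvgM; [exact: cvg_cst|exact: odd_sum2_cvg].
Qed.

Lemma continuous_sum I (r : seq I) (F : I -> R -> R) :
  (forall i, continuous (F i)) -> continuous (fun x => \sum_(i <- r) F i x).
Proof.
move=> cF; elim: r => [|i r IH].
  by rewrite (_ : (fun x => _) = cst 0); [move=> x; exact: cvg_cst|
    apply/funext => x; rewrite big_nil].
rewrite (_ : (fun x => _) = (fun x => F i x + \sum_(i <- r) F i x)); last first.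
  by apply/funext => x; rewrite big_cons.
by move=> x; apply: continuousD; [exact: cF|exact: IH].
Qed.

Lemma Rintegral_itv_sum c I (r : seq I) (F : I -> R -> R) :
  (forall i, continuous (F i)) ->
  \int[mu1]_(x in `](- c), c[) (\sum_(i <- r) F i x) =
  \sum_(i <- r) \int[mu1]_(x in `](- c), c[) F i x.
Proof.
move=> cF; elim: r => [|i r IH].
  rewrite (_ : (fun x => _) = cst 0); last by apply/funext => x; rewrite big_nil.
  by rewrite Rintegral_cst//= mul0r big_nil.
rewrite (_ : (fun x => _) = (fun x => F i x + \sum_(i <- r) F i x)); last first.
  by apply/funext => x; rewrite big_cons.
rewrite RintegralD//.
- by rewrite IH big_cons.
- exact: interval_integrable.
- by apply: interval_integrable; exact: continuous_sum.
Qed.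

Lemma continuous_coefM c i (k : R) : continuous (fun x => k * mode c i x).
Proof.
move=> x; apply: (@continuousM _ _ (cst k) (mode c i)); first exact: cvg_cst.
exact: continuous_mode.
Qed.

Lemma continuous_one_psum c N : continuous (one_psum c N).
Proof. by apply: continuous_sum => i; exact: continuous_coefM. Qed.

Lemma Rintegral_one_psum c N : 0 < c ->
  \int[mu1]_(x in `](- c), c[) one_psum c N x = c * coef_sqr_sum N.
Proof.
move=> c0; rewrite /one_psum Rintegral_itv_sum => [|i]; last exact: continuous_coefM.
rewrite /coef_sqr_sum mulr_sumr; apply: eq_bigr => i _.
rewrite RintegralZl//; last by apply: interval_integrable; exact: continuous_mode.
by rewrite Rintegral_mode//; ring.
Qed.

Lemma Rintegral_one_psum_sqr c N : 0 < c ->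
  \int[mu1]_(x in `](- c), c[) (one_psum c N x ^+ 2) = c * coef_sqr_sum N.
Proof.
move=> c0.
have cMM k i j : continuous (fun x => k * (mode c i x * mode c j x)).
  move=> x; apply: (@continuousM _ _ (cst k) (fun x => mode c i x * mode c j x)).
    exact: cvg_cst.
  by apply: continuousM; exact: continuous_mode.
rewrite (_ : (fun x => _) = (fun x => \sum_(i < N) \sum_(j < N)
    mode_coef i * mode_coef j * (mode c i x * mode c j x))); last first.
  apply/funext => x; rewrite expr2 /one_psum mulr_suml; apply: eq_bigr => i _.
  by rewrite mulr_sumr; apply: eq_bigr => j _; ring.
rewrite Rintegral_itv_sum => [|i]; last by apply: continuous_sum => j; exact: cMM.
rewrite /coef_sqr_sum mulr_sumr; apply: eq_bigr => i _.
rewrite Rintegral_itv_sum => [|j]; last exact: cMM.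
rewrite (bigD1 i)//= big1 ?addr0 => [|j ji].
  rewrite RintegralZl//; last by apply: interval_integrable => x;
    apply: continuousM; exact: continuous_mode.
  by rewrite Rintegral_modeM// eqxx mulr1; ring.
rewrite RintegralZl//; last by apply: interval_integrable => x;
    apply: continuousM; exact: continuous_mode.
rewrite Rintegral_modeM//.
by rewrite (_ : (i == j :> nat) = false) ?mulr0//; apply/negbTE; rewrite eq_sym.
Qed.

End modes.

Section double_series.
Variable R : realType.
Notation oddr := (@oddr R).

(* [(2 k + 1)^(-3/2)]: the coefficients of the torsion series and of its gradient
   are dominated by products of these weights. *)
Definition weight (k : nat) : R := Num.sqrt (oddr k) ^- 3.

Lemma sqrt_oddr_gt0 k : 0 < Num.sqrt (oddr k).
Proof. by rewrite sqrtr_gt0 oddr_gt0. Qed.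

Lemma weight_ge0 k : 0 <= weight k.
Proof. by rewrite invr_ge0 exprn_ge0// ltW// sqrt_oddr_gt0. Qed.

(** Telescoping in the inverse square roots: for consecutive roots [s < x] one has [x^2 - s^2 = 2],
    so [1 / s - 1 / x = 2 / (s x (x + s)) >= x^-3]. *)
Lemma sum_weight_le N : \sum_(k < N) weight k <= 2.
Proof.
case: N => [|N]; first by rewrite big_ord0.
suff h : \sum_(k < N.+1) weight k <= 2 - (Num.sqrt (oddr N))^-1.
  by apply: le_trans h _; rewrite lerBlDr lerDl invr_ge0 ltW// sqrt_oddr_gt0.
elim: N => [|N IH].
  rewrite big_ord1 /weight oddrE mulr0 add0r sqrtr1 expr1n invr1; lra.
rewrite big_ord_recr/=.
have : weight N.+1 <= (Num.sqrt (oddr N))^-1 - (Num.sqrt (oddr N.+1))^-1.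
  rewrite /weight; have := sqrt_oddr_gt0 N; have := sqrt_oddr_gt0 N.+1.
  have := sqr_sqrtr (ltW (oddr_gt0 R N)); have := sqr_sqrtr (ltW (oddr_gt0 R N.+1)).
  have : oddr N.+1 = oddr N + 2 by rewrite !oddrE -natr1; ring.
  move: (Num.sqrt (oddr N)) (Num.sqrt (oddr N.+1)) => s x -> x2 s2 x0 s0.
  have xs : x ^+ 2 = s ^+ 2 + 2 by rewrite x2 s2.
  have sx : s < x by rewrite -ltr_sqr ?nnegrE ?ltW// xs ltrDl.
  have sn0 : s != 0 by rewrite gt_eqF.
  have xn0 : x != 0 by rewrite gt_eqF.
  have dn0 : x + s != 0 by rewrite gt_eqF// addr_gt0.
  have -> : s^-1 - x^-1 = 2 / (s * x * (x + s)).
    have -> : 2 = (x - s) * (x + s) by rewrite -subr_sqr xs; ring.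
    by field; rewrite dn0 xn0 sn0.
  have p0 : 0 < s * x * (x + s) by rewrite !mulr_gt0// addr_gt0.
  rewrite ler_pdivlMr// mulrC ler_pdivrMr ?exprn_gt0//.
  have -> : x ^+ 3 = x * (x * x) by ring.
  have : s * (x + s) <= 2 * (x * x) by nra.
  by move=> h; nra.
by move=> h; apply: le_trans (lerD IH h) _; rewrite addrA subrK.
Qed.

Definition square_sum (t : nat -> nat -> R) (N : nat) : R := \sum_(k < N) \sum_(l < N) t k l.

Lemma square_sum_nd t : (forall k l, 0 <= t k l) -> nondecreasing_seq (square_sum t).
Proof.
move=> t0; apply/nondecreasing_seqP => n; rewrite /square_sum big_ord_recr/=.
rewrite -[leLHS]addr0 lerD//; last exact: sumr_ge0.
by apply: ler_sum => i _; rewrite big_ord_recr/= lerDl.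
Qed.

Lemma square_sum_weight_le (K : R) N : 0 <= K ->
  square_sum (fun k l => K * (weight k * weight l)) N <= 4 * K.
Proof.
move=> K0; rewrite /square_sum.
rewrite (_ : \sum_(k < N) _ = K * ((\sum_(k < N) weight k) * (\sum_(l < N) weight l))).
  rewrite mulrC ler_wpM2r//.
  have h := sum_weight_le N; have h0 : 0 <= \sum_(k < N) weight k by apply: sumr_ge0 => k _; exact: weight_ge0.
  by nra.
rewrite mulr_suml mulr_sumr; apply: eq_bigr => k _.
by rewrite !mulr_sumr.
Qed.

(** Absolute convergence for sums over growing squares: [t + w] and [w] are nonnegative, so their
    square sums are monotone and bounded, and [t] is the difference. *)
Lemma square_sum_cvg (t : nat -> nat -> R) (K : R) : 0 <= K ->
  (forall k l, `|t k l| <= K * (weight k * weight l)) -> cvgn (square_sum t).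
Proof.
move=> K0 tK; pose w k l := K * (weight k * weight l).
have cw : cvgn (square_sum w).
  apply: nondecreasing_is_cvgn.
    by apply: square_sum_nd => k l; rewrite !mulr_ge0// weight_ge0.
  by exists (4 * K) => _ [n _ <-]; exact: square_sum_weight_le.
have ctw : cvgn (square_sum (fun k l => t k l + w k l)).
  apply: nondecreasing_is_cvgn.
    apply: square_sum_nd => k l; have := tK k l; rewrite ler_norml => /andP[h _].
    by rewrite -lerBlDr sub0r.
  exists (8 * K) => _ [n _ <-].
  have -> : 8 * K = 4 * (2 * K) by ring.
  apply: le_trans (square_sum_weight_le n (mulr_ge0 (ler0n _ 2) K0)).
  apply: ler_sum => k _; apply: ler_sum => l _.
  have := tK k l; rewrite ler_norml => /andP[_ h].
  by rewrite -mulrA mulrDl mul1r lerD.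
rewrite (_ : square_sum t = square_sum (fun k l => t k l + w k l) - square_sum w).
  exact: is_cvgB.
apply/funext => n; rewrite /square_sum -[RHS]/(_ - _) -sumrB; apply: eq_bigr => k _.
by rewrite -sumrB; apply: eq_bigr => l _; rewrite addrK.
Qed.

End double_series.

Section trig_sums.
Variables (R : realType) (a b : R).
Hypotheses (a0 : 0 < a) (b0 : 0 < b).
Notation D := (rectangle a b : set (plane R)).
Notation mu := (@area R).
Notation side := (half_width a b).
Implicit Types (A : nat -> nat -> R) (p : R * R).

Let sel (i : bool) (k l : nat) : nat := if i then l else k.

Definition mode2 (k l : nat) p : R :=
  mode a k (coordinate false p) * mode b l (coordinate true p).

Let mode2E i k l : mode2 k l = (fun p =>
  mode (side i) (sel i k l) (coordinate i p) *
  mode (side (~~ i)) (sel (~~ i) k l) (coordinate (~~ i) p)).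
Proof. by apply/funext => p; case: i => //=; rewrite /mode2 mulrC. Qed.

Definition dmode2 i k l p : R :=
  dmode (side i) (sel i k l) (coordinate i p) *
  mode (side (~~ i)) (sel (~~ i) k l) (coordinate (~~ i) p).

Definition mode_freq i k l : R := freq (side i) (sel i k l).

Lemma freq2_gt0 i k l : 0 < mode_freq i k l.
Proof. by apply: freq_gt0; exact: half_width_gt0. Qed.

Lemma diff2_upto_mode2 m k l : diff2_upto m (mode2 k l).
Proof.
apply: diff2_uptoM.
  exact: (diff2_upto_lift m false (smooth1_mode a k)).
exact: (diff2_upto_lift m true (smooth1_mode b l)).
Qed.

Lemma partial_mode2 i k l : partial i (mode2 k l) = dmode2 i k l.
Proof.
rewrite (mode2E i).
have [d1 e1] := partial_lift i (is_derive_mode (side i) (sel i k l)).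
have [d2 e2] := partial_liftN i (mode (side (~~ i)) (sel (~~ i) k l)).
apply/funext => p.
by rewrite (partialM d1 d2) e1 e2 /= mulr0 add0r mulrC.
Qed.

Lemma partial_dmode2 i k l :
  partial i (dmode2 i k l) = (fun p => - mode_freq i k l ^+ 2 * mode2 k l p).
Proof.
have [d1 e1] := partial_lift i (is_derive_dmode (side i) (sel i k l)).
have [d2 e2] := partial_liftN i (mode (side (~~ i)) (sel (~~ i) k l)).
apply/funext => p; rewrite (mode2E i) /dmode2.
rewrite (partialM d1 d2) e1 e2 /= mulr0 add0r mulrC mulrA.
by rewrite mulrC mulrA mulrC.
Qed.

Lemma mode2_bound i k l p : D p ->
  `|mode2 k l p| <= mode_freq i k l / side i * (side i ^+ 2 - coordinate i p ^+ 2).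
Proof.
move=> Dp; rewrite (mode2E i) normrM -[leRHS]mulr1 ler_pM// ?mode_norm//.
by apply: mode_bound; [exact: half_width_gt0|exact: coord_lt_side].
Qed.

Lemma dmode2_bound i k l p : `|dmode2 i k l p| <= mode_freq i k l.
Proof.
rewrite /dmode2 normrM -[leRHS]mulr1 ler_pM// ?mode_norm//.
by apply: dmode_norm; exact: half_width_gt0.
Qed.

Lemma partialZ i (c : R) f : (forall p, derivable f p (dir R i)) ->
  (forall p, derivable (fun p => c * f p) p (dir R i)) /\
  partial i (fun p => c * f p) = (fun p => c * partial i f p).
Proof.
move=> df; have dc p : derivable (cst c) p (dir R i) by exact: derivable_cst.
split; first by move=> p; exact: (derivableM (dc p) (df p)).
rewrite (partialM dc df); apply/funext => p.
by rewrite {2}/partial derive_cst mulr0 addr0.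
Qed.

Lemma partial_sum i I (r : seq I) (F : I -> R * R -> R) :
  (forall k p, derivable (F k) p (dir R i)) ->
  (forall p, derivable (fun p => \sum_(k <- r) F k p) p (dir R i)) /\
  partial i (fun p => \sum_(k <- r) F k p) = (fun p => \sum_(k <- r) partial i (F k) p).
Proof.
move=> dF; elim: r => [|k r [d e]].
  rewrite (_ : (fun p => \sum_(k <- [::]) F k p) = cst 0); last first.
    by apply/funext => p; rewrite big_nil.
  split; first by move=> p; exact: derivable_cst.
  by apply/funext => p; rewrite big_nil /partial derive_cst.
rewrite (_ : (fun p => \sum_(k <- k :: r) F k p) =
  (fun p => F k p + \sum_(k <- r) F k p)); last first.
  by apply/funext => p; rewrite big_cons.
split; first by move=> p; exact: (derivableD (dF k p) (d p)).
by rewrite (partialD (dF k) d) e; apply/funext => p; rewrite big_cons.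
Qed.

Definition trig_sum A N p : R := square_sum (fun k l => A k l * mode2 k l p) N.
Definition dtrig_sum i A N p : R := square_sum (fun k l => A k l * dmode2 i k l p) N.

Lemma diff2_upto_trig_sum m A N : diff2_upto m (trig_sum A N).
Proof.
apply: diff2_upto_sum => k; apply: diff2_upto_sum => l.
apply: diff2_uptoM; [exact: diff2_upto_cst|exact: diff2_upto_mode2].
Qed.

Let partial_square_sum i A (f f' : nat -> nat -> R * R -> R) N :
  (forall k l p, derivable (f k l) p (dir R i)) ->
  (forall k l, partial i (f k l) = f' k l) ->
  partial i (fun p => square_sum (fun k l => A k l * f k l p) N) =
  (fun p => square_sum (fun k l => A k l * f' k l p) N).
Proof.
move=> df ff'.
have h1 (k l : 'I_N) := partialZ (A k l) (df k l).
have h2 (k : 'I_N) := partial_sum (index_enum 'I_N) (fun l => (h1 k l).1).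
rewrite /square_sum (partial_sum (index_enum 'I_N) (fun k => (h2 k).1)).2.
apply/funext => p; apply: eq_bigr => k _; rewrite (h2 k).2; apply: eq_bigr => l _.
by rewrite (h1 k l).2 ff'.
Qed.

Lemma partial_trig_sum i A N : partial i (trig_sum A N) = dtrig_sum i A N.
Proof.
apply: partial_square_sum => k l; last exact: partial_mode2.
by have [_ /(_ i)[]] := diff2_upto_mode2 1 k l.
Qed.

Lemma partial_dtrig_sum i A N :
  partial i (dtrig_sum i A N) = trig_sum (fun k l => - mode_freq i k l ^+ 2 * A k l) N.
Proof.
rewrite /dtrig_sum (partial_square_sum A (f' := fun k l p => - mode_freq i k l ^+ 2 * mode2 k l p)).
- apply/funext => p; apply: eq_bigr => k _; apply: eq_bigr => l _.
  by rewrite mulrA [A k l * _]mulrC.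
- move=> k l; rewrite -partial_mode2.
  by have [_ /(_ i)[_ [_ /(_ i)[]]]] := diff2_upto_mode2 2 k l.
- by move=> k l; exact: partial_dmode2.
Qed.

Lemma continuous_trig_sum A N : continuous (trig_sum A N).
Proof. exact: (diff2_upto_continuous (diff2_upto_trig_sum 0 A N)). Qed.

Lemma continuous_dtrig_sum i A N : continuous (dtrig_sum i A N).
Proof. by rewrite -partial_trig_sum; have [_ /(_ i)[_ []]] := diff2_upto_trig_sum 1 A N. Qed.

Lemma derivable_dtrig_sum i A N p : derivable (dtrig_sum i A N) p (dir R i).
Proof.
by rewrite -partial_trig_sum; have [_ /(_ i)[_ [_ /(_ i)[]]]] := diff2_upto_trig_sum 2 A N.
Qed.

Lemma square_sum_norm (t : nat -> nat -> R) N :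
  `|square_sum t N| <= square_sum (fun k l => `|t k l|) N.
Proof.
apply: le_trans (ler_norm_sum _ _ _) _.
by apply: ler_sum => k _; exact: ler_norm_sum.
Qed.

(** Controls the gradient of a partial sum and, divided by the side, its decay at the boundary; a
    bound uniform in [N] is all that membership in H^1_0 requires. *)
Definition freq_mass i A N : R := square_sum (fun k l => `|A k l| * mode_freq i k l) N.

Lemma trig_sum_bound i A N p : D p -> `|trig_sum A N p| <=
  freq_mass i A N / side i * (side i ^+ 2 - coordinate i p ^+ 2).
Proof.
move=> Dp; apply: le_trans (square_sum_norm _ _) _.
rewrite /freq_mass /square_sum -mulrA mulr_suml; apply: ler_sum => k _.
rewrite mulr_suml; apply: ler_sum => l _.
rewrite normrM -mulrA ler_wpM2l// mulrA; exact: mode2_bound.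
Qed.

Lemma dtrig_sum_bound i A N p : `|dtrig_sum i A N p| <= freq_mass i A N.
Proof.
apply: le_trans (square_sum_norm _ _) _.
apply: ler_sum => k _; apply: ler_sum => l _.
rewrite normrM ler_wpM2l//; exact: dmode2_bound.
Qed.

Lemma H10_trig_sum_lim A (f : nat -> nat) (u : R * R -> R) (g : bool -> R * R -> R) (K : R) :
  (forall i N, freq_mass i A N <= K) ->
  (forall p, D p -> trig_sum A (f n) p @[n --> \oo] --> u p) ->
  (forall i p, D p -> dtrig_sum i A (f n) p @[n --> \oo] --> g i p) ->
  H10 D u g.
Proof.
move=> AK tu tg.
have K0 : 0 <= K.
  apply: le_trans (AK true 0%N); apply: sumr_ge0 => k _; apply: sumr_ge0 => l _.
  by rewrite mulr_ge0// ltW// freq2_gt0.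
(* One constant for both hypotheses of the approximation lemma: it dominates [K] for the gradient
   and [K / side i] for the decay. *)
pose M := K + K / a + K / b.
have KM i : K / side i <= M.
  have h1 : 0 <= K / a by rewrite divr_ge0// ltW.
  have h2 : 0 <= K / b by rewrite divr_ge0// ltW.
  by rewrite /M; case: i => /=; lra.
apply: (@H10_approximation R a b a0 b0 (fun n => trig_sum A (f n)) u g M) => //.
- by move=> n m; exact: diff2_upto_trig_sum.
- move=> n i p Dp; apply: le_trans (trig_sum_bound i A (f n) Dp) _.
  rewrite ler_wpM2r ?(ltW (coord_sqr_lt a0 b0 i Dp))//.
  apply: le_trans (KM i); rewrite ler_wpM2r// invr_ge0 ltW//.
  exact: half_width_gt0.
- move=> n i p Dp; rewrite partial_trig_sum; apply: le_trans (dtrig_sum_bound _ _ _ _) _.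
  apply: le_trans (AK i _) _.
  have h1 : 0 <= K / a by rewrite divr_ge0// ltW.
  have h2 : 0 <= K / b by rewrite divr_ge0// ltW.
  by rewrite /M; lra.
- by move=> i p Dp; under eq_fun do rewrite partial_trig_sum; exact: tg.
Qed.

Definition laplace_eig k l : R := freq a k ^+ 2 + freq b l ^+ 2.

(** Modes are eigenfunctions: differentiating [dtrig_sum] again multiplies the coefficients by
    [- mode_freq^2], and the two directions add up to [laplace_eig]. *)
Lemma trig_sum_weak A N phi : test_function D phi ->
  \int[mu]_(p in D) (\sum_(i : bool) dtrig_sum i A N p * partial i phi p) =
  \int[mu]_(p in D) (trig_sum (fun k l => laplace_eig k l * A k l) N p * phi p).
Proof.
move=> tphi.
have cphi := test_function_continuous tphi.
have cd i : continuous (fun p => dtrig_sum i A N p * partial i phi p).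
  move=> p; apply: continuousM; first exact: continuous_dtrig_sum.
  exact: (test_function_partial (i := i) tphi).
have ct B : continuous (fun p => trig_sum B N p * phi p).
  by move=> p; apply: continuousM; [exact: continuous_trig_sum|exact: cphi].
rewrite (_ : (fun p => \sum_(i : bool) _) = (fun p => dtrig_sum true A N p * partial true phi p +
  dtrig_sum false A N p * partial false phi p)); last first.
  by apply/funext => p; rewrite big_bool.
have mD := measurable_rectangle a b.
rewrite RintegralD//; [|exact: (continuous_rectangle_integrable a0 b0 (@cd true))|
  exact: (continuous_rectangle_integrable a0 b0 (@cd false))].
have ibp i : \int[mu]_(p in D) (dtrig_sum i A N p * partial i phi p) =
    \int[mu]_(p in D) (trig_sum (fun k l => mode_freq i k l ^+ 2 * A k l) N p * phi p).
  rewrite (test_integration_by_parts a0 b0 _ _ _ tphi).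
  - rewrite partial_dtrig_sum -mulN1r -RintegralZl//; last first.
      exact: (continuous_rectangle_integrable a0 b0 (@ct _)).
    apply: eq_Rintegral => p _; rewrite mulrA; congr (_ * _).
    rewrite /trig_sum /square_sum mulr_sumr; apply: eq_bigr => k _.
    by rewrite mulr_sumr; apply: eq_bigr => l _; ring.
  - exact: continuous_dtrig_sum.
  - by move=> p; exact: derivable_dtrig_sum.
  - by rewrite partial_dtrig_sum; exact: continuous_trig_sum.
rewrite !ibp -RintegralD//; [|exact: (continuous_rectangle_integrable a0 b0 (@ct _))|
  exact: (continuous_rectangle_integrable a0 b0 (@ct _))].
apply: eq_Rintegral => p _; rewrite -mulrDl; congr (_ * _).
rewrite /trig_sum /square_sum -big_split/=; apply: eq_bigr => k _.
rewrite -big_split/=; apply: eq_bigr => l _.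
by rewrite /laplace_eig /mode_freq /=; ring.
Qed.

End trig_sums.

(** * Weak solutions tested against functions of H^1_0 *)

Section weak_solutions.
Variables (R : realType) (a b : R).
Hypotheses (a0 : 0 < a) (b0 : 0 < b).
Notation D := (rectangle a b : set (plane R)).
Notation mu := (@area R).
Notation side := (half_width a b).
Implicit Types (A : nat -> nat -> R) (p : R * R) (u f : plane R -> R)
  (g : bool -> plane R -> R).

Let mD := measurable_rectangle a b.
Let fD := area_rectangle_lty a0 b0.

Lemma test_function_L2 phi : test_function D phi -> L2 D phi.
Proof.
move=> tphi; apply: (continuous_rectangle_L2 a0 b0).
exact: test_function_continuous tphi.
Qed.

Lemma test_function_partial_L2 i phi : test_function D phi -> L2 D (partial i phi).
Proof.
move=> tphi; apply: (continuous_rectangle_L2 a0 b0).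
exact: (test_function_partial (i := i) tphi).
Qed.

Lemma H10_approximants u g : H10 D u g -> exists phi : nat -> R * R -> R,
  [/\ forall n, test_function D (phi n),
    \int[mu]_(p in D) ((phi n p - u p) ^+ 2) @[n --> \oo] --> (0 : R) &
    forall i, \int[mu]_(p in D) ((partial i (phi n) p - g i p) ^+ 2)
      @[n --> \oo] --> (0 : R)].
Proof.
move=> [[u2 g2 _] [phi [tphi cphi]]]; exists phi.
pose F n p := (phi n p - u p) ^+ 2 + \sum_(i : bool) (partial i (phi n) p - g i p) ^+ 2.
have cF : \int[mu]_(p in D) (F n p) @[n --> \oo] --> (0 : R) by exact: fine_cvg cphi.
have i1 n : mu.-integrable D (EFin \o (fun p => (phi n p - u p) ^+ 2)).
  by apply: L2_sqr_integrable; apply: (L2B mD) => //; exact: test_function_L2.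
have i2 n i : mu.-integrable D (EFin \o (fun p => (partial i (phi n) p - g i p) ^+ 2)).
  by apply: L2_sqr_integrable; apply: (L2B mD) => //; exact: test_function_partial_L2.
have FE n : F n = (fun p => (phi n p - u p) ^+ 2 + ((partial true (phi n) p - g true p) ^+ 2
    + (partial false (phi n) p - g false p) ^+ 2)).
  by apply/funext => p; rewrite /F big_bool.
have iF n : mu.-integrable D (EFin \o F n).
  rewrite FE (_ : EFin \o _ = ((EFin \o (fun p => (phi n p - u p) ^+ 2)%R) \+
    ((EFin \o (fun p => (partial true (phi n) p - g true p) ^+ 2)%R) \+
     (EFin \o (fun p => (partial false (phi n) p - g false p) ^+ 2)%R)))%E)//.
  by apply: integrableD => //; exact: integrableD.
have sq (G : nat -> plane R -> R) : (forall n, mu.-integrable D (EFin \o G n)) ->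
    (forall n p, 0 <= G n p <= F n p) -> \int[mu]_(p in D) (G n p) @[n --> \oo] --> (0 : R).
  move=> iG GF; apply: (@squeeze_cvgr _ _ _ _ (cst 0) (fun n => \int[mu]_(p in D) (F n p))) => //.
    apply: nearW => n; apply/andP; split.
      by apply: Rintegral_ge0 => p _; case/andP: (GF n p).
    by apply: le_Rintegral => // p _; case/andP: (GF n p).
  exact: cvg_cst.
split=> [//||i].
  apply: sq => // n p; rewrite sqr_ge0/= FE lerDl.
  by rewrite addr_ge0// sqr_ge0.
apply: sq => // n p; rewrite sqr_ge0/= FE.
have h1 := sqr_ge0 (phi n p - u p).
have h2 := sqr_ge0 (partial true (phi n) p - g true p).
have h3 := sqr_ge0 (partial false (phi n) p - g false p).
by case: (i); [rewrite addrCA lerDl addr_ge0|rewrite addrA lerDr addr_ge0].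
Qed.

Lemma Rintegral_sum_bool (F : bool -> plane R -> R) :
  (forall i, mu.-integrable D (EFin \o F i)) ->
  \int[mu]_(p in D) (\sum_(i : bool) F i p) = \sum_(i : bool) \int[mu]_(p in D) F i p.
Proof.
move=> iF; rewrite big_bool.
rewrite (_ : (fun p => _) = (fun p => F true p + F false p)); last first.
  by apply/funext => p; rewrite big_bool.
by rewrite RintegralD.
Qed.

Lemma cvg_sum_bool (x : bool -> nat -> R) (l : bool -> R) :
  (forall i, x i n @[n --> \oo] --> l i) ->
  \sum_(i : bool) x i n @[n --> \oo] --> \sum_(i : bool) l i.
Proof.
move=> h; rewrite big_bool (_ : (fun n => _) = (fun n => x true n + x false n)).
  by apply: cvgD; exact: h.
by apply/funext => n; rewrite big_bool.
Qed.

(** By density the equation can be tested with any [v] in H^1_0: both sides are continuous in L^2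
    along the approximating test functions and their gradients. *)
Lemma weak_solution_test u g f v h : H10 D u g -> L2 D f ->
  (forall phi, test_function D phi ->
      \int[mu]_(p in D) (\sum_(i : bool) g i p * partial i phi p) =
      \int[mu]_(p in D) (f p * phi p)) ->
  H10 D v h ->
  \sum_(i : bool) \int[mu]_(p in D) (g i p * h i p) = \int[mu]_(p in D) (f p * v p).
Proof.
move=> [[u2 g2 _] _] f2 uf /[dup] -[[v2 h2 _] _] /H10_approximants[phi [tphi cphi cdphi]].
have l1 : \int[mu]_(p in D) (phi n p * f p) @[n --> \oo] --> \int[mu]_(p in D) (v p * f p).
  by apply: (L2_cvgM mD) => // n; exact: test_function_L2.
have l2 : \sum_(i : bool) \int[mu]_(p in D) (partial i (phi n) p * g i p) @[n --> \oo] -->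
    \sum_(i : bool) \int[mu]_(p in D) (h i p * g i p).
  apply: (@cvg_sum_bool (fun i n => \int[mu]_(p in D) (partial i (phi n) p * g i p))).
  move=> i.
  by apply: (L2_cvgM mD) => // n; exact: test_function_partial_L2.
have e : (fun n => \int[mu]_(p in D) (phi n p * f p)) =
    (fun n => \sum_(i : bool) \int[mu]_(p in D) (partial i (phi n) p * g i p)).
  apply/funext => n; under eq_Rintegral do rewrite mulrC.
  rewrite -uf// Rintegral_sum_bool => [|i].
    by apply: eq_bigr => i _; under eq_Rintegral do rewrite mulrC.
  by apply: (L2_integrableM mD) => //; exact: test_function_partial_L2.
rewrite e in l1.
under eq_bigr do under eq_Rintegral do rewrite mulrC.
under [RHS]eq_Rintegral do rewrite mulrC.
by rewrite -[LHS](cvg_lim (@Rhausdorff R) l2) -[RHS](cvg_lim (@Rhausdorff R) l1).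
Qed.

Lemma freq_mass_ge0 i A N : 0 <= freq_mass a b i A N.
Proof.
apply: sumr_ge0 => k _; apply: sumr_ge0 => l _.
by rewrite mulr_ge0// ltW// freq2_gt0.
Qed.

(** With coefficients truncated at [N] the partial sums are eventually constant, so the limit
    criterion also covers a single finite sum. *)
Lemma H10_trig_sum A N : H10 D (trig_sum a b A N) (fun i => dtrig_sum a b i A N).
Proof.
pose A' k l := if (k < N)%N && (l < N)%N then A k l else 0.
have e (t : nat -> nat -> R) n : (N <= n)%N ->
    square_sum (fun k l => if (k < N)%N && (l < N)%N then t k l else 0) n = square_sum t N.
  move=> Nn; rewrite /square_sum (big_ord_widen n (fun k => \sum_(l < N) t k l) Nn) [RHS]big_mkcond.
  apply: eq_bigr => k _; case: ifPn => kN; last by rewrite big1.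
  by rewrite (big_ord_widen n (t k) Nn) [RHS]big_mkcond.
have e1 p n : (N <= n)%N -> trig_sum a b A' n p = trig_sum a b A N p.
  move=> Nn; rewrite /trig_sum -(e (fun k l => A k l * mode2 a b k l p) _ Nn).
  apply: eq_bigr => k _; apply: eq_bigr => l _; rewrite /A'.
  by case: ifP => // _; rewrite mul0r.
have e2 i p n : (N <= n)%N -> dtrig_sum a b i A' n p = dtrig_sum a b i A N p.
  move=> Nn; rewrite /dtrig_sum -(e (fun k l => A k l * dmode2 a b i k l p) _ Nn).
  apply: eq_bigr => k _; apply: eq_bigr => l _; rewrite /A'.
  by case: ifP => // _; rewrite mul0r.
pose K := freq_mass a b true A N + freq_mass a b false A N.
have nd i : nondecreasing_seq (freq_mass a b i A').
  apply: square_sum_nd => k l; by rewrite mulr_ge0// ltW// freq2_gt0.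
apply: (@H10_trig_sum_lim R a b a0 b0 A' id _ _ K).
- move=> i n; apply: (@le_trans _ _ (freq_mass a b i A' (maxn n N))).
    by apply: nd; exact: leq_maxl.
  apply: (@le_trans _ _ (freq_mass a b i A N)).
    rewrite /freq_mass -(e (fun k l => `|A k l| * mode_freq a b i k l) _ (leq_maxr n N)).
    apply: ler_sum => k _; apply: ler_sum => l _; rewrite /A'.
    by case: ifP => // _; rewrite normr0 mul0r.
  have h1 := freq_mass_ge0 true A N; have h2 := freq_mass_ge0 false A N.
  by rewrite /K; case: (i); lra.
- move=> p _; apply: cvg_near_cst; exists N => // n /= Nn; rewrite e1//.
- move=> i p _; apply: cvg_near_cst; exists N => // n /= Nn; rewrite e2//.
Qed.

Lemma H10_trig_sum_test u g A N : H10 D u g ->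
  \sum_(i : bool) \int[mu]_(p in D) (dtrig_sum a b i A N p * g i p) =
  \int[mu]_(p in D) (trig_sum a b (fun k l => laplace_eig a b k l * A k l) N p * u p).
Proof.
move=> ug; apply: (weak_solution_test (H10_trig_sum A N)) => //.
  by apply: (continuous_rectangle_L2 a0 b0); exact: continuous_trig_sum.
by move=> phi tphi; exact: trig_sum_weak.
Qed.

(** Green's second identity: the equation of [u] tested with the trigonometric sum, and that of the
    sum tested with [u], share the same energy integral. *)
Lemma weak_solution_trig_sum u f A N : weak_solution D u f -> L2 D f ->
  \int[mu]_(p in D) (trig_sum a b (fun k l => laplace_eig a b k l * A k l) N p * u p) =
  \int[mu]_(p in D) (f p * trig_sum a b A N p).
Proof.
move=> [g ug uf] f2; rewrite -(H10_trig_sum_test A N ug).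
rewrite -(weak_solution_test ug f2 uf (H10_trig_sum A N)).
by apply: eq_bigr => i _; apply: eq_Rintegral => p _; rewrite mulrC.
Qed.

End weak_solutions.

(** * Torsional rigidity and first eigenvalue *)

Section torsion.
Variables (R : realType) (a b : R).
Hypotheses (a0 : 0 < a) (b0 : 0 < b).
Notation D := (rectangle a b : set (plane R)).
Notation mu := (@area R).
Notation mu1 := (@lebesgue_measure R).
Notation side := (half_width a b).
Notation oddr := (@oddr R).

Let mD := measurable_rectangle a b.
Let fD := area_rectangle_lty a0 b0.

Definition one_coef k l : R := mode_coef R k * mode_coef R l.
Definition torsion_coef k l : R := one_coef k l / laplace_eig a b k l.

Lemma laplace_eig_gt0 k l : 0 < laplace_eig a b k l.
Proof. by rewrite addr_gt0// exprn_gt0// freq_gt0. Qed.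

Lemma laplace_eig_torsion_coef k l : laplace_eig a b k l * torsion_coef k l = one_coef k l.
Proof. by rewrite /torsion_coef mulrC divfK// gt_eqF// laplace_eig_gt0. Qed.

Lemma trig_sum_laplace_eig_torsion : trig_sum a b (fun k l => laplace_eig a b k l * torsion_coef k l) = trig_sum a b one_coef.
Proof.
apply/funext => N; apply/funext => p; apply: eq_bigr => k _; apply: eq_bigr => l _.
by rewrite laplace_eig_torsion_coef.
Qed.

Lemma trig_sum_oneE N p : trig_sum a b one_coef N p = one_psum a N p.1 * one_psum b N p.2.
Proof.
rewrite /one_psum mulr_suml; apply: eq_bigr => k _; rewrite mulr_sumr; apply: eq_bigr => l _.
by rewrite /one_coef /mode2 /=; ring.
Qed.

Lemma Rintegral_rectangle_tensor (f g : R -> R) : continuous f -> continuous g ->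
  \int[mu]_(p in D) (f p.1 * g p.2) =
  \int[mu1]_(x in `](- a), a[) f x * \int[mu1]_(x in `](- b), b[) g x.
Proof.
move=> cf cg; apply: Rintegral_tensor => //.
- exact: interval_integrable.
- exact: interval_integrable.
- apply: (continuous_rectangle_integrable a0 b0 (f := fun p => f p.1 * g p.2)) => p.
  apply: (@continuousM _ _ (fun p : R * R => f p.1) (fun p => g p.2)).
    by apply: (@continuous_comp _ _ _ fst f); [exact: cvg_fst|exact: cf].
  by apply: (@continuous_comp _ _ _ snd g); [exact: cvg_snd|exact: cg].
Qed.

(** With [q = coef_sqr_sum N], both the integral of the partial sum and that of its square are
    [a b q^2], while the area is [4 a b]. The squared error is thus [a b (4 - q^2)], and [q] tends
    to 2. *)
Lemma trig_sum_one_cvg :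
  \int[mu]_(p in D) ((trig_sum a b one_coef n p - cst 1 p) ^+ 2) @[n --> \oo] --> (0 : R).
Proof.
have e N : \int[mu]_(p in D) ((trig_sum a b one_coef N p - cst 1 p) ^+ 2) =
    a * b * (4 - coef_sqr_sum R N * coef_sqr_sum R N).
  have cp := @continuous_one_psum R.
  have cp2 c n : continuous (fun x : R => one_psum c n x ^+ 2).
    by move=> x; apply: continuousM; exact: cp.
  have i1 : mu.-integrable D (EFin \o (fun p : plane R => one_psum a N p.1 ^+ 2 * one_psum b N p.2 ^+ 2)).
    apply: (continuous_rectangle_integrable a0 b0 (f := fun p => one_psum a N p.1 ^+ 2 * one_psum b N p.2 ^+ 2)) => p.
    apply: (@continuousM _ _ (fun p : R * R => one_psum a N p.1 ^+ 2) (fun p => one_psum b N p.2 ^+ 2)).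
      by apply: (@continuous_comp _ _ _ fst (fun x => one_psum a N x ^+ 2)); [exact: cvg_fst|exact: cp2].
    by apply: (@continuous_comp _ _ _ snd (fun x => one_psum b N x ^+ 2)); [exact: cvg_snd|exact: cp2].
  have i2 : mu.-integrable D (EFin \o (fun p : plane R => one_psum a N p.1 * one_psum b N p.2)).
    rewrite (_ : EFin \o _ = EFin \o (trig_sum a b one_coef N : plane R -> R)); last first.
      by apply/funext => p /=; rewrite trig_sum_oneE.
    by apply: continuous_rectangle_integrable => //; exact: continuous_trig_sum.
  have i3 : mu.-integrable D (EFin \o (fun p : plane R => 2 * (one_psum a N p.1 * one_psum b N p.2))).
    rewrite (_ : EFin \o _ = (fun p => 2%:E * (EFin \o (fun p : plane R => one_psum a N p.1 * one_psum b N p.2)%R) p)%E).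
      exact: integrableZl.
    by apply/funext => p; rewrite /= EFinM.
  have i4 : mu.-integrable D (EFin \o (cst 1 : plane R -> R)).
    by apply: (continuous_rectangle_integrable a0 b0) => p; exact: cvg_cst.
  rewrite (_ : (fun p => _) = (fun p => (one_psum a N p.1 ^+ 2 * one_psum b N p.2 ^+ 2 -
     2 * (one_psum a N p.1 * one_psum b N p.2)) + cst 1 p)); last first.
    by apply/funext => p; rewrite trig_sum_oneE /=; ring.
  rewrite RintegralD//; last first.
    rewrite (_ : EFin \o _ =
      (EFin \o (fun p : plane R => one_psum a N p.1 ^+ 2 * one_psum b N p.2 ^+ 2)%R) \-
      (EFin \o (fun p : plane R => 2 * (one_psum a N p.1 * one_psum b N p.2))%R))%E//.
    exact: integrableB.
  rewrite RintegralB// RintegralZl//.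
  rewrite (Rintegral_rectangle_tensor (cp2 a N) (cp2 b N)) (Rintegral_rectangle_tensor (cp a N) (cp b N)).
  rewrite !Rintegral_one_psum// !Rintegral_one_psum_sqr// Rintegral_cst//.
  rewrite (_ : fine _ = 4 * (a * b)); last exact: (congr1 fine (area_rectangle a0 b0)).
  by ring.
have -> : (fun N => \int[mu]_(p in D) ((trig_sum a b one_coef N p - cst 1 p) ^+ 2)) =
    (fun N => a * b * (4 - coef_sqr_sum R N * coef_sqr_sum R N)) by apply/funext => N; exact: e.
rewrite (_ : 0 = a * b * (4 - 2 * 2)); last by ring.
apply: cvgM; first exact: cvg_cst.
apply: cvgB; first exact: cvg_cst.
by apply: cvgM; exact: coef_sqr_sum_cvg.
Qed.

Lemma Rintegral_mode2 k l : \int[mu]_(p in D) mode2 a b k l p =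
  (a * mode_coef R k) * (b * mode_coef R l).
Proof.
rewrite (Rintegral_rectangle_tensor (@continuous_mode R a k) (@continuous_mode R b l)).
by rewrite !Rintegral_mode.
Qed.

Lemma Rintegral_rectangle_sum I (r : seq I) (F : I -> R * R -> R) :
  (forall i, continuous (F i)) ->
  continuous (fun p => \sum_(i <- r) F i p) /\
  \int[mu]_(p in D) (\sum_(i <- r) F i p) =
  \sum_(i <- r) \int[mu]_(p in D) F i p.
Proof.
move=> cF; elim: r => [|i r [c e]].
  rewrite (_ : (fun p => _) = cst 0); last by apply/funext => p; rewrite big_nil.
  by split; [move=> p; exact: cvg_cst|rewrite Rintegral_cst//= mul0r big_nil].
rewrite (_ : (fun p => _) = (fun p => F i p + \sum_(i <- r) F i p)); last first.
  by apply/funext => p; rewrite big_cons.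
split; first by move=> p; apply: continuousD; [exact: cF|exact: c].
rewrite RintegralD//.
- by rewrite e big_cons.
- exact: continuous_rectangle_integrable.
- exact: continuous_rectangle_integrable.
Qed.

Lemma Rintegral_trig_sum A N : \int[mu]_(p in D) trig_sum a b A N p =
  square_sum (fun k l => A k l * ((a * mode_coef R k) * (b * mode_coef R l))) N.
Proof.
have cm k l : continuous (mode2 a b k l).
  exact: (diff2_upto_continuous (diff2_upto_mode2 a b 0 k l)).
have cAm k l : continuous (fun p => A k l * mode2 a b k l p).
  by move=> p; apply: (continuousM (cvg_cst _) (@cm k l p)).
have h k := @Rintegral_rectangle_sum _ (index_enum 'I_N) (fun l => fun p => A k l * mode2 a b k l p)
  (fun l => @cAm k l).
rewrite (Rintegral_rectangle_sum (index_enum 'I_N) (fun k : 'I_N => (h k).1)).2.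
apply: eq_bigr => k _; rewrite (h k).2; apply: eq_bigr => l _.
rewrite RintegralZl//; last exact: (continuous_rectangle_integrable a0 b0).
by rewrite Rintegral_mode2.
Qed.

Lemma torsion_integral_cvg u : weak_solution D u (cst 1) ->
  square_sum (fun k l => torsion_coef k l * ((a * mode_coef R k) * (b * mode_coef R l))) n
    @[n --> \oo] --> \int[mu]_(p in D) u p.
Proof.
move=> wu; have c1 : L2 D (cst 1 : plane R -> R) by exact: L2_cst.
have u2 : L2 D u by case: wu => g [[+ _ _] _] _.
have l1 : \int[mu]_(p in D) (trig_sum a b one_coef n p * u p) @[n --> \oo] -->
    \int[mu]_(p in D) (cst 1 p * u p).
  apply: (L2_cvgM mD) => //; last exact: trig_sum_one_cvg.
  by move=> n; apply: (continuous_rectangle_L2 a0 b0); exact: continuous_trig_sum.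
have -> : \int[mu]_(p in D) u p = \int[mu]_(p in D) (cst 1 p * u p).
  by apply: eq_Rintegral => p _; rewrite mul1r.
rewrite (_ : (fun n => _) = (fun n => \int[mu]_(p in D) (trig_sum a b one_coef n p * u p)))//.
apply/funext => n.
rewrite -trig_sum_laplace_eig_torsion (weak_solution_trig_sum a0 b0 torsion_coef n wu c1) -Rintegral_trig_sum.
by apply: eq_Rintegral => p _; rewrite mul1r.
Qed.

(** Up to constants the left side is [m] or [n] over [m n (m^2 + n^2)], homogeneous of degree -3;
    sharing this degree equally between [m] and [n] gives summable weights of exponent 3/2. *)
Let torsion_coef_bound : exists2 K : R, 0 <= K &
  forall i k l, `|torsion_coef k l| * mode_freq a b i k l <= K * (weight R k * weight R l).
Proof.
pose p : R := pi / (2 * a); pose q : R := pi / (2 * b).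
have pi0 := pi_gt0 R.
have p0 : 0 < p by rewrite divr_gt0// mulr_gt0.
have q0 : 0 < q by rewrite divr_gt0// mulr_gt0.
(* Makes the anisotropic eigenvalue comparable to [m^2 + n^2], whatever the sides. *)
pose r := Num.min (p ^+ 2) (q ^+ 2).
have r0 : 0 < r by rewrite lt_min !exprn_gt0.
have rp : r <= p ^+ 2 by rewrite ge_min lexx.
have rq : r <= q ^+ 2 by rewrite ge_min lexx orbT.
pose C : R := 16 / pi ^+ 2; have C0 : 0 < C by rewrite divr_gt0// exprn_gt0.
exists (C * (p + q) / r).
  by apply: divr_ge0; rewrite ltW// mulr_gt0// addr_gt0.
move=> i k l.
have fk : freq a k = oddr k * p by rewrite /freq -mulrA.
have fl : freq b l = oddr l * q by rewrite /freq -mulrA.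
have coefn j : `|mode_coef R j| = 4 / (oddr j * pi).
  rewrite /mode_coef !normrM normfV normrM (ger0_norm (ltW pi0)) (ger0_norm (ltW (oddr_gt0 R j))).
  rewrite (_ : `|sin _| = 1) ?normr_nat ?mulr1//.
  by apply/eqP; rewrite -sqrp_eq1// real_normK ?num_real// (cos_sin_oddr R j).2.
have e : `|torsion_coef k l| = C / (oddr k * oddr l) / laplace_eig a b k l.
  rewrite /torsion_coef /one_coef normrM normfV (gtr0_norm (laplace_eig_gt0 k l)) normrM !coefn.
  congr (_ / _); rewrite /C; move: (oddr_neq0 R k) (oddr_neq0 R l).
  move: (oddr k) (oddr l) (pi : R) pi0 => x y P P0 x0 y0.
  by field; rewrite x0 y0 gt_eqF.
have sk := sqr_sqrtr (ltW (oddr_gt0 R k)); have sl := sqr_sqrtr (ltW (oddr_gt0 R l)).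
have x0 := sqrt_oddr_gt0 R k; have y0 := sqrt_oddr_gt0 R l.
rewrite e /laplace_eig /mode_freq /weight fk fl.
have -> : freq (half_width a b i) (if i then l else k) = if i then oddr l * q else oddr k * p.
  by case: i.
move: (Num.sqrt (oddr k)) (Num.sqrt (oddr l)) sk sl x0 y0 => x y <- <- x0 y0.
have xn0 : x != 0 by rewrite gt_eqF.
have yn0 : y != 0 by rewrite gt_eqF.
set E := (x ^+ 2 * p) ^+ 2 + (y ^+ 2 * q) ^+ 2.
have rE : r * (x ^+ 4 + y ^+ 4) <= E.
  have -> : E = p ^+ 2 * x ^+ 4 + q ^+ 2 * y ^+ 4 by rewrite /E; ring.
  by rewrite mulrDr; apply: lerD; rewrite ler_wpM2r// exprn_ge0// ltW.
have xy0 : 0 < x ^+ 4 + y ^+ 4 by rewrite addr_gt0// exprn_gt0.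
have E0 : 0 < E by rewrite (lt_le_trans _ rE)// mulr_gt0.
have rn0 : r != 0 by rewrite gt_eqF.
have En0 : E != 0 by rewrite gt_eqF.
(* Here [x] and [y] are the square roots of the odd integers, so all exponents are integral; what
   remains is [x^3 y <= x^4 + y^4] and its mirror image. *)
have key : r * (x ^+ 3 * y ^+ 3 * (if i then y ^+ 2 * q else x ^+ 2 * p)) <=
   (p + q) * (x ^+ 2 * y ^+ 2) * E.
  have xy : 0 <= x * y by rewrite mulr_ge0// ltW.
  have d (s t : R) : 0 < s -> 0 < t -> s ^+ 3 * t <= s ^+ 4 + t ^+ 4.
    move=> s0 t0; rewrite !(exprSr _ 3); have [st|ts] := leP s t.
      rewrite ler_wpDl ?mulr_ge0 ?exprn_ge0 ?(ltW s0)//.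
      by rewrite ler_pM2r// lerXn2r// nnegrE ltW.
    by rewrite ler_wpDr ?mulr_ge0 ?exprn_ge0 ?(ltW t0)// ler_pM2l ?exprn_gt0// ltW.
  have d1 := d x y x0 y0.
  have d2 : x * y ^+ 3 <= x ^+ 4 + y ^+ 4 by rewrite mulrC addrC; exact: d.
  have xy2 : 0 <= x ^+ 2 * y ^+ 2 by rewrite mulr_ge0// sqr_ge0.
  apply: (@le_trans _ _ ((p + q) * (x ^+ 2 * y ^+ 2) * (r * (x ^+ 4 + y ^+ 4)))); last first.
    by apply: ler_wpM2l => //; rewrite mulr_ge0// addr_ge0// ltW.
  rewrite [leRHS](_ : _ = r * (x ^+ 2 * y ^+ 2 * ((p + q) * (x ^+ 4 + y ^+ 4)))); last by ring.
  rewrite ler_pM2l//; case: (i).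
    rewrite [leLHS](_ : _ = x ^+ 2 * y ^+ 2 * (q * (x * y ^+ 3))); last by ring.
    apply: ler_wpM2l => //; apply: ler_pM => //; first exact: ltW.
      by rewrite mulr_ge0 ?exprn_ge0// ltW.
    by rewrite lerDr ltW.
  rewrite [leLHS](_ : _ = x ^+ 2 * y ^+ 2 * (p * (x ^+ 3 * y))); last by ring.
  apply: ler_wpM2l => //; apply: ler_pM => //; first exact: ltW.
    by rewrite mulr_ge0 ?exprn_ge0// ltW.
  by rewrite lerDl ltW.
set w := if i then _ else _ in key *.
have -> : C / (x ^+ 2 * y ^+ 2) / E * w =
    C / (r * (x ^+ 2 * y ^+ 2) * E * (x ^+ 3 * y ^+ 3)) * (r * (x ^+ 3 * y ^+ 3 * w)).
  by field; rewrite En0 yn0 xn0 rn0.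
have -> : C * (p + q) / r * (x ^- 3 * y ^- 3) =
    C / (r * (x ^+ 2 * y ^+ 2) * E * (x ^+ 3 * y ^+ 3)) * ((p + q) * (x ^+ 2 * y ^+ 2) * E).
  by field; rewrite En0 yn0 xn0 rn0.
apply: ler_wpM2l => //.
by rewrite divr_ge0 ?(ltW C0)// !mulr_ge0 ?exprn_ge0// ltW.
Qed.

Lemma torsion_exists : exists u, weak_solution D u (cst 1).
Proof.
have [K K0 tK] := torsion_coef_bound.
have mass i N : freq_mass a b i torsion_coef N <= 4 * K.
  apply: le_trans (square_sum_weight_le N K0).
  by apply: ler_sum => k _; apply: ler_sum => l _; exact: tK.
(* The lowest frequency: dividing by it turns the bound on the gradient coefficients into one on the
   coefficients themselves. *)
pose m := freq a 0; have m0 : 0 < m by exact: freq_gt0.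
have coefK k l : `|torsion_coef k l| <= K / m * (weight R k * weight R l).
  rewrite mulrAC ler_pdivlMr//; apply: le_trans (tK false k l).
  rewrite ler_wpM2l// /m /mode_freq /freq /=.
  rewrite ler_pM2r ?invr_gt0 ?mulr_gt0// ler_pM2r ?pi_gt0// ler_nat.
  by rewrite ltnS leq_double.
have cu (p : R * R) : cvgn (trig_sum a b torsion_coef ^~ p).
  apply: (@square_sum_cvg _ _ (K / m)); first by rewrite divr_ge0// ltW.
  move=> k l; rewrite normrM; apply: le_trans (coefK k l).
  by rewrite ler_piMr// normrM mulr_ile1// mode_norm.
have cg i (p : R * R) : cvgn (dtrig_sum a b i torsion_coef ^~ p).
  apply: (@square_sum_cvg _ _ K) => // k l; rewrite normrM.
  by apply: le_trans (tK i k l); rewrite ler_wpM2l// dmode2_bound.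
pose u p := limn (trig_sum a b torsion_coef ^~ p).
pose g i p := limn (dtrig_sum a b i torsion_coef ^~ p).
exists u; exists g.
  by apply: (@H10_trig_sum_lim R a b a0 b0 torsion_coef id u g (4 * K)).
move=> phi tphi.
have cphi := test_function_continuous tphi.
have l1 : \sum_(i : bool) \int[mu]_(p in D) (dtrig_sum a b i torsion_coef n p * partial i phi p)
    @[n --> \oo] --> \sum_(i : bool) \int[mu]_(p in D) (g i p * partial i phi p).
  apply: (@cvg_sum_bool R (fun i n => \int[mu]_(p in D) (dtrig_sum a b i torsion_coef n p * partial i phi p))) => i.
  have cdphi := test_function_partial (i := i) tphi.
  apply: (@bounded_cvg_integralM R a b a0 b0 _ _ _ (4 * K)).
  - by move=> n; apply: continuous_rectangle_measurable; exact: continuous_dtrig_sum.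
  - by move=> n p _; apply: le_trans (mass i n); exact: dtrig_sum_bound.
  - by move=> p _; have := cg i p.
  - exact: continuous_rectangle_measurable.
  - exact: continuous_rectangle_bounded.
(* The expansion of 1 does not converge absolutely, so this side passes to the limit in L^2, unlike
   the gradient side. *)
have l2 : \int[mu]_(p in D) (trig_sum a b one_coef n p * phi p) @[n --> \oo] -->
    \int[mu]_(p in D) (cst 1 p * phi p).
  apply: (L2_cvgM mD); last exact: trig_sum_one_cvg.
  - by move=> n; apply: (continuous_rectangle_L2 a0 b0); exact: continuous_trig_sum.
  - exact: L2_cst.
  - exact: test_function_L2.
have id i n : mu.-integrable D (EFin \o (fun p : plane R => dtrig_sum a b i torsion_coef n p * partial i phi p)).
  apply: (L2_integrableM mD); last exact: test_function_partial_L2.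
  by apply: (continuous_rectangle_L2 a0 b0); exact: continuous_dtrig_sum.
have ig i : mu.-integrable D (EFin \o (fun p : plane R => g i p * partial i phi p)).
  apply: (L2_integrableM mD); last exact: test_function_partial_L2.
  have [|||mg gM _] := @bounded_cvg_integral R D mD fD (fun n => dtrig_sum a b i torsion_coef n) (g i) (4 * K).
  - by move=> n; apply: continuous_rectangle_measurable; exact: continuous_dtrig_sum.
  - by move=> n p _; apply: le_trans (mass i n); exact: dtrig_sum_bound.
  - by move=> p _; have := cg i p.
  exact: (bounded_L2 mD fD mg gM).
rewrite Rintegral_sum_bool//.
have e : (fun n => \sum_(i : bool) \int[mu]_(p in D) (dtrig_sum a b i torsion_coef n p * partial i phi p)) =
    (fun n => \int[mu]_(p in D) (trig_sum a b one_coef n p * phi p)).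
  apply/funext => n; rewrite -Rintegral_sum_bool//.
  by rewrite trig_sum_weak// trig_sum_laplace_eig_torsion.
rewrite e in l1.
by rewrite -[LHS](cvg_lim (@Rhausdorff R) l1) -[RHS](cvg_lim (@Rhausdorff R) l2).
Qed.

Lemma torsional_rigidity_cvg :
  square_sum (fun k l => torsion_coef k l * ((a * mode_coef R k) * (b * mode_coef R l))) n
    @[n --> \oo] --> torsional_rigidity D.
Proof.
apply: torsion_integral_cvg.
rewrite /torsion_function; case: xgetP => [u _ //|].
by have [u wu] := torsion_exists => /(_ u).
Qed.

End torsion.

Section eigenvalue.
Variables (R : realType) (a b : R).
Hypotheses (a0 : 0 < a) (b0 : 0 < b).
Notation D := (rectangle a b : set (plane R)).
Notation mu := (@area R).
Notation side := (half_width a b).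

Let mD := measurable_rectangle a b.
Let fD := area_rectangle_lty a0 b0.

(* Riccati substitution: with [w t = k * tan (k * t)] one has [w' = k^2 + w^2],
   so [(phi')^2 - k^2 phi^2 = (phi' + w phi)^2 - (w phi^2)']. The quotient
   [T] below is a globally continuous extension of the tangent. *)
Lemma poincare_lt i (k : R) phi : 0 < k -> k * side i < pi / 2 ->
  test_function D phi ->
  k ^+ 2 * \int[mu]_(p in D) (phi p ^+ 2) <=
  \int[mu]_(p in D) (partial i phi p ^+ 2).
Proof.
move=> k0 kpi tphi; have s0 := half_width_gt0 a0 b0 i.
have cphi := test_function_continuous tphi.
have cdphi := test_function_partial (i := i) tphi.
have dphi := test_function_derivable (i := i) tphi.
have ks0 : 0 < k * side i by rewrite mulr_gt0.
have pi0 := pi_gt0 R.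
(* The least value of the cosine on the segment: the maximum with [d] changes nothing there and
   keeps the denominator positive elsewhere. *)
pose d := cos (k * side i).
have d0 : 0 < d by apply: cos_gt0_pihalf; lra.
have cosd t : t \in `[(- side i), side i] -> d <= cos (k * t).
  rewrite in_itv/= => /andP[t1 t2]; rewrite /d -(cos_norm (k * t)).
  have h : `|k * t| <= k * side i.
    by rewrite normrM (gtr0_norm k0) ler_pM2l// ler_norml t1.
  have n0 := normr_ge0 (k * t).
  move: h; rewrite le_eqVlt => /predU1P[->//|h]; apply: ltW.
  by rewrite ltr_cos// in_itv/=; lra.
pose T t : R := sin (k * t) / Num.max (cos (k * t)) d.
have m0 t : 0 < Num.max (cos (k * t)) d by rewrite lt_max d0 orbT.
have ck : continuous (fun t : R => k * t).
  by move=> t; apply: continuousM => //; exact: cvg_cst.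
have cT : continuous T.
  move=> t; apply: (@continuousM _ _ (fun t => sin (k * t)) (fun t => (Num.max (cos (k * t)) d)^-1)).
    by apply: (@continuous_comp _ _ _ (fun t => k * t) sin); [exact: ck|exact: continuous_sin].
  apply: (@continuousV _ _ (fun t => Num.max (cos (k * t)) d)); first by rewrite gt_eqF.
  apply: (@continuous_max _ _ (fun t => cos (k * t)) (cst d)).
    by apply: (@continuous_comp _ _ _ (fun t => k * t) cos); [exact: ck|exact: continuous_cos].
  exact: cvg_cst.
have Ttan t : t \in `[(- side i), side i] -> T t = tan (k * t).
  by move=> /cosd h; rewrite /T /tan max_l.
pose Tc p := T (coordinate i p).
have cTc : continuous Tc.
  move=> p; apply: (@continuous_comp _ _ _ (coordinate i) T); first exact: continuous_coord.
  exact: cT.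
pose F p := k * tan (k * coordinate i p) * phi p ^+ 2.
pose f p := k ^+ 2 * (1 + Tc p ^+ 2) * phi p ^+ 2 + 2 * k * Tc p * (phi p * partial i phi p).
have cf : continuous f.
  have c1 : continuous (fun p => phi p ^+ 2) by move=> p; apply: continuousM; exact: cphi.
  have c2 : continuous (fun p => phi p * partial i phi p).
    by move=> p; apply: continuousM; [exact: cphi|exact: cdphi].
  have c3 : continuous (fun p => k ^+ 2 * (1 + Tc p ^+ 2)).
    move=> p; apply: (@continuousM _ _ (cst (k ^+ 2)) (fun p => 1 + Tc p ^+ 2)).
      exact: cvg_cst.
    have cT2 : {for p, continuous (fun p => Tc p ^+ 2)} by apply: continuousM; exact: cTc.
    have c1p : {for p, continuous (cst (1 : R) : R * R -> R)} by exact: cvg_cst.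
    exact: (continuousD c1p cT2).
  have c4 : continuous (fun p => 2 * k * Tc p).
    by move=> p; apply: (@continuousM _ _ (cst (2 * k)) Tc); [exact: cvg_cst|exact: cTc].
  by move=> p; exact: (continuousD (continuousM (@c3 p) (@c1 p)) (continuousM (@c4 p) (@c2 p))).
have f0 : \int[mu]_(p in D) f p = 0.
  have [M fM] := continuous_rectangle_bounded a b cf.
  apply: (@Rintegral_partial0 R a b a0 b0 i F f M) => //.
  - exact: continuous_rectangle_measurable.
  - move=> s t sI tI; have c0 : cos (k * t) != 0.
      by rewrite gt_eqF// (lt_le_trans d0)// cosd.
    have d1 : is_derive t 1 (fun t => tan (k * t)) ((cos (k * t)) ^- 2 * k).
      apply: is_derive_eq (@is_derive1_comp _ tan (fun t => k * t) t _ _ (is_derive_tan c0) _) _.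
      by rewrite /GRing.scale/= mulr1.
    have d2 := is_derive_slice (dphi (slice i s t)).
    rewrite (_ : (fun t => F (slice i s t)) = (fun t => k * tan (k * t) *
        (phi (slice i s t) * phi (slice i s t)))); last first.
      by apply/funext => x; rewrite /F coord_slice expr2.
    apply: is_derive_eq.
    rewrite /f /Tc coord_slice Ttan// -cos2_tan2// /GRing.scale/=.
    by ring.
  - by move=> s sI; apply: continuous_subspaceT; exact: (@continuous_slice R i f s cf).
  - move=> s sI; have [h1 h2] := slice_side_out a b i s.
    by rewrite /F !(test_function0 tphi)// expr0n/= !mulr0.
have sq (g : R * R -> R) : continuous g -> continuous (fun p => g p ^+ 2).
  by move=> cg p; apply: continuousM; exact: cg.
have int (g : R * R -> R) : continuous g -> mu.-integrable D (EFin \o (g : plane R -> R)).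
  exact: continuous_rectangle_integrable.
have ckp : continuous (fun p => k ^+ 2 * phi p ^+ 2).
  move=> p; apply: (@continuousM _ _ (cst (k ^+ 2)) (fun p => phi p ^+ 2)).
    exact: cvg_cst.
  exact: sq.
rewrite -RintegralZl//; last exact: (int _ (sq _ cphi)).
rewrite -[leRHS]addr0 -f0 -RintegralD//; [|exact: (int _ (sq _ cdphi))|exact: int].
apply: le_Rintegral => //; first exact: int.
  apply: (int (fun p => partial i phi p ^+ 2 + f p)) => p.
  exact: (continuousD (@sq _ cdphi p) (@cf p)).
move=> p _; have := sqr_ge0 (partial i phi p + k * Tc p * phi p).
rewrite /f; move: (partial i phi p) (Tc p) (phi p) => x y z h.
rewrite -subr_ge0 (_ : _ - _ = (x + k * y * z) ^+ 2)//; ring.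
Qed.

(** At the sharp constant the tangent blows up at the sides, so the strict version is applied to
    [s * freq] with [s < 1], and [s] is then chosen close to 1. *)
Lemma poincare i phi : test_function D phi ->
  freq (side i) 0 ^+ 2 * \int[mu]_(p in D) (phi p ^+ 2) <=
  \int[mu]_(p in D) (partial i phi p ^+ 2).
Proof.
move=> tphi; have s0 := half_width_gt0 a0 b0 i.
have f0 := freq_gt0 0 s0.
set X := \int[mu]_(p in D) (phi p ^+ 2); set Y := \int[mu]_(p in D) _.
have X0 : 0 <= X by apply: Rintegral_ge0 => p _; exact: sqr_ge0.
have Y0 : 0 <= Y by apply: Rintegral_ge0 => p _; exact: sqr_ge0.
have h (s : R) : 0 < s -> s < 1 -> s ^+ 2 * (freq (side i) 0 ^+ 2 * X) <= Y.
  move=> s0' s1; rewrite mulrA -exprMn; apply: poincare_lt => //.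
    by rewrite mulr_gt0.
  rewrite -mulrA freq_mul// oddrE mulr0 add0r mul1r.
  by rewrite gtr_pMl// divr_gt0// pi_gt0.
rewrite leNgt; apply/negP; set Z := _ * X in h * => YZ.
have Z0 : 0 < Z by apply: le_lt_trans YZ.
pose t := Y / Z; have t0 : 0 <= t by rewrite divr_ge0// ltW.
have t1 : t < 1 by rewrite ltr_pdivrMr// mul1r.
have YE : Y = t * Z by rewrite divfK// gt_eqF.
(* If [Y = t Z] with [t < 1], then [s = (1 + t) / 2] is below 1 and [s^2 - t = ((1 - t) / 2)^2] is
   positive, a contradiction. *)
have /h : 0 < (1 + t) / 2 by lra.
have -> : (1 + t) / 2 < 1 by lra.
move=> /(_ isT); rewrite YE ler_pM2r// leNgt => /negP; apply.
rewrite -subr_gt0 (_ : _ - t = ((1 - t) / 2) ^+ 2); last by field.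
by rewrite exprn_gt0// divr_gt0// subr_gt0.
Qed.

Lemma L2_cvg_sqr (fn : nat -> plane R -> R) (f : plane R -> R) :
  (forall n, L2 D (fn n)) -> L2 D f ->
  \int[mu]_(p in D) ((fn n p - f p) ^+ 2) @[n --> \oo] --> (0 : R) ->
  \int[mu]_(p in D) (fn n p ^+ 2) @[n --> \oo] --> \int[mu]_(p in D) (f p ^+ 2).
Proof.
move=> fn2 f2 fnf.
have h : 2 * \int[mu]_(p in D) (fn n p * f p) @[n --> \oo] -->
    2 * \int[mu]_(p in D) (f p * f p).
  by apply: cvgM; [exact: cvg_cst|exact: L2_cvgM].
have e n : \int[mu]_(p in D) (fn n p ^+ 2) = \int[mu]_(p in D) ((fn n p - f p) ^+ 2) +
    2 * \int[mu]_(p in D) (fn n p * f p) - \int[mu]_(p in D) (f p ^+ 2).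
  have i1 : mu.-integrable D (EFin \o (fun p => (fn n p - f p) ^+ 2)).
    by apply: L2_sqr_integrable; exact: L2B.
  have i2 := L2_integrableM mD (fn2 n) f2.
  have i2' : mu.-integrable D (EFin \o (fun p => 2 * (fn n p * f p))).
    rewrite (_ : EFin \o _ = (fun p => 2%:E * (EFin \o (fun p => fn n p * f p)%R) p)%E).
      exact: integrableZl.
    by apply/funext => p; rewrite /= EFinM.
  rewrite -RintegralZl// -RintegralD// -RintegralB//; last exact: L2_sqr_integrable.
    by apply: eq_Rintegral => p _; ring.
  rewrite (_ : EFin \o _ = (EFin \o (fun p => (fn n p - f p) ^+ 2)%R) \+
    (EFin \o (fun p => 2 * (fn n p * f p))%R))%E//.
  exact: integrableD.
rewrite (_ : (fun n => _) = (fun n => \int[mu]_(p in D) ((fn n p - f p) ^+ 2) +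
    2 * \int[mu]_(p in D) (fn n p * f p) - \int[mu]_(p in D) (f p ^+ 2))); last first.
  by apply/funext => n; exact: e.
have c : \int[mu]_(p in D) (f p ^+ 2) @[n --> \oo] --> \int[mu]_(p in D) (f p ^+ 2).
  exact: cvg_cst.
have e2 : 0 + 2 * \int[mu]_(p in D) (f p * f p) - \int[mu]_(p in D) (f p ^+ 2) =
    \int[mu]_(p in D) (f p ^+ 2).
  have -> : \int[mu]_(p in D) (f p * f p) = \int[mu]_(p in D) (f p ^+ 2).
    by apply: eq_Rintegral => p _; rewrite expr2.
  by ring.
by rewrite -[X in _ --> X]e2; apply: cvgB => //; exact: (cvgD fnf h).
Qed.

Lemma H10_poincare u g : H10 D u g ->
  laplace_eig a b 0 0 * \int[mu]_(p in D) (u p ^+ 2) <=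
  \sum_(i : bool) \int[mu]_(p in D) (g i p * g i p).
Proof.
move=> /[dup] -[[u2 g2 _] _] /(H10_approximants a0 b0)[phi [tphi cphi cdphi]].
have l1 : laplace_eig a b 0 0 * \int[mu]_(p in D) (phi n p ^+ 2) @[n --> \oo] -->
    laplace_eig a b 0 0 * \int[mu]_(p in D) (u p ^+ 2).
  apply: cvgM; first exact: cvg_cst.
  by apply: L2_cvg_sqr => // n; exact: (test_function_L2 a0 b0).
have l2 : \sum_(i : bool) \int[mu]_(p in D) (partial i (phi n) p ^+ 2) @[n --> \oo] -->
    \sum_(i : bool) \int[mu]_(p in D) (g i p ^+ 2).
  apply: (@cvg_sum_bool R (fun i n => \int[mu]_(p in D) (partial i (phi n) p ^+ 2))) => i.
  by apply: L2_cvg_sqr => // n; exact: (test_function_partial_L2 a0 b0).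
rewrite (eq_bigr (fun i => \int[mu]_(p in D) (g i p ^+ 2))); last first.
  by move=> i _; apply: eq_Rintegral => p _; rewrite expr2.
rewrite -[leLHS](cvg_lim (@Rhausdorff R) l1) -[leRHS](cvg_lim (@Rhausdorff R) l2).
apply: ler_lim; [exact: cvgP l1|exact: cvgP l2|apply: nearW => n].
rewrite big_bool /laplace_eig mulrDl addrC; apply: lerD.
  exact: (poincare true (tphi n)).
exact: (poincare false (tphi n)).
Qed.

(** Testing the eigenvalue equation with its own eigenfunction makes [l] a Rayleigh quotient; its
    denominator is positive because [u] is not almost everywhere 0. *)
Lemma dirichlet_eigenvalue_ge l : dirichlet_eigenvalue D l -> laplace_eig a b 0 0 <= l.
Proof.
move=> [u [g ug uf] un0]; have [[u2 g2 _] _] := ug.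
have lu2 : L2 D (fun p => l * u p) by exact: L2Z.
have := weak_solution_test a0 b0 ug lu2 uf ug.
have := H10_poincare ug => /[swap] ->.
have -> : \int[mu]_(p in D) (l * u p * u p) = l * \int[mu]_(p in D) (u p ^+ 2).
  rewrite -RintegralZl//; last exact: L2_sqr_integrable.
  by apply: eq_Rintegral => p _; rewrite -mulrA expr2.
rewrite ler_pM2r// lt_neqAle Rintegral_ge0 ?andbT; last by move=> p _; exact: sqr_ge0.
apply/negP => /eqP U0; apply: un0.
have i2 := L2_sqr_integrable u2.
have mu2 : measurable_fun D (EFin \o (fun p => u p ^+ 2)) by case/integrableP: i2.
have : (\int[mu]_(p in D) `|(EFin \o (fun p => u p ^+ 2)%R) p| = 0)%E.
  transitivity (\int[mu]_(p in D) (u p ^+ 2)%:E)%E.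
    by apply: eq_integral => p _ /=; rewrite ger0_norm// sqr_ge0.
  by rewrite -[LHS]fineK ?(integrable_fin_num mD i2)//; congr EFin.
move/(ae_eq_integral_abs mu mD mu2); apply: filterS => p /= h Dp.
by have /eqP := h Dp; rewrite eqe sqrf_eq0 => /eqP.
Qed.

(** The eigenfunction is the product of the two lowest modes, written as a one-term trigonometric
    sum. That it is not almost everywhere 0 is read off its nonzero integral. *)
Lemma dirichlet_eigenvalue_laplace_eig : dirichlet_eigenvalue D (laplace_eig a b 0 0).
Proof.
pose A (k l : nat) : R := 1.
have tE B p : trig_sum a b B 1 p = B 0%N 0%N * mode2 a b 0 0 p.
  by rewrite /trig_sum /square_sum !big_ord1.
exists (trig_sum a b A 1).
  exists (fun i => dtrig_sum a b i A 1); first exact: H10_trig_sum.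
  move=> phi tphi; rewrite trig_sum_weak//; apply: eq_Rintegral => p _.
  by rewrite !tE mulr1 mul1r.
move=> ae0.
have : \int[mu]_(p in D) trig_sum a b A 1 p = 0.
  have -> : \int[mu]_(p in D) trig_sum a b A 1 p = \int[mu]_(p in D) cst 0 p.
    congr fine; apply: ae_eq_integral => //.
      apply/measurable_EFinP; apply: continuous_rectangle_measurable.
      exact: continuous_trig_sum.
    by apply/measurable_EFinP; exact: measurable_cst.
    case: ae0 => N [mN N0 sN]; exists N; split => // p /= h; apply: sN => /= h'.
    by apply: h => Dp; rewrite h'.
  by rewrite Rintegral_cst// mul0r.
rewrite Rintegral_trig_sum// /square_sum !big_ord1 /= mul1r.
have c0 : mode_coef R 0 != 0.
  rewrite -sqrf_eq0 sqr_mode_coefE gt_eqF// mulr_gt0 ?invr_gt0 ?oddr2_gt0//.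
  by rewrite divr_gt0// exprn_gt0// pi_gt0.
by move: (mode_coef R 0) c0 => c c0 /eqP; rewrite !mulf_eq0 (gt_eqF a0) (gt_eqF b0) (negbTE c0).
Qed.

Lemma lambda1_rectangle : lambda1 D = laplace_eig a b 0 0.
Proof.
rewrite /lambda1; case: xgetP => [l _ [el lmin]|].
  apply/eqP; rewrite eq_le; apply/andP; split.
    exact: lmin dirichlet_eigenvalue_laplace_eig.
  exact: dirichlet_eigenvalue_ge.
move=> /(_ (laplace_eig a b 0 0)) []; split; first exact: dirichlet_eigenvalue_laplace_eig.
exact: dirichlet_eigenvalue_ge.
Qed.

End eigenvalue.

(** * The Polya functional of rectangles *)

Section polya_rectangle.
Variable R : realType.
Implicit Types a b : R.

(** This is [t / (1 + t)^2] for [t = (a / b)^2], in a form that is visibly symmetric in the two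
    sides. *)
Definition aspect a b : R := a ^+ 2 * b ^+ 2 / (a ^+ 2 + b ^+ 2) ^+ 2.

Lemma aspect_gt0 a b : 0 < a -> 0 < b -> 0 < aspect a b.
Proof. by move=> a0 b0; rewrite divr_gt0 ?mulr_gt0 ?exprn_gt0// addr_gt0 ?exprn_gt0. Qed.

(** The two squared coefficients contribute [(16 / pi^2)^2] and the area [4 a b] a factor 1/4, hence
    64. In the quotient of eigenvalues [pi] cancels, and only [t] remains of the sides. *)
Lemma polya_rectangleE a b : 0 < a -> 0 < b ->
  polya (rectangle a b) = 64 / pi ^+ 4 * lattice_lim (aspect a b).
Proof.
move=> a0 b0; pose t := (a / b) ^+ 2.
have an0 : a != 0 by rewrite gt_eqF.
have bn0 : b != 0 by rewrite gt_eqF.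
have t0 : 0 < t by rewrite exprn_gt0// divr_gt0.
have ab0 : a ^+ 2 + b ^+ 2 != 0 by rewrite gt_eqF// addr_gt0// exprn_gt0.
have tE : t / (1 + t) ^+ 2 = aspect a b.
  by rewrite /t /aspect; field; rewrite ab0 bn0.
have l1 := torsional_rigidity_cvg a0 b0.
have l2 := lattice_lim_cvg (ltW (aspect_gt0 a0 b0)).
have c1 : laplace_eig a b 0 0 / (4 * (a * b)) *
    square_sum (fun k l => torsion_coef a b k l * ((a * mode_coef R k) * (b * mode_coef R l))) n @[n --> \oo] -->
    laplace_eig a b 0 0 / (4 * (a * b)) * torsional_rigidity (rectangle a b).
  exact: (cvgM (cvg_cst _) l1).
have c2 : 64 / pi ^+ 4 * lattice_sum (aspect a b) n @[n --> \oo] -->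
    64 / pi ^+ 4 * lattice_lim (aspect a b).
  exact: (cvgM (cvg_cst _) l2).
rewrite /polya (lambda1_rectangle a0 b0).
rewrite (_ : fine _ = 4 * (a * b)); last exact: (congr1 fine (area_rectangle a0 b0)).
rewrite mulrAC; suff e : (fun n => laplace_eig a b 0 0 / (4 * (a * b)) *
    square_sum (fun k l => torsion_coef a b k l * ((a * mode_coef R k) * (b * mode_coef R l))) n) =
    (fun n => 64 / pi ^+ 4 * lattice_sum (aspect a b) n).
  rewrite e in c1.
  by rewrite -[LHS](cvg_lim (@Rhausdorff R) c1) -[RHS](cvg_lim (@Rhausdorff R) c2).
apply/funext => n.
rewrite -tE -lattice_sumE// /square_sum !mulr_sumr; apply: eq_bigr => k _.
rewrite !mulr_sumr; apply: eq_bigr => l _.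
rewrite /torsion_coef /one_coef.
have -> : laplace_eig a b 0 0 / (4 * (a * b)) * (mode_coef R k * mode_coef R l / laplace_eig a b k l *
    (a * mode_coef R k * (b * mode_coef R l))) =
    laplace_eig a b 0 0 * (mode_coef R k ^+ 2 * mode_coef R l ^+ 2) / (4 * laplace_eig a b k l).
  have := laplace_eig_gt0 a0 b0 k l; move: (laplace_eig a b k l) (mode_coef R k) (mode_coef R l) => e x y e0.
  by field; rewrite an0 bn0 gt_eqF.
rewrite !sqr_mode_coefE /laplace_eig /freq !oddrE mulr0 add0r -!oddrE.
move: (oddr_gt0 R k) (oddr_gt0 R l) (pi_gt0 R).
move: (oddr R k) (oddr R l) (pi : R) => x y P x0 y0 P0.
have d1 : (x * b) ^+ 2 + (y * a) ^+ 2 != 0 by rewrite gt_eqF// addr_gt0// exprn_gt0// mulr_gt0.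
have d2 : (x * P * b) ^+ 2 + (y * P * a) ^+ 2 != 0.
  by rewrite gt_eqF// addr_gt0// exprn_gt0// !mulr_gt0.
rewrite /t; field.
by rewrite d1 d2 (gt_eqF x0) (gt_eqF y0) (gt_eqF P0) an0 bn0.
Qed.

Lemma aspect11 : aspect 1 1 = 1 / 4.
Proof. by rewrite /aspect !expr1n; field. Qed.

Lemma aspect_le a b : 0 < a -> 0 < b -> aspect a b <= 1 / 4.
Proof.
move=> a0 b0; rewrite /aspect ler_pdivrMr ?exprn_gt0 ?addr_gt0 ?exprn_gt0//.
by have := sqr_ge0 (a ^+ 2 - b ^+ 2); nra.
Qed.

Lemma aspect_decr a a' : 1 <= a -> a < a' -> aspect a' 1 < aspect a 1.
Proof.
move=> a1 aa'; rewrite /aspect expr1n !mulr1.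
have s1 : 1 <= a ^+ 2 by rewrite exprn_ege1.
have ss' : a ^+ 2 < a' ^+ 2 by rewrite ltr_sqr ?nnegrE//; lra.
move: (a ^+ 2) (a' ^+ 2) s1 ss' => s s' s1 ss'.
rewrite ltr_pdivrMr ?exprn_gt0//; last by lra.
rewrite mulrAC ltr_pdivlMr ?exprn_gt0//; last by lra.
(* The second factor is where [1 <= a] enters: it makes the product [s s'] exceed 1. *)
rewrite -subr_gt0 (_ : _ - _ = (s' - s) * (s * s' - 1)); last by ring.
by rewrite mulr_gt0//; nra.
Qed.

Lemma lattice_const_gt0 : 0 < 64 / pi ^+ 4 :> R.
Proof. by rewrite divr_gt0// exprn_gt0// pi_gt0. Qed.

Lemma lattice_const_mul : 64 / pi ^+ 4 * (pi ^+ 6 / 768) = pi ^+ 2 / 12 :> R.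
Proof.
have := pi_gt0 R; move: (pi : R) => P P0.
by field; rewrite gt_eqF.
Qed.

Lemma polya_rectangle_lt a b : 0 < a -> 0 < b -> polya (rectangle a b) < pi ^+ 2 / 12.
Proof.
move=> a0 b0; rewrite polya_rectangleE// -lattice_const_mul.
rewrite ltr_pM2l ?lattice_const_gt0// -lattice_lim0.
by apply: lattice_lim_decr => //; exact: aspect_gt0.
Qed.

Lemma polya_square_le a b : 0 < a -> 0 < b ->
  polya (rectangle 1 1 : set (R * R)) <= polya (rectangle a b).
Proof.
move=> a0 b0; rewrite !polya_rectangleE// ler_pM2l ?lattice_const_gt0//.
have := aspect_le a0 b0; rewrite -aspect11 le_eqVlt => /predU1P[->//|h].
by apply: ltW; apply: lattice_lim_decr => //; apply: ltW; exact: aspect_gt0.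
Qed.

(** The first term of the series alone gives [64 / pi^4], and this exceeds [pi^2 / 24] as soon as
    [pi^6 < 24 * 64 = 1536]; from [pi^2 <= 10] one gets 1000. *)
Lemma polya_square_gt : pi ^+ 2 / 24 < polya (rectangle 1 1 : set (R * R)).
Proof.
rewrite polya_rectangleE//.
have h : 1 <= lattice_lim (aspect 1 1 : R).
  by apply: lattice_lim_ge1; apply: ltW; exact: aspect_gt0.
apply: (@lt_le_trans _ _ (64 / pi ^+ 4)); last first.
  by rewrite ler_peMr// ltW// lattice_const_gt0.
have p0 : 0 < (pi : R) ^+ 2 by rewrite exprn_gt0// pi_gt0.
have p10 := pi_sqr_le R.
rewrite (exprM _ 2 2); move: (pi ^+ 2 : R) p0 p10 => P P0 P10.
rewrite ltr_pdivlMr ?exprn_gt0// mulrAC ltr_pdivrMr//.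
have -> : P * P ^+ 2 = P ^+ 3 by rewrite -exprS.
apply: (@le_lt_trans _ _ (10 ^+ 3)); first by rewrite lerXn2r// nnegrE ltW.
by rewrite -natrX -natrM ltr_nat.
Qed.

Lemma polya_rectangle_cvg : polya (rectangle a 1) @[a --> +oo] --> (pi ^+ 2 / 12 : R).
Proof.
apply/cvgrPdist_lt => e e0.
have k0 := lattice_const_gt0.
have [|d d0 hd] := @lattice_lim_near0 R (e / (64 / pi ^+ 4)); first by rewrite divr_gt0.
near=> a; have a1 : 1 < a by near: a; exact: nbhs_pinfty_gt.
have ad : d^-1 < a by near: a; apply: nbhs_pinfty_gt; exact: num_real.
have a0 : 0 < a by rewrite (lt_trans _ a1).
have ub := polya_rectangle_lt a0 (ltr01 : 0 < 1 :> R).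
rewrite ger0_norm ?subr_ge0 ?(ltW ub)//.
rewrite polya_rectangleE// -lattice_const_mul -mulrBr mulrC -ltr_pdivlMr//.
rewrite ltrBlDr -ltrBlDl; apply: hd; first by rewrite ltW// aspect_gt0.
(* A crude bound: for [a > 1], [a^2 / (a^2 + 1)^2 <= 1 / a], which is below [d] by the choice of
   [a]. *)
apply: (@le_lt_trans _ _ a^-1); last by rewrite -[d]invrK ltf_pV2 ?posrE ?invr_gt0.
rewrite /aspect expr1n mulr1 ler_pdivrMr ?exprn_gt0 ?addr_gt0 ?exprn_gt0//.
by rewrite ler_pdivlMl//; nra.
Unshelve. all: by end_near. Qed.

End polya_rectangle.

Theorem theorem7p1 (R : realType) :
  [/\ forall a b : R, 0 < a -> 0 < b ->
        [/\ pi ^+ 2 / 24 < polya (rectangle 1 1 : set (R * R)),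
            polya (rectangle 1 1 : set (R * R)) <= polya (rectangle a b) &
            polya (rectangle a b) < pi ^+ 2 / 12],
      polya (rectangle a 1) @[a --> +oo] --> (pi ^+ 2 / 12 : R) &
      forall a a' : R, 1 <= a -> a < a' ->
        polya (rectangle a 1) < polya (rectangle a' 1)].
Proof.
split=> [a b a0 b0||a a' a1 aa'].
- split; [exact: polya_square_gt|exact: polya_square_le|exact: polya_rectangle_lt].
- exact: polya_rectangle_cvg.
- have a0 : 0 < a by exact: lt_le_trans a1.
  have a'0 : 0 < a' by exact: lt_trans aa'.
  rewrite !polya_rectangleE// ltr_pM2l ?lattice_const_gt0//.
  apply: lattice_lim_decr; first by rewrite ltW// aspect_gt0.
  exact: aspect_decr.
Qed.
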